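(* Let $R$ be a commutative Noetherian domain of Krull dimension $d$ and $I$ an ideal of $R$. (1) Let $P$ be a finitely generated projective module over the Rees algebra $A=R[It]$ with $\mathrm{rank}(P)>d$, and let $(b,p)\in\mathrm{Um}(A\oplus P)$. Then there exists $\sigma\in\mathrm{Aut}(A\oplus P)$ with $(b,p)\sigma=(1,0)$. (2) Let $P$ be a finitely generated projective module over the extended Rees algebra $A=R[It,t^{-1}]$ with $\mathrm{rank}(P)>d$, and let $(b,p)\in\mathrm{Um}(A\oplus P)$. Then there exists $\sigma\in\mathrm{Aut}(A\oplus P)$ with $(b,p)\sigma=(1,0)$.
   Context: For an ideal $I$ of $R$ and an indeterminate $t$, the Rees algebra is $R[It]=\bigoplus_{n\geq 0} I^n t^n\subset R[t]$, and the extended Rees algebra is $R[It,t^{-1}]=\bigoplus_{n\in\mathbb{Z}} I^n t^n\subset R[t,t^{-1}]$, where $I^n=R$ for $n\leq 0$. $\mathrm{Um}(A\oplus P)$ is the set of unimodular elements of $A\oplus P$, i.e. elements $v$ with $\{\phi(v):\phi\in\mathrm{Hom}_A(A\oplus P,A)\}=A$. Automorphisms act on row vectors from the right. *)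

(* Defs.v *)
From HB Require Import structures.
From mathcomp Require Import all_boot all_order all_algebra.
From mathcomp Require Import fraction.
Set Implicit Arguments. Unset Strict Implicit. Unset Printing Implicit Defensive.
Import Order.TTheory GRing.Theory Num.Theory.
Local Open Scope ring_scope.

Section Ideals.
Variable R : comNzRingType.

Definition is_ideal (J : R -> Prop) : Prop :=
  [/\ J 0, (forall x y, J x -> J y -> J (x + y)) &
      (forall r x, J x -> J (r * x))].

Definition is_prime_ideal (J : R -> Prop) : Prop :=
  [/\ is_ideal J, ~ J 1 & (forall a b, J (a * b) -> J a \/ J b)].

Definition noetherian : Prop :=
  forall J : nat -> R -> Prop,
    (forall n, is_ideal (J n)) ->
    (forall n x, J n x -> J n.+1 x) ->
    exists N, forall n, (N <= n)%N -> forall x, J n x <-> J N x.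

Definition prime_chain (n : nat) (P : nat -> R -> Prop) : Prop :=
  (forall i, (i <= n)%N -> is_prime_ideal (P i)) /\
  (forall i, (i < n)%N ->
     (forall x, P i x -> P i.+1 x) /\ exists x, P i.+1 x /\ ~ P i x).

Definition krull_dim (d : nat) : Prop :=
  (exists P, prime_chain d P) /\
  (forall n P, prime_chain n P -> (n <= d)%N).

(* n-th power I^n of an ideal I: the ideal generated by products of n
   elements of I (so I^0 = R). *)
Definition ideal_pow (I : R -> Prop) (n : nat) (x : R) : Prop :=
  exists (m : nat) (r : 'I_m -> R) (a : 'I_m -> 'I_n -> R),
    (forall j k, I (a j k)) /\ x = \sum_(j < m) r j * \prod_(k < n) a j k.

End Ideals.

Definition in_rees (R : comNzRingType) (I : R -> Prop) (f : {poly R}) : Prop :=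
  forall i, ideal_pow I i f`_i.

(* The extended Rees algebra R[It, t^-1] as a subset of
   R[t, t^-1] ⊂ Frac(R[t]): elements p / t^k with the coefficient of t^n
   (= p`_(n+k)) in I^n for n > 0 (and arbitrary for n <= 0; note the
   truncated subtraction i - k). *)
Definition in_ext_rees (R : idomainType) (I : R -> Prop)
    (f : {fraction {poly R}}) : Prop :=
  exists (k : nat) (p : {poly R}),
    f = FracField.tofrac p / FracField.tofrac ('X^k) /\ forall i, ideal_pow I (i - k) p`_i.

Section Modules.
Variables (A : idomainType) (P : lmodType A).

(* P is finitely generated projective (a direct summand of A^n via
   f : P -> A^n, g : A^n -> P with g \o f = id) and has rank r, the rank
   being the rank of P ⊗ Frac(A), i.e. the rank over Frac(A) of the
   idempotent endomorphism f \o g of A^n. *)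
Definition fg_projective_of_rank (r : nat) : Prop :=
  exists (n : nat) (f : {linear P -> 'rV[A]_n}) (g : {linear 'rV[A]_n -> P}),
    cancel f g /\
    \rank (map_mx (@FracField.tofrac A) (lin1_mx (f \o g))) = r.

Definition unimodular (v : (A^o * P)%type) : Prop :=
  forall a : A, exists phi : {linear (A^o * P)%type -> A^o}, phi v = a.

Definition is_automorphism (s : {linear (A^o * P)%type -> (A^o * P)%type}) : Prop :=
  bijective s.

End Modules.

(* Main.v *)
(* Let K be the fraction field of R, A the Rees or the extended Rees algebra and
   E an idempotent matrix over A with image P. For s0 <> 0 in I, evaluating X at
   s0 t embeds R[X] in A, with equality after inverting s0 (and t). The module P
   becomes free over K[X], hence there are s <> 0 in R and matrices G, H over A
   with G H = s E and H G = s: after inverting s, P has coordinates, and those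
   of p are polynomials over R up to powers of s (and t).

   A is finitely generated over R[X] inside its fraction field, so its chains of
   primes have length at most d + 1, and at most d above s. As rank P > d,
   elementary automorphisms make p unimodular modulo s. The primes of R[X]
   disjoint from 1 + s'R also form chains of length at most d: with s' = s, and
   then s' = s u1, this gives corrections of the polynomial coordinates whose
   ideals contain some u1 in 1 + s R and some u2 in 1 + s u1 R. One obtains
   products of transvections sigma1 over A[1/(s u1)] and sigma2 over A[1/(s u2)]
   that send (b, p) to (1, 0). They are the values at lambda = 1 of families, got
   by replacing X by lambda X, that agree at lambda = 0. Quillen's patching
   argument turns sigma2 into an automorphism defined both over A[1/u2] and over
   A[1/(s u1)], hence over A since u2 and s u1 are comaximal.

   When every nonzero element of R is a unit, P is free and the row (b, p) is
   completed by elimination over K[X]; when I = 0, A is R or R[1/t]. *)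

Require Import Defs.
From HB Require Import structures.
From mathcomp Require Import all_boot all_order all_algebra.
From mathcomp Require Import fraction perm.
From Stdlib Require Import Classical ClassicalEpsilon.
From mathcomp Require Import ring zify.
Set Implicit Arguments. Unset Strict Implicit. Unset Printing Implicit Defensive.
Import GRing.Theory.
Local Open Scope ring_scope.

(** Two constraints shape the construction. Patching needs the value of sigma2 at lambda = 1 to lose
    its denominator s, although the transvections are found only after inverting s. This is why p is
    first made unimodular modulo s and why later corrections are multiples of s: an ideal that
    contains 1 - s a and s^k u2 contains u2. Hence the square of s in the corrections, one factor
    for this purpose and one for H G = s.

    The other constraint is the agreement at lambda = 0. Only the constant terms of the polynomial
    coordinates survive there, and they must generate a power of s after a correction q0 common to
    both families; the rest of each correction is a multiple of X. For the Rees algebra, putting X =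
    0 in the unimodularity relation and using the stable range of R is enough. For the extended
    algebra the relations hold only up to powers of X and say nothing at X = 0: the constant terms
    are forced by elementary automorphisms that use t^-1. This takes two coordinates, which rank P >
    d >= 1 provides. *)

(** * Noetherian induction, primes and a stable range theorem *)

Section IdealTheory.
Variable C : comNzRingType.
Implicit Types (J Q : C -> Prop) (a b x y : C).

Definition addI J a : C -> Prop := fun x => exists y c, J y /\ x = y + c * a.

Lemma ideal_opp J x : is_ideal J -> J x -> J (- x).
Proof. by case=> _ _ JM Jx; rewrite -mulN1r; apply: JM. Qed.

Lemma ideal_sub J x y : is_ideal J -> J x -> J y -> J (x - y).
Proof. by move=> Ji Jx Jy; case: (Ji) => _ JD _; apply: JD => //; apply: ideal_opp. Qed.

Lemma ideal_mulr J x y : is_ideal J -> J x -> J (x * y).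
Proof. by case=> _ _ JM Jx; rewrite mulrC; apply: JM. Qed.

Lemma ideal_sum J (I : Type) (r : seq I) (p : pred I) (F : I -> C) :
  is_ideal J -> (forall i, p i -> J (F i)) -> J (\sum_(i <- r | p i) F i).
Proof. by case=> J0 JD _ JF; apply: big_ind. Qed.

Lemma ideal_addKl J x y : is_ideal J -> J x -> J (x + y) -> J y.
Proof. by move=> Ji Jx Jxy; rewrite -[y](addKr x) addrC; apply: ideal_sub. Qed.

Lemma addI_ideal J a : is_ideal J -> is_ideal (addI J a).
Proof.
move=> [J0 JD JM]; split.
- by exists 0, 0; rewrite mul0r addr0.
- move=> x y [x1 [c1 [J1 ->]]] [x2 [c2 [J2 ->]]].
  by exists (x1 + x2), (c1 + c2); split; [apply: JD | ring].
- move=> r x [x1 [c1 [J1 ->]]].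
  by exists (r * x1), (r * c1); split; [apply: JM | ring].
Qed.

Lemma addI_sub J a x : J x -> addI J a x.
Proof. by move=> Jx; exists x, 0; rewrite mul0r addr0. Qed.

Lemma addI_gen J a : is_ideal J -> addI J a a.
Proof. by case=> J0 _ _; exists 0, 1; rewrite mul1r add0r. Qed.

Lemma addI_min J Q a : is_ideal Q -> (forall x, J x -> Q x) -> Q a ->
  forall x, addI J a x -> Q x.
Proof.
by move=> [_ QD QM] JQ Qa x [y [c [Jy ->]]]; apply: QD; [apply: (JQ) | apply: (QM)].
Qed.

Definition principal a : C -> Prop := fun x => exists c, x = c * a.

Lemma principal_ideal a : is_ideal (principal a).
Proof.
split; first by exists 0; rewrite mul0r.
- by move=> x y [c ->] [c' ->]; exists (c + c'); rewrite mulrDl.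
- by move=> r x [c ->]; exists (r * c); rewrite mulrA.
Qed.

Lemma principal_gen a : principal a a.
Proof. by exists 1; rewrite mul1r. Qed.

Lemma zero_ideal : is_ideal (fun x : C => x = 0).
Proof. by split=> // [x y -> ->|r x ->]; rewrite ?addr0 ?mulr0. Qed.

Lemma prime_exp Q a k : is_prime_ideal Q -> Q (a ^+ k) -> Q a.
Proof.
case=> _ Q1 QM; elim: k => [|k IH]; first by rewrite expr0.
by rewrite exprS => /QM [].
Qed.

Lemma prime_not1 Q : is_prime_ideal Q -> ~ Q 1.
Proof. by case. Qed.

Hypothesis noeC : noetherian C.

(** Without a maximal member, a choice of strict enlargements iterated from [J0] would give a
    strictly increasing sequence of ideals. *)
Lemma noeth_max (Phi : (C -> Prop) -> Prop) J0 :
  is_ideal J0 -> Phi J0 ->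
  exists J, [/\ is_ideal J, Phi J, (forall x, J0 x -> J x) &
    forall J', is_ideal J' -> Phi J' -> (forall x, J x -> J' x) ->
      forall x, J' x -> J x].
Proof.
move=> J0i J0P; apply: NNPP => nomax.
pose T := {J : C -> Prop | [/\ is_ideal J, Phi J & forall x, J0 x -> J x]}.
have step (t : T) : {t' : T | (forall x, sval t x -> sval t' x) /\
    exists x, sval t' x /\ ~ sval t x}.
  apply: constructive_indefinite_description.
  case: t => J [Ji JP JJ]; apply: NNPP => no; apply: nomax; exists J; split=> //.
  move=> J' Ji' JP' JJ' x J'x; apply: NNPP => nJx; apply: no.
  have H : [/\ is_ideal J', Phi J' & forall x, J0 x -> J' x].
    by split=> // y /JJ /JJ'.
  by exists (exist _ J' H); split=> //=; exists x.
pose t0 : T := exist _ J0 (And3 J0i J0P (fun x H => H)).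
pose F n : T := iter n (fun t => sval (step t)) t0.
have [N stab] := noeC (fun n => let: And3 Ji _ _ := svalP (F n) in Ji)
  (fun n x => (svalP (step (F n))).1 x).
have [_ [x [xN1 xN]]] := svalP (step (F N)).
by apply: xN; apply/(stab N.+1).
Qed.

Lemma noeth_ind (Phi : (C -> Prop) -> Prop) :
  (forall J, is_ideal J ->
     (forall J', is_ideal J' -> (forall x, J x -> J' x) ->
        (exists x, J' x /\ ~ J x) -> Phi J') -> Phi J) ->
  forall J, is_ideal J -> Phi J.
Proof.
move=> step J Ji; apply: NNPP => nP.
have [M [Mi nM _ Mmax]] := noeth_max (Phi := fun J => ~ Phi J) Ji nP.
apply: nM; apply: step => // J' J'i MJ' [x [J'x nMx]].
by apply: NNPP => nP'; apply: nMx; apply: (Mmax J').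
Qed.

(** An ideal maximal among those over [J] that avoid [S] is prime: if [a] and [b] lie outside it,
    both enlargements meet [S], and the product of the two elements found in [S] would lie in the
    ideal as soon as [a * b] does. *)
Lemma prime_disjoint (S : C -> Prop) J :
  S 1 -> (forall x y, S x -> S y -> S (x * y)) ->
  is_ideal J -> (forall x, S x -> ~ J x) ->
  exists Q, [/\ is_prime_ideal Q, (forall x, J x -> Q x) & forall x, S x -> ~ Q x].
Proof.
move=> S1 SM Ji JS.
have [Q [Qi QS JQ Qmax]] :=
  noeth_max (Phi := fun J => forall x, S x -> ~ J x) Ji JS.
exists Q; split=> //; split=> //; first exact: QS.
have meet a : ~ Q a -> exists x, S x /\ addI Q a x.
  move=> nQa; apply: NNPP => no; apply: nQa.
  apply: (Qmax (addI Q a)); [exact: addI_ideal| |exact: addI_sub|exact: addI_gen].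
  by move=> x Sx Qx; apply: no; exists x.
move=> a b Qab; apply: NNPP => /not_or_and [nQa nQb].
have [x [Sx [x1 [c [Qx1 defx]]]]] := meet a nQa.
have [y [Sy [y1 [e [Qy1 defy]]]]] := meet b nQb.
apply: (QS _ (SM _ _ Sx Sy)); rewrite {x}defx {y}defy in Sx Sy *.
have -> : (x1 + c * a) * (y1 + e * b) =
   (y1 + e * b) * x1 + (c * a) * y1 + (c * e) * (a * b) by ring.
by case: Qi => _ QD QM; apply: (QD); [apply: (QD)|]; apply: (QM).
Qed.

Lemma prime_over J : is_ideal J -> ~ J 1 ->
  exists Q, is_prime_ideal Q /\ forall x, J x -> Q x.
Proof.
move=> Ji J1.
have [||x -> //|Q [Qp JQ _]] := @prime_disjoint (fun x => x = 1) J _ _ Ji.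
- by [].
- by move=> x y -> ->; rewrite mul1r.
by exists Q.
Qed.

Lemma not_prime_split J : is_ideal J -> ~ is_prime_ideal J ->
  J 1 \/ exists a b, [/\ J (a * b), ~ J a & ~ J b].
Proof.
move=> Ji np; case: (classic (J 1)) => J1; [by left | right].
apply: NNPP => no; apply: np; split=> // a b Jab; apply: NNPP => /not_or_and [na nb].
by apply: no; exists a, b.
Qed.

(* The elements x_i are corrected one locally closed stratum at a time: a
   correction that is a multiple of a does not change anything on V(a). *)
Lemma stable_range (X : (C -> Prop) -> Prop) n J :
  (forall Q Q', is_prime_ideal Q -> is_prime_ideal Q' ->
     (forall x, Q x -> Q' x) -> X Q' -> X Q) ->
  is_ideal J ->
  (forall P, prime_chain n P -> (forall i, (i <= n)%N -> X (P i)) ->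
     (forall x, J x -> P 0%N x) -> False) ->
  forall b (g : nat -> C), exists x : nat -> C,
  forall Q, is_prime_ideal Q -> X Q -> (forall y, J y -> Q y) ->
    (forall i, (i < n)%N -> Q (g i + b * x i)) -> Q b.
Proof.
move=> genX; elim: n J => [|n IHn] J Ji; move: J Ji; apply: noeth_ind => J Ji IHJ noch b g.
  exists (fun=> 0) => Q Qp XQ JQ _.
  by case: (noch (fun=> Q)) => //; split.
have sub J' : is_ideal J' -> (forall x, J x -> J' x) ->
    (exists x, J' x /\ ~ J x) -> forall b g, exists x : nat -> C,
  forall Q, is_prime_ideal Q -> X Q -> (forall y, J' y -> Q y) ->
    (forall i, (i < n.+1)%N -> Q (g i + b * x i)) -> Q b.
  move=> J'i JJ' ex b' g'; apply: IHJ => // P Pch XP J'P.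
  by apply: (noch P) => // x /JJ' /J'P.
case: (classic (is_prime_ideal J)) => [Jp|/(not_prime_split Ji)[J1|]].
(* The class [X] plays the part of the spectrum of a localization: as it is stable under passage to
   smaller primes, it has no member above [J] when it does not contain [J]. *)
- case: (classic (X J)) => [XJ|nXJ]; last first.
    exists (fun=> 0) => Q Qp XQ JQ _; case: nXJ; exact: genX XQ.
  case: (classic (J b)) => [Jb|nJb]; first by exists (fun=> 0) => Q _ _ JQ _; apply: JQ.
  (* One of 0 and 1 works, since [b] is not in [J]. A chain above [J] and the new last coordinate
     can be prolonged downwards by [J], so the induction on [n] applies to the other coordinates. *)
  have [e ng] : exists e, ~ J (g n + b * e).
    case: (classic (J (g n))) => Jg; last by exists 0; rewrite mulr0 addr0.
    by exists 1; rewrite mulr1 => Jgb; apply: nJb; apply: (ideal_addKl Ji Jg).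
  have [|P Pch XP JP|x Hx] := IHn (addI J (g n + b * e)) _ _ b g.
  + exact: addI_ideal.
  + apply: (noch (fun i => if i is i'.+1 then P i' else J)) => //.
      split=> [[|i] //|[|i]] /= Hi; [exact: (Pch.1)| |exact: (Pch.2)].
      split=> [x Jx|]; first by apply: JP; apply: addI_sub.
      exists (g n + b * e); split=> //; apply: JP; exact: addI_gen.
    by case=> [|i] //=; apply: XP.
  exists (fun i => if (i < n)%N then x i else e) => Q Qp XQ JQ Hi.
  apply: (Hx Q) => //.
  + apply: addI_min => //; first by case: Qp.
    by have := Hi n (ltnSn n); rewrite ltnn.
  + by move=> i Hin; have := Hi i (ltnW Hin); rewrite Hin.
- by exists (fun=> 0) => Q [Qi Q1 _] _ JQ _; case: Q1; apply: JQ.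
case=> a [c [Jac nJa nJc]].
have [|||x1 H1] := sub (addI J a) _ _ _ b g; first exact: addI_ideal.
- exact: addI_sub.
- by exists a; split=> //; apply: addI_gen.
have [|||x2 H2] := sub (addI J c) _ _ _ (a * b) (fun i => g i + b * x1 i).
- exact: addI_ideal.
- exact: addI_sub.
- by exists c; split=> //; apply: addI_gen.
exists (fun i => x1 i + a * x2 i) => Q Qp XQ JQ Hi; case: (Qp) => Qi Q1 QM.
have Ha : Q a -> Q b.
  move=> Qa; apply: (H1 Q) => // [|i Hin]; first exact: addI_min.
  have Qa' : Q (b * x2 i * a) by case: Qi => _ _; apply.
  by apply: (ideal_addKl Qi Qa'); have := Hi i Hin; congr (Q _); ring.
case: (QM a c (JQ _ Jac)) => // Qc.
have : Q (a * b).
  apply: (H2 Q) => // [|i Hin]; first exact: addI_min.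
  by have := Hi i Hin; congr (Q _); ring.
by case/QM.
Qed.

End IdealTheory.

(** * Krull's principal ideal theorem *)

Section PrincipalIdealTheorem.
Variable C : comNzRingType.
Hypothesis noeC : noetherian C.
Implicit Types (J m : C -> Prop).

(** The contraction to [C] of the extension of [J] to the local ring at [m]; statements about that
    local ring are made in [C] itself. *)
Definition localized m J : C -> Prop := fun z => exists e, ~ m e /\ J (e * z).

Lemma prime_notM m x y : is_prime_ideal m -> ~ m x -> ~ m y -> ~ m (x * y).
Proof. by case=> _ _ mM nx ny /mM []. Qed.

Lemma localized_ideal m J : is_prime_ideal m -> is_ideal J -> is_ideal (localized m J).
Proof.
move=> mp [J0 JD JM]; split.
- by exists 1; rewrite mulr0; split=> //; apply: prime_not1 mp.
- move=> x y [e [ne Je]] [f [nf Jf]]; exists (e * f); split; first exact: prime_notM.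
  have -> : e * f * (x + y) = f * (e * x) + e * (f * y) by ring.
  by apply: (JD); apply: (JM).
- move=> r x [e [ne Je]]; exists e; split=> //.
  have -> : e * (r * x) = r * (e * x) by ring.
  exact: (JM).
Qed.

Lemma localized_sub m J x : is_prime_ideal m -> J x -> localized m J x.
Proof. by move=> [_ m1 _] Jx; exists 1; rewrite mul1r. Qed.

(** The local ring at [m] modulo [J0] is Artinian, because every element of [m] is nilpotent there;
    the conclusion is that a descending chain has a stationary step. Noetherian induction adds to
    [J] a socle element [g]. If some term misses [g] locally, the coefficient of [g] left by the
    induction lies in [m] and kills [g] modulo [J]; otherwise [g] lies locally in every term. *)
Lemma local_dcc m J0 : is_prime_ideal m -> is_ideal J0 ->
  (forall c, m c -> exists k, localized m J0 (c ^+ k)) ->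
  forall J, is_ideal J -> (forall x, J0 x -> J x) ->
  forall b : nat -> C -> Prop, (forall n, is_ideal (b n)) ->
    (forall n x, b n.+1 x -> b n x) -> (forall n x, J x -> b n x) ->
  exists n, forall z, b n z -> localized m (b n.+1) z.
Proof.
move=> mp J0i nilp; apply: (noeth_ind noeC) => J Ji IHJ J0J b bi bdec Jb.
have bdecn n k x : b (n + k)%N x -> b n x.
  by elim: k => [|k IH]; rewrite ?addn0 // addnS => /bdec /IH.
case: (classic (localized m J 1)) => [[e [ne Je]]|nJ1].
  exists 0%N => z _; exists e; split=> //.
  by rewrite mulr1 in Je; apply: Jb; apply: ideal_mulr.
(* An element outside [J] whose annihilator modulo [J] is maximal: multiplying it by a power of [c]
   in [m] cannot enlarge the annihilator without giving zero, so [c] itself kills it. *)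
have [g [ng soc]] : exists g, ~ localized m J g /\
    forall c, m c -> localized m J (c * g).
  pose ann g : C -> Prop := fun c => localized m J (c * g).
  have Li := localized_ideal mp Ji.
  have anni g : is_ideal (ann g).
    split; rewrite /ann; first by rewrite mul0r; case: Li.
    - by move=> x y Hx Hy; rewrite mulrDl; case: Li => _ LD _; apply: LD.
    - by move=> r x Hx; rewrite -mulrA; case: Li => _ _ LM; apply: LM.
  pose Phi K := exists g, ~ localized m J g /\ forall x, K x <-> ann g x.
  have [||K [Ki [g [ng Kg]] _ Kmax]] := noeth_max noeC (Phi := Phi) (J0 := ann 1) _ _.
  - exact: anni.
  - by exists 1.
  exists g; split=> // c mc.
  have [k ck] := nilp c mc.
  have [j] : exists j, localized m J (c ^+ j * g).
    exists k; case: ck => e [ne Je]; exists e; split=> //.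
    by rewrite mulrA; apply: (ideal_mulr _ Ji); apply: J0J.
  elim: j => [|j IHj]; first by rewrite expr0 mul1r.
  case: (classic (localized m J (c ^+ j * g))) => [/IHj //|nj cj].
  apply/Kg; apply: (Kmax (ann (c ^+ j * g))) => //; first by exists (c ^+ j * g).
  - move=> x /Kg; rewrite /ann => Hx.
    have -> : x * (c ^+ j * g) = c ^+ j * (x * g) by ring.
    by case: Li => _ _; apply.
  - by rewrite /ann mulrA -exprS.
have nJg : ~ J g by move/(localized_sub mp).
have IH : forall b : nat -> C -> Prop, (forall n, is_ideal (b n)) ->
    (forall n x, b n.+1 x -> b n x) -> (forall n x, J x -> b n x) ->
    exists n, forall z, b n z -> exists c, localized m (fun y => b n.+1 (y - c * g)) z.
  move=> b' bi' bdec' Jb'.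
  have [|||x Jx||||n Hn] := IHJ (addI J g) _ _ _ _ (fun n => addI (b' n) g) _ _ _.
  - exact: addI_ideal.
  - exact: addI_sub.
  - by exists g; split=> //; apply: addI_gen.
  - by apply: addI_sub; apply: J0J.
  - by move=> n; apply: addI_ideal.
  - by move=> n x [y [c [by' ->]]]; exists y, c; split=> //; apply: bdec'.
  - by move=> n x [y [c [by' ->]]]; exists y, c; split=> //; apply: Jb'.
  exists n => z bz; have [|e [ne [y [c [by' ey]]]]] := Hn z; first exact: addI_sub.
  by exists c, e; rewrite ey addrK.
case: (classic (exists n0, ~ localized m (b n0) g)) => [[n0 ng0]|allg].
- have [||| n Hn] := IH (fun n => b (n0 + n)%N).
  + by move=> n.
  + by move=> n x; rewrite addnS; apply: bdec.
  + by move=> n x; apply: Jb.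
  exists (n0 + n)%N => z bz; have [c [e [ne]]] := Hn z bz; rewrite addnS => He.
  have [mc|nmc] := classic (m c).
    have [f [nf Jf]] := soc c mc; exists (f * e); split; first exact: prime_notM.
    have -> : f * e * z = f * (e * z - c * g) + f * (c * g) by ring.
    case: (bi (n0 + n).+1) => _ bD bM; apply: (bD); first exact: (bM).
    exact: Jb.
  case: ng0; exists c; split=> //; apply: (bdecn _ n).
  have -> : c * g = e * z - (e * z - c * g) by ring.
  by apply: ideal_sub => //; [case: (bi (n0 + n)%N) => _ _; apply | apply: bdec].
- have [||| n Hn] := IH b; [by []|by []|by []|].
  exists n => z bz; have [c [e [ne He]]] := Hn z bz.
  have [f [nf Hf]] : localized m (b n.+1) g.
    by apply: NNPP => no; apply: allg; exists n.+1.
  exists (f * e); split; first exact: prime_notM.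
  have -> : f * e * z = f * (e * z - c * g) + c * (f * g) by ring.
  by case: (bi n.+1) => _ bD bM; apply: (bD); apply: (bM).
Qed.

(* Otherwise Q2 is minimal over Q0 + (a), so of height at most one modulo Q0 by
   Krull's principal ideal theorem, against Q0 < Q1 < Q2. *)
Theorem prime_between (Q0 Q1 Q2 : C -> Prop) a :
  is_prime_ideal Q0 -> is_prime_ideal Q1 -> is_prime_ideal Q2 ->
  (forall x, Q0 x -> Q1 x) -> (exists x, Q1 x /\ ~ Q0 x) ->
  (forall x, Q1 x -> Q2 x) -> (exists x, Q2 x /\ ~ Q1 x) -> Q2 a ->
  exists Q', [/\ is_prime_ideal Q', (forall x, Q0 x -> Q' x), Q' a,
    (forall x, Q' x -> Q2 x) & exists x, Q2 x /\ ~ Q' x].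
Proof.
move=> p0 p1 p2 Q01 [y [Q1y nQ0y]] Q12 [w [Q2w nQ1w]] Q2a.
apply: NNPP => no.
have nQ1a : ~ Q1 a by move=> Q1a; apply: no; exists Q1; split=> //; exists w.
have [i0 i1 i2] : [/\ is_ideal Q0, is_ideal Q1 & is_ideal Q2].
  by case: p0 p1 p2 => ? _ _ [? _ _] [].
have Ki := addI_ideal a i0; set K := addI Q0 a in Ki.
(* If no power of [c] were locally in [K], a prime over [K] avoiding [c] and the complement of [Q2]
   would be the [Q'] assumed not to exist. *)
have nilp c : Q2 c -> exists k, localized Q2 K (c ^+ k).
  move=> Q2c; apply: NNPP => nk; apply: no.
  have [||||Q' [Q'p KQ' dis]] := @prime_disjoint C noeC
      (fun x => exists e k, ~ Q2 e /\ x = e * c ^+ k) K.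
  - by exists 1, 0%N; rewrite mulr1; split=> //; apply: prime_not1 p2.
  - move=> _ _ [e [k [ne ->]]] [f [l [nf ->]]]; exists (e * f), (k + l)%N.
    by split; [apply: prime_notM | rewrite exprD; ring].
  - by [].
  - by move=> _ [e [k [ne ->]]] He; apply: nk; exists k, e.
  exists Q'; split=> //.
  - by move=> x Q0x; apply: KQ'; apply: addI_sub.
  - by apply: KQ'; apply: addI_gen.
  - move=> x Q'x; apply: NNPP => nQ2x; apply: (dis x) => //.
    by exists x, 0%N; rewrite mulr1.
  - exists c; split=> //; apply: dis; exists 1, 1%N; rewrite mul1r; split=> //.
    by apply: prime_not1 p2.
(* s n is the contraction of the ideal generated by y^n in the localization of
   C / Q0 at Q1 *)
pose s n : C -> Prop := fun z => exists e c, ~ Q1 e /\ Q0 (e * z - c * y ^+ n).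
have si n : is_ideal (s n).
  split; first by exists 1, 0; rewrite mulr0 mul0r subr0; split; [apply: prime_not1 p1 | case: i0].
  - move=> z z' [e [c [ne Hz]]] [e' [c' [ne' Hz']]].
    exists (e * e'), (e' * c + e * c'); split; first exact: prime_notM.
    have -> : e * e' * (z + z') - (e' * c + e * c') * y ^+ n =
      e' * (e * z - c * y ^+ n) + e * (e' * z' - c' * y ^+ n) by ring.
    by case: i0 => _ QD QM; apply: (QD); apply: (QM).
  - move=> r z [e [c [ne Hz]]]; exists e, (r * c); split=> //.
    have -> : e * (r * z) - r * c * y ^+ n = r * (e * z - c * y ^+ n) by ring.
    by case: i0 => _ _; apply.
have sdec n z : s n.+1 z -> s n z.
  by move=> [e [c [ne Hz]]]; exists e, (c * y); rewrite -mulrA -exprS.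
have sQ0 n z : Q0 z -> s n z.
  move=> Q0z; exists 1, 0; rewrite mul1r mul0r subr0; split=> //; apply: prime_not1 p1.
have ssat n e z : ~ Q1 e -> s n (e * z) -> s n z.
  move=> ne [f [c [nf Hf]]]; exists (f * e), c; rewrite -mulrA; split=> //.
  exact: prime_notM.
have [||||x Kx||||n Hn] := @local_dcc Q2 K _ _ _ K _ _ (fun n => addI (s n) a) _ _ _ => //.
- by move=> n; apply: addI_ideal.
- by move=> n x [z [c [sz ->]]]; exists z, c; split=> //; apply: sdec.
- by move=> n x [z [c [sz ->]]]; exists z, c; split=> //; apply: sQ0.
have {}Hn z : s n z -> exists e z' c, [/\ ~ Q2 e, s n.+1 z', s n c & e * z = z' + c * a].
  move=> snz; have [|e [ne [z' [c [sz' ec]]]]] := Hn z; first exact: addI_sub.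
  exists e, z', c; split=> //; apply: (ssat _ a) => //.
  have -> : a * c = e * z - z' by rewrite ec; ring.
  by apply: ideal_sub => //; [case: (si n) => _ _; apply | apply: sdec].
(* Nakayama's lemma for s n modulo s n.+1, through a maximal counterexample *)
have Nak z : s n z -> localized Q2 (s n.+1) z.
  move=> snz; apply: NNPP => bad.
  have [||N [Ni [z0 [sz0 bad0]] sN Nmax]] := noeth_max noeC
     (Phi := fun N => exists z, s n z /\ ~ localized Q2 N z) (J0 := s n.+1) => //.
    by exists z.
  have nNz0 : ~ N z0 by move/(localized_sub p2).
  have gen z' : s n z' -> localized Q2 (addI N z0) z'.
    move=> sz'; apply: NNPP => bad'; apply: nNz0.
    apply: (Nmax (addI N z0)); [exact: addI_ideal|by exists z'| |exact: addI_gen].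
    exact: addI_sub.
  have [e [z' [c [ne sz' sc ez]]]] := Hn _ sz0.
  have [e' [ne' [v [c' [Nv ec]]]]] := gen _ sc.
  apply: bad0; exists (e' * e - c' * a); split.
    move=> Q2d; apply: (prime_notM p2 ne' ne); rewrite -[e' * e](subrK (c' * a)).
    by case: i2 => _ QD QM; apply: (QD) => //; apply: (QM).
  have -> : (e' * e - c' * a) * z0 = e' * z' + a * v.
    transitivity (e' * (e * z0) - c' * a * z0); first by ring.
    rewrite ez; transitivity (e' * z' + a * (e' * c) - c' * a * z0); first by ring.
    by rewrite ec; ring.
  by case: Ni => _ ND NM; apply: (ND); apply: (NM) => //; apply: sN.
(* Modulo [Q0], a multiple of [y ^+ n] by an element outside [Q1] becomes a multiple of [y ^+ n.+1].
   Cancelling [y ^+ n], which is not in [Q0], puts that element in [Q1]. *)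
have [|e [ne [e' [c [ne' Hc]]]]] := Nak (y ^+ n).
  by exists 1, 1; rewrite subrr; split; [apply: prime_not1 p1 | case: i0].
have Q0e : Q0 (e' * e - c * y).
  case: (p0) => _ _ /(_ (y ^+ n) (e' * e - c * y)) [].
  - by move: Hc; congr (Q0 _); rewrite exprS; ring.
  - by move/(prime_exp p0) => /nQ0y.
  - by [].
have : Q1 (e' * e).
  rewrite -[e' * e](subrK (c * y)); case: i1 => _ QD QM; apply: (QD); first exact: Q01.
  exact: (QM).
by case: p1 => _ _ Q1M /Q1M [//|/Q12].
Qed.

End PrincipalIdealTheorem.

(** * Chains of primes through a given element *)

Section Chains.
Variable C : comNzRingType.
Implicit Types (P : nat -> C -> Prop) (Q : C -> Prop).

Definition chain_cons Q P : nat -> C -> Prop := fun i => if i is j.+1 then P j else Q.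

Lemma prime_chain_cons n Q P : prime_chain n P -> is_prime_ideal Q ->
  (forall x, Q x -> P 0%N x) -> (exists x, P 0%N x /\ ~ Q x) ->
  prime_chain n.+1 (chain_cons Q P).
Proof.
move=> [Pp Ps] Qp QP nQ; split=> [[|i] //|[|i]] /= Hi; first exact: Pp.
- by split.
- exact: Ps.
Qed.

Lemma prime_chain_tail n P : prime_chain n.+1 P -> prime_chain n (fun i => P i.+1).
Proof. by move=> [Pp Ps]; split=> i Hi; [apply: Pp | apply: Ps]. Qed.

Lemma prime_chain_sub n P i j : prime_chain n P -> (i <= j <= n)%N ->
  forall x, P i x -> P j x.
Proof.
move=> [_ Ps]; elim: j => [|j IH] /andP[].
  by rewrite leqn0 => /eqP ->.
rewrite leq_eqVlt => /orP[/eqP -> //|ij] jn x Pix.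
by apply: (Ps j jn).1; apply: IH => //; rewrite -ltnS ij ltnW.
Qed.

Lemma prime_chain_const Q : is_prime_ideal Q -> prime_chain 0 (fun=> Q).
Proof. by move=> Qp; split. Qed.

(** [prime_between] replaces the middle of three consecutive primes by one that contains [a]. Used
    from the top of the chain downwards, it brings [a] to the bottom at the cost of one step. *)
Lemma prime_chain_through : noetherian C -> forall a m P,
  prime_chain m.+2 P -> P m.+2 a ->
  exists P', [/\ prime_chain m.+1 P', P' 0%N a, (forall x, P 0%N x -> P' 0%N x) &
    forall x, P' m.+1 x -> P m.+2 x].
Proof.
move=> noeC a; elim=> [|m IH] P Pch Pa; case: (classic (P 1%N a)) => P1a.
- exists (fun i => P i.+1); split=> //; first exact: prime_chain_tail.
  by apply: (prime_chain_sub Pch).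
- case: (Pch) => Pp Ps.
  have [Q' [Q'p P0Q' Q'a Q'P nQ']] := prime_between noeC (Pp 0%N isT) (Pp 1%N isT)
    (Pp 2%N isT) (Ps 0%N isT).1 (Ps 0%N isT).2 (Ps 1%N isT).1 (Ps 1%N isT).2 Pa.
  exists (chain_cons Q' (fun=> P 2%N)); split=> //.
  by apply: prime_chain_cons => //; apply: prime_chain_const; apply: Pp.
- exists (fun i => P i.+1); split=> //; first exact: prime_chain_tail.
  by apply: (prime_chain_sub Pch).
- have [P' [P'ch P'a PP' P'P]] := IH _ (prime_chain_tail Pch) Pa.
  case: (Pch) => Pp Ps.
  have [Q' [Q'p P0Q' Q'a Q'P nQ']] := prime_between noeC (Pp 0%N isT) (Pp 1%N isT)
    (P'ch.1 0%N isT) (Ps 0%N isT).1 (Ps 0%N isT).2 PP' (ex_intro _ a (conj P'a P1a)) P'a.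
  by exists (chain_cons Q' P'); split=> //; apply: prime_chain_cons.
Qed.

End Chains.

(** * Hilbert's basis theorem and the dimension of polynomial rings *)

Section PolynomialRing.
Variable C : comNzRingType.

(** Nested ideals with the same leading coefficients in each degree coincide. The diagonal sequence
    [L n n] stabilizes at some [M], which settles all degrees from [M] on; the finitely many lower
    degrees are treated one at a time. *)
Lemma noetherian_poly : noetherian C -> noetherian {poly C}.
Proof.
move=> noeC J Ji Jinc.
have Jle n k f : (n <= k)%N -> J n f -> J k f.
  by move=> /subnK <-; elim: (k - n)%N => // l IH /IH; rewrite addSn; apply: Jinc.
pose L n i : C -> Prop := fun c => exists f, [/\ J n f, (size f <= i.+1)%N & f`_i = c].
have Li n i : is_ideal (L n i).
  split; first by exists 0; rewrite size_poly0 coef0; split=> //; case: (Ji n).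
  - move=> c c' [f [Jf sf <-]] [f' [Jf' sf' <-]]; exists (f + f'); rewrite coefD; split=> //.
      by case: (Ji n) => _ JD _; apply: JD.
    by rewrite (leq_trans (size_polyD _ _)) // geq_max sf.
  - move=> r c [f [Jf sf <-]]; exists (r *: f); rewrite coefZ; split=> //.
      by rewrite -mul_polyC; case: (Ji n) => _ _; apply.
    exact: leq_trans (size_scale_leq _ _) sf.
have Lle n k i j c : (n <= k)%N -> (i <= j)%N -> L n i c -> L k j c.
  move=> nk ij [f [Jf sf fc]]; exists (f * 'X^(j - i)); split.
  - by apply: ideal_mulr => //; apply: Jle Jf.
  - have [->|nf] := eqVneq f 0; first by rewrite mul0r size_poly0.
    by rewrite size_mulXn // (leq_trans (leq_add (leqnn _) sf)) // addnS subnK.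
  - by rewrite coefMXn ltnNge leq_subr /= subKn.
have [M HM] := noeC (fun n => L n n) (fun n => Li n n)
  (fun n c => @Lle n n.+1 n n.+1 c (leqnSn n) (leqnSn n)).
have [N' HN'] : exists N, forall i, (i < M)%N -> forall n, (N <= n)%N ->
    forall c, L n i c -> L N i c.
  elim: (M) => [|k [N HN]]; first by exists 0%N.
  have [N1 HN1] := noeC (fun n => L n k) (fun n => Li n k)
    (fun n c => @Lle n n.+1 k k c (leqnSn n) (leqnn k)).
  exists (maxn N N1) => i; rewrite ltnS leq_eqVlt => /orP[/eqP ->|ik] n; rewrite geq_max.
    move=> /andP[_ N1n] c /(HN1 _ N1n) Lc.
    by apply: Lle Lc => //; apply: leq_maxr.
  move=> /andP[Nn _] c /(HN _ ik _ Nn) Lc.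
  by apply: Lle Lc => //; apply: leq_maxl.
pose N := maxn M N'.
exists N => n Nn f; split; last exact: Jle.
have LN i c : L n i c -> L N i c.
  have [iM|Mi] := ltnP i M => Lc.
    have := HN' i iM n (leq_trans (leq_maxr _ _) Nn) c Lc.
    by apply: Lle => //; apply: leq_maxr.
  have : L (maxn n i) (maxn n i) c by apply: Lle Lc; rewrite ?leq_maxl ?leq_maxr.
  move/(HM (maxn n i)) => Lc'.
  apply: (@Lle M N M i) => //; first exact: leq_maxl.
  apply: Lc'; exact: leq_trans Mi (leq_maxr _ _).
have [k] := ubnP (size f); elim: k f => // k IHk f; rewrite ltnS => sf Jf.
have [->|nf] := eqVneq f 0; first by case: (Ji N).
have [|g [Jg sg gf]] := LN (size f).-1 f`_(size f).-1.
  by exists f; split=> //; apply: leqSpred.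
rewrite -(subrK g f); case: (Ji N) => _ JD _; apply: JD => //.
apply: IHk; last by apply: ideal_sub => //; apply: Jle Jg.
have sz : (size f).-1.+1 = size f by rewrite prednK // lt0n size_poly_eq0.
apply: leq_trans sf; rewrite -sz ltnS; apply/leq_sizeP => j.
rewrite leq_eqVlt => /orP[/eqP <-|Hj]; first by rewrite coefB gf subrr.
rewrite coefB !nth_default ?subrr //; first exact: leq_trans sg _.
by rewrite -sz.
Qed.

Definition contract (Q : {poly C} -> Prop) : C -> Prop := fun c => Q c%:P.

Lemma contract_prime Q : is_prime_ideal Q -> is_prime_ideal (contract Q).
Proof.
move=> [[Q0 QD QM] Q1 Qm]; split; rewrite /contract //.
- split=> [//|x y Qx Qy|r x Qx]; rewrite ?polyCD ?polyCM; [exact: QD|exact: QM].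
- by move=> a b; rewrite polyCM; apply: Qm.
Qed.

(** The bound on the size of the quotient is there for [poly_fibre], where a minimality argument is
    applied to the quotient as well as to the remainder. *)
Lemma pseudo_division (f g : {poly C}) : g != 0 -> exists k u r,
  [/\ (lead_coef g ^+ k) *: f = u * g + r, (size r < size g)%N &
      (size u <= size f - (size g).-1)%N].
Proof.
move=> ng; suff: forall n (f : {poly C}), (size f <= n)%N -> exists k u r,
  [/\ (lead_coef g ^+ k) *: f = u * g + r, (size r < size g)%N &
      (size u <= n - (size g).-1)%N] by apply.
have sg : (0 < size g)%N by rewrite lt0n size_poly_eq0.
elim=> [|n IH] {}f sf.
  exists 0%N, 0, f; rewrite scale1r mul0r add0r size_poly0; split=> //.
  exact: leq_ltn_trans sf sg.
have [sfg|sgf] := ltnP (size f) (size g).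
  by exists 0%N, 0, f; rewrite scale1r mul0r add0r size_poly0.
pose w : {poly C} := lead_coef f *: 'X^(size f - size g).
have sz : (size f).-1.+1 = size f by rewrite prednK //; apply: leq_trans sgf.
have swg : (size (w * g)%R <= size f)%N.
  rewrite /w -scalerAl (leq_trans (size_scale_leq _ _)) // mulrC.
  by rewrite size_mulXn // subnK.
have [|k [u [r [E sr su]]]] := IH (lead_coef g *: f - w * g).
  rewrite -ltnS; apply: leq_trans sf; rewrite -sz ltnS; apply/leq_sizeP => j.
  rewrite leq_eqVlt => /orP[/eqP <-|Hj].
    rewrite coefB coefZ /w -scalerAl coefZ coefXnM -lead_coefE.
    have -> : ((size f).-1 < size f - size g)%N = false.
      by apply/negbTE; rewrite -leqNgt -ltnS sz ltn_subrL sg (leq_trans sg sgf).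
    have -> : ((size f).-1 - (size f - size g) = (size g).-1)%N.
      rewrite -(subnK sgf) addnK; case: (size g) sg => // k _.
      by rewrite addnS /= addnC addnK.
    by rewrite -lead_coefE mulrC subrr.
  rewrite coefB coefZ !nth_default ?mulr0 ?subrr //; first by apply: leq_trans swg _; rewrite -sz.
  by rewrite -sz.
exists k.+1, (u + lead_coef g ^+ k *: w), r; split=> //.
- rewrite exprSr -scalerA -[lead_coef g *: f](subrK (w * g)) scalerDr E mulrDl.
  by rewrite scalerAl addrAC.
- rewrite (leq_trans (size_polyD _ _)) // geq_max; apply/andP; split.
    by apply: leq_trans su _; apply: leq_sub2r.
  do 2 rewrite (leq_trans (size_scale_leq _ _)) //.
  rewrite size_polyXn; case: (size g) sg sgf => // l _ sgf /=.
  rewrite -subSn // subSS; exact: leq_sub2r.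
Qed.

(** The fibre over a prime is the spectrum of a polynomial ring over a field, of dimension one.
    Concretely, let [f] in [Q1] outside [Q0] and [g] in [Q2] outside [Q1] have least size: in the
    pseudo-division of [f] by [g], minimality forces the remainder and then the quotient into [Q0],
    hence also [f]. *)
Lemma poly_fibre Q0 Q1 Q2 :
  is_prime_ideal Q0 -> is_prime_ideal Q1 -> is_prime_ideal Q2 ->
  (forall f, Q0 f -> Q1 f) -> (exists f, Q1 f /\ ~ Q0 f) ->
  (forall f, Q1 f -> Q2 f) -> (exists f, Q2 f /\ ~ Q1 f) ->
  ~ (forall c, contract Q2 c -> contract Q0 c).
Proof.
move=> p0 p1 p2 Q01 ex1 Q12 ex2 Hc.
have minimal (S : {poly C} -> Prop) : (exists f, S f) ->
    exists f, S f /\ forall g : {poly C}, (size g < size f)%N -> ~ S g.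
  move=> [f]; have [n] := ubnP (size f); elim: n f => // n IH f; rewrite ltnS => sf Sf.
  case: (classic (exists g : {poly C}, (size g < size f)%N /\ S g)) => [[g [sg Sg]]|no].
    by apply: (IH g) => //; apply: leq_trans sg sf.
  by exists f; split=> // g sg Sg; apply: no; exists g.
(* If the leading coefficient were in [Q0], removing the leading term would give a smaller element
   of [Q'] outside [Q]. *)
have lead Q Q' (f : {poly C}) : is_prime_ideal Q -> is_prime_ideal Q' ->
    (forall f, Q0 f -> Q f) -> (forall f, Q f -> Q' f) ->
    Q' f -> ~ Q f -> (forall g : {poly C}, (size g < size f)%N -> ~ (Q' g /\ ~ Q g)) ->
    ~ Q0 (lead_coef f)%:P.
  move=> [Qi _ _] [Q'i _ _] QQ0 QQ' Q'f nQf fmin Ql; apply: nQf.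
  have Qt : Q (lead_coef f *: 'X^((size f).-1)).
    by rewrite -mul_polyC; apply: ideal_mulr => //; apply: QQ0.
  have [->|nf] := eqVneq f 0; first by case: Qi.
  rewrite -(subrK (lead_coef f *: 'X^((size f).-1)) f).
  case: (Qi) => _ QD _; apply: QD => //; apply: NNPP => nQ.
  apply: fmin (conj _ nQ); last by apply: ideal_sub => //; apply: QQ'.
  have sz : (size f).-1.+1 = size f by rewrite prednK // lt0n size_poly_eq0.
  rewrite -sz ltnS; apply/leq_sizeP => j.
  rewrite leq_eqVlt => /orP[/eqP <-|Hj].
    by rewrite coefB coefZ coefXn eqxx mulr1 lead_coefE subrr.
  by rewrite coefB coefZ coefXn gtn_eqF // mulr0 subr0 nth_default // -sz.
have [f [[Q1f nQ0f] fmin]] := minimal (fun f => Q1 f /\ ~ Q0 f) ex1.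
have [g [[Q2g nQ1g] gmin]] := minimal (fun f => Q2 f /\ ~ Q1 f) ex2.
have lf := lead Q0 Q1 f p0 p1 (fun _ H => H) Q01 Q1f nQ0f fmin.
have lg := lead Q1 Q2 g p1 p2 Q01 Q12 Q2g nQ1g gmin.
have fminQ (h : {poly C}) : (size h < size f)%N -> Q1 h -> Q0 h.
  by move=> sh Q1h; apply: NNPP => nQ; apply: (fmin h).
have gminQ (h : {poly C}) : (size h < size g)%N -> Q2 h -> Q1 h.
  by move=> sh Q1h; apply: NNPP => nQ; apply: (gmin h).
have [i0 i1 i2] : [/\ is_ideal Q0, is_ideal Q1 & is_ideal Q2].
  by case: p0 p1 p2 => ? _ _ [? _ _] [].
have ng : g != 0 by apply/eqP => g0; apply: nQ1g; rewrite g0; case: i1.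
have nf : f != 0 by apply/eqP => f0; apply: nQ0f; rewrite f0; case: i0.
have Zmem (Q : {poly C} -> Prop) (c : C) k (h : {poly C}) : is_prime_ideal Q -> Q ((c ^+ k) *: h) -> Q c%:P \/ Q h.
  move=> Qp; rewrite -mul_polyC polyC_exp; case: (Qp) => _ _ QM /QM[/(prime_exp Qp)|]; by [left|right].
have sgf : (size g <= size f)%N.
  rewrite leqNgt; apply/negP => sfg.
  have [k [u [r [E sr _]]]] := pseudo_division g nf.
  have Q2r : Q2 r.
    have -> : r = lead_coef f ^+ k *: g - u * f by rewrite E addrAC subrr add0r.
    apply: ideal_sub => //; first by rewrite -mul_polyC; case: i2 => _ _; apply.
    by case: i2 => _ _ QM; apply: (QM); apply: Q12.
  have Q1r : Q1 r by apply: gminQ => //; apply: ltn_trans sr sfg.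
  case: (Zmem Q1 (lead_coef f) k g p1) => //.
    by rewrite E; case: i1 => _ QD QM; apply: (QD) => //; apply: (QM).
  by move/Q12/Hc.
have sg1 : (1 < size g)%N.
  rewrite ltnNge; apply/negP => /size1_polyC g1; apply: nQ1g.
  by rewrite g1; apply: Q01; apply: Hc; rewrite /contract -g1.
have [k [u [r [E sr su]]]] := pseudo_division f ng.
have Q2r : Q2 r.
  have -> : r = lead_coef g ^+ k *: f - u * g by rewrite E addrAC subrr add0r.
  apply: ideal_sub => //; first by apply: Q12; rewrite -mul_polyC; case: i1 => _ _; apply.
  by case: i2 => _ _ QM; apply: (QM).
have Q1r := gminQ r sr Q2r.
have Q0r : Q0 r by apply: fminQ => //; apply: leq_trans sr sgf.
have Q1u : Q1 u.
  case: (p1) => _ _ /(_ u g) []// ; rewrite -(addrK r (u * g)) -E.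
  by apply: ideal_sub => //; rewrite -mul_polyC; case: i1 => _ _; apply.
have Q0u : Q0 u.
  apply: fminQ => //; apply: leq_ltn_trans su _.
  by rewrite ltn_subrL -subn1 subn_gt0 sg1 lt0n size_poly_eq0.
case: (Zmem Q0 (lead_coef g) k f p0) => //.
by rewrite E; case: (i0) => _ QD _; apply: QD => //; apply: ideal_mulr.
Qed.

(** By [poly_fibre], the top of a chain of length at least two contains a constant [a] absent from
    the bottom. Moving [a] to the bottom costs one step in [C[X]] but enlarges the contraction
    strictly, which is a step in [C]; so only one step is lost in all. Keeping the new chain inside
    the contraction of the top lets [stable_range_poly] prolong it. *)
Theorem poly_chain : noetherian C -> forall m (Q : nat -> {poly C} -> Prop),
  prime_chain m Q -> exists k P, [/\ (m <= k.+1)%N, prime_chain k P,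
    (forall c, P 0%N c <-> contract (Q 0%N) c) &
    forall i, (i <= k)%N -> forall c, P i c -> contract (Q m) c].
Proof.
move=> noeC; elim=> [|m IH] Q Qch.
  exists 0%N, (fun=> contract (Q 0%N)); split=> //.
  by apply: prime_chain_const; apply: contract_prime; apply: Qch.1.
case: m IH Qch => [|m] IH Qch.
  exists 0%N, (fun=> contract (Q 0%N)); split=> // [|_ _ c].
    by apply: prime_chain_const; apply: contract_prime; apply: Qch.1.
  exact: (prime_chain_sub Qch).
have [a [Qa nQa]] : exists a, contract (Q m.+2) a /\ ~ contract (Q 0%N) a.
  apply: NNPP => no.
  have [] := @poly_fibre (Q 0%N) (Q 1%N) (Q m.+2); try by apply: Qch.1.
  - exact: (Qch.2 0%N isT).1.
  - exact: (Qch.2 0%N isT).2.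
  - by move=> f; apply: (prime_chain_sub Qch); rewrite /= leqnn.
  - have [f [Q2f nQ1f]] := (Qch.2 1%N isT).2; exists f; split=> //.
    by apply: (prime_chain_sub Qch) _ Q2f; rewrite /= leqnn.
  - by move=> c Qc; apply: NNPP => nQc; apply: no; exists c.
have [Q' [Q'ch Q'a QQ' Q'Q]] := prime_chain_through (noetherian_poly noeC) Qch Qa.
have [k [P [mk Pch P0 Pm]]] := IH Q' Q'ch.
exists k.+1, (chain_cons (contract (Q 0%N)) P); split=> //.
- apply: prime_chain_cons => //; first by apply: contract_prime; apply: Qch.1.
    by move=> x Qx; apply/P0; apply: QQ'.
  by exists a; split=> //; apply/P0.
- case=> [|i] /= Hi c; first by apply: (prime_chain_sub Qch); rewrite /= leqnn.
  by move/(Pm _ Hi)/Q'Q.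
Qed.

End PolynomialRing.

(** * Relative dimension and birational extensions of finite type *)

(** Bounds the dimension of [C / J] without forming the quotient ring. *)
Definition dim_over (C : comNzRingType) (J : C -> Prop) (e : nat) : Prop :=
  forall m P, prime_chain m P -> (forall x, J x -> P 0%N x) -> (m <= e)%N.

Section Morphisms.
Variables (C A : comNzRingType) (ev : {rmorphism C -> A}).

Definition kernel : C -> Prop := fun c => ev c = 0.

Lemma preim_ideal (Q : A -> Prop) : is_ideal Q -> is_ideal (fun c => Q (ev c)).
Proof.
move=> [Q0 QD QM]; split; first by rewrite rmorph0.
- by move=> x y Qx Qy; rewrite rmorphD; apply: QD.
- by move=> r x Qx; rewrite rmorphM; apply: QM.
Qed.

Lemma preim_prime (Q : A -> Prop) : is_prime_ideal Q -> is_prime_ideal (fun c => Q (ev c)).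
Proof.
move=> [Qi Q1 QM]; split; [exact: preim_ideal|by rewrite rmorph1|].
by move=> a b; rewrite rmorphM; apply: QM.
Qed.

Hypothesis ev_surj : forall a, exists c, ev c = a.

Lemma noetherian_surj : noetherian C -> noetherian A.
Proof.
move=> noeC J Ji Jinc.
have [N HN] := noeC (fun n c => J n (ev c)) (fun n => preim_ideal (Ji n))
  (fun n c => Jinc n (ev c)).
by exists N => n Nn a; have [c <-] := ev_surj a; apply: HN.
Qed.

Lemma dim_over_surj e : dim_over kernel e -> dim_over (fun x : A => x = 0) e.
Proof.
move=> dimC m P [Pp Ps] _; apply: (dimC m (fun i c => P i (ev c))).
  split=> i Hi; first by apply: preim_prime; apply: Pp.
  have [s [x [P1x nPx]]] := Ps i Hi; split=> [c|]; first exact: s.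
  by have [c ec] := ev_surj x; exists c; rewrite ec.
move=> c; rewrite /kernel => ->.
by case: (Pp 0%N isT) => -[].
Qed.

End Morphisms.

Lemma zero_prime (A : idomainType) : is_prime_ideal (fun x : A => x = 0).
Proof.
split; first exact: zero_ideal.
- by apply/eqP; apply: oner_neq0.
- by move=> a b /eqP; rewrite mulf_eq0 => /orP[]/eqP; [left|right].
Qed.

Lemma dim_over_nonzero (A : idomainType) e (s : A) : s != 0 ->
  dim_over (fun x : A => x = 0) e.+1 -> dim_over (principal s) e.
Proof.
move=> ns dimA m P Pch Ps; rewrite -ltnS.
apply: (dimA m.+1 (chain_cons (fun x => x = 0) P)) => //.
have Pp := Pch.1 0%N isT.
apply: prime_chain_cons => //; first exact: zero_prime.
- by move=> x ->; case: Pp => -[].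
- by exists s; split; [apply: Ps; apply: principal_gen | apply/eqP].
Qed.

(** Subrings of [A] are handled through presentations [ev], with [kernel ev] as ideal of relations;
    adjoining [x] is passing to [C[X]]. When [x] is a fraction, [a *: 'X - b%:P] is a relation
    outside the prime [N] of polynomials with coefficients in [kernel ev], and this strict inclusion
    cancels the extra dimension. *)
Lemma dim_adjoin (C : comNzRingType) (A : idomainType) (ev : {rmorphism C -> A}) x e :
  noetherian C -> dim_over (kernel ev) e ->
  exists (C' : comNzRingType) (ev' : {rmorphism C' -> A}),
  [/\ noetherian C', (forall c, exists c', ev' c' = ev c), (exists c', ev' c' = x),
   dim_over (kernel ev') e.+1 &
   (exists a b, ev a != 0 /\ ev a * x = ev b) -> dim_over (kernel ev') e].
Proof.
move=> noeC dimC.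
have cx : commr_rmorph ev x by move=> c; apply: mulrC.
exists {poly C}, (horner_morph cx).
have dim1 m (Q : nat -> {poly C} -> Prop) : prime_chain m Q ->
    (forall c, ev c = 0 -> Q 0%N c%:P) -> (m <= e.+1)%N.
  move=> Qch HQ; have [k [P [mk Pch P0 _]]] := poly_chain noeC Qch.
  by apply: leq_trans mk _; rewrite ltnS; apply: (dimC k P) => // c /HQ /P0.
split.
- exact: noetherian_poly.
- by move=> c; exists c%:P; rewrite /= horner_morphC.
- by exists 'X; rewrite /= horner_morphX.
- move=> m Q Qch HQ; apply: dim1 Qch _ => c c0; apply: HQ.
  by rewrite /kernel /= horner_morphC.
move=> [a [b [na ab]]] m Q Qch HQ; rewrite -ltnS.
pose N : {poly C} -> Prop := fun f => map_poly ev f = 0.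
have Np : is_prime_ideal N := preim_prime (map_poly ev) (zero_prime _).
apply: (dim1 _ (chain_cons N Q)); last by move=> c c0; rewrite /= /N map_polyC /= c0.
apply: prime_chain_cons => //.
- by move=> f Nf; apply: HQ; rewrite /kernel /= /horner_morph Nf horner0.
- exists (a *: 'X - b%:P); split.
    apply: HQ; rewrite /kernel -mul_polyC rmorphB rmorphM /=.
    by rewrite !horner_morphC horner_morphX ab subrr.
  move=> /polyP /(_ 1%N) /eqP; rewrite coef_map coef0 coefB coefZ coefX coefC /=.
  by rewrite mulr1 subr0 (negbTE na).
Qed.

Lemma dim_adjoin_seq (A : idomainType) (C : comNzRingType) (ev : {rmorphism C -> A}) e
    (xs : seq A) :
  noetherian C -> dim_over (kernel ev) e ->
  (forall x, x \in xs -> exists a b, ev a != 0 /\ ev a * x = ev b) ->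
  exists (C' : comNzRingType) (ev' : {rmorphism C' -> A}),
  [/\ noetherian C', (forall c, exists c', ev' c' = ev c),
      (forall x, x \in xs -> exists c', ev' c' = x) & dim_over (kernel ev') e].
Proof.
move=> noeC dimC; elim: xs => [|x xs IH] Hxs.
  by exists C, ev; split=> // c; exists c.
have [|C1 [ev1 [noe1 C1C C1x dim1]]] := IH.
  by move=> y yxs; apply: Hxs; rewrite inE yxs orbT.
have [C2 [ev2 [noe2 C2C C2x _ dim2]]] := dim_adjoin x noe1 dim1.
exists C2, ev2; split=> //.
- by move=> c; have [c1 <-] := C1C c; apply: C2C.
- move=> y; rewrite inE => /orP[/eqP -> //|/C1x [c1 <-]]; exact: C2C.
apply: dim2; have [|a [b [na ab]]] := Hxs x; first exact: mem_head.
by have [a1 Ea] := C1C a; have [b1 Eb] := C1C b; exists a1, b1; rewrite Ea Eb.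
Qed.

(** * Stable range for rows, in particular over R[X] *)

Lemma stable_range_row (C : comNzRingType) (X : (C -> Prop) -> Prop) e r (J : C -> Prop) :
  noetherian C ->
  (forall Q Q', is_prime_ideal Q -> is_prime_ideal Q' ->
     (forall x, Q x -> Q' x) -> X Q' -> X Q) ->
  is_ideal J ->
  (forall m P, prime_chain m P -> (forall i, (i <= m)%N -> X (P i)) ->
     (forall x, J x -> P 0%N x) -> (m <= e)%N) -> (e < r)%N ->
  forall b (g : 'rV[C]_r), exists x : 'rV[C]_r,
  forall Q, is_prime_ideal Q -> X Q -> (forall y, J y -> Q y) ->
    (forall j, Q ((g + b *: x) 0 j)) -> Q b.
Proof.
move=> noeC genX Ji dimX er b g.
pose g' i := oapp (fun j : 'I_r => g 0 j) 0 (insub i).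
have [|x Hx] := @stable_range C noeC X e.+1 J genX Ji _ b g'.
  by move=> P Pch XP JP; have := dimX _ _ Pch XP JP; rewrite ltnn.
exists (\row_j x j) => Q Qp XQ JQ HQ; apply: (Hx Q) => // i ie.
have ir := leq_trans ie er.
by have := HQ (Ordinal ir); rewrite !mxE /g' insubT.
Qed.

(** The primes concerned are those of [R[X]] localized at [1 + s R]. On [V(s)] the dimension drops
    by one. Off [V(s)], the contraction of the top of a chain together with [s] still generates a
    proper ideal, so the contracted chain has one more prime in [R], which makes up for the
    variable. The second correction is a multiple of [s] and leaves the first intact on [V(s)]. *)
Lemma stable_range_poly (R : idomainType) e r (s : R) :
  noetherian R -> dim_over (fun x : R => x = 0) e -> s != 0 -> (e < r)%N ->
  forall b (g : 'rV[{poly R}]_r), exists x : 'rV[{poly R}]_r,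
  forall Q, is_prime_ideal Q -> (forall c, ~ Q (1 + s * c)%:P) ->
    (forall j, Q ((g + b *: x) 0 j)) -> Q b.
Proof.
move=> noeR dimR ns er b g; have noeP := noetherian_poly noeR.
have ns' : s%:P != 0 by rewrite polyC_eq0.
have dimP : dim_over (fun f : {poly R} => f = 0) e.+1.
  move=> m Q Qch _; have [k [P [mk Pch _ _]]] := poly_chain noeR Qch.
  apply: leq_trans mk _; rewrite ltnS; apply: (dimR k P) => // x ->.
  by case: (Pch.1 0%N isT) => -[].
have [||x1 H1] := stable_range_row (X := fun=> True) noeP _ (principal_ideal s%:P) _ er b g.
- by [].
- by move=> m P Pch _; apply: (dim_over_nonzero ns' dimP Pch).
pose X (Q : {poly R} -> Prop) := ~ Q s%:P /\ forall c, ~ Q (1 + s * c)%:P.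
have [||x2 H2] := stable_range_row (X := X) noeP _ (zero_ideal _) _ er (s%:P * b) (g + b *: x1).
- by move=> Q Q' _ _ QQ' [ns1 nc]; split=> [/QQ' //|c /QQ']; apply: nc.
- move=> m P Pch XP _; have [k [P' [mk P'ch _ P'm]]] := poly_chain noeR Pch.
  apply: leq_trans mk _.
  have [nsP ncP] := XP m (leqnn m).
  have Pmp := contract_prime (Pch.1 m (leqnn m)); have [Pmi _ _] := Pmp.
  have [|M [Mp PM]] := prime_over noeR (addI_ideal s Pmi).
    move=> [y [c [Py Ey]]]; apply: (ncP (- c)).
    by move: Py; rewrite /contract; congr (P m _%:P); rewrite Ey; ring.
  pose P'' i := if (i <= k)%N then P' i else M.
  apply: (dimR k.+1 P''); last first.
    by move=> x ->; rewrite /P'' /=; case: (P'ch.1 0%N isT) => -[].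
  split=> i Hi; rewrite /P''.
    by case: ifP => ik //; apply: P'ch.1.
  have [->|ik] : i = k \/ (i < k)%N; last 1 first.
  - by rewrite (ltnW ik) ik; apply: P'ch.2.
  - by move: Hi; rewrite ltnS leq_eqVlt => /orP[/eqP|]; [left | right].
  rewrite leqnn ltnn.
  split=> [x P'x|]; first by apply: PM; apply: addI_sub; apply: P'm P'x.
  exists s; split; first by apply: PM; apply: addI_gen.
  by move/(P'm _ (leqnn k)).
exists (x1 + s%:P *: x2) => Q Qp nQ HQ.
case: (classic (Q s%:P)) => Qs.
  apply: (H1 Q) => // [y [c ->]|j]; first by case: Qp => -[_ _ QM] _ _; apply: QM.
  have Qi : is_ideal Q by case: Qp.
  have Q2 : Q (b * x2 0 j * s%:P) by case: Qi => _ _; apply.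
  apply: (ideal_addKl Qi Q2); have := HQ j; congr (Q _); rewrite !mxE; ring.
have : Q (s%:P * b).
  apply: (H2 Q) => // [y ->|j]; first by case: Qp => -[].
  by have := HQ j; congr (Q _); rewrite !mxE; ring.
by case: Qp => _ _ QM /QM[].
Qed.

Lemma scalemx_inj (A : idomainType) m n (c : A) (M N : 'M[A]_(m, n)) :
  c != 0 -> c *: M = c *: N -> M = N.
Proof.
move=> nc /matrixP eMN; apply/matrixP => i j.
by have := eMN i j; rewrite !mxE; apply: mulfI.
Qed.

(** * Local freeness of the image of an idempotent, and stable range in it *)

Section Idempotent.
Variables (A : idomainType) (n r : nat) (E : 'M[A]_n).
Hypothesis idE : E *m E = E.
Hypothesis rkE : \rank (map_mx (@FracField.tofrac A) E) = r.

Lemma det_split (M N : 'M[A]_n) :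
  \det (M + N) = \sum_(D : {set 'I_n}) \det (\matrix_(i, j) if i \in D then M i j else N i j).
Proof.
rewrite /determinant exchange_big /=; apply: eq_bigr => p _.
rewrite -mulr_sumr; congr (_ * _).
under eq_bigr => i _ do rewrite mxE.
rewrite bigA_distr; apply: eq_big => [D|D _]; first by rewrite inE.
by apply: eq_bigr => i _; rewrite mxE.
Qed.

Definition factors_through (c : A) (G : 'M[A]_(n, r)) (H : 'M[A]_(r, n)) :=
  G *m H = c *: E /\ H *m G = c%:M.

(** Expanding [1 = \det (E + (1 - E))] along the rows gives the sum of the [\det (N D)], where [N D]
    mixes rows of [E] and of [1 - E]; one term is outside [Q]. As [N D] conjugates [E] to the
    coordinate projection on [D], inverting this determinant makes the image of [E] free on [D], and
    ranks over the fraction field give [#|D| = r]. *)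
Lemma local_factor (Q : A -> Prop) : is_prime_ideal Q ->
  exists c G H, ~ Q c /\ factors_through c G H.
Proof.
move=> Qp; pose N (D : {set 'I_n}) : 'M[A]_n :=
  \matrix_(i, j) if i \in D then E i j else (1%:M - E) i j.
have [D nQD] : exists D, ~ Q (\det (N D)).
  apply: NNPP => no; apply: (prime_not1 Qp).
  have <- : \sum_D \det (N D) = 1 by rewrite -det_split addrC subrK det1.
  apply: ideal_sum => [|D _]; first by case: Qp.
  by apply: NNPP => nQ; apply: no; exists D.
pose S : 'M[A]_(#|D|, n) := \matrix_(k, j) (enum_val k == j)%:R.
have SS : S *m S^T = 1%:M.
  apply/matrixP => i j; rewrite !mxE (bigD1 (enum_val i)) //= !mxE eqxx mul1r.
  rewrite big1 ?addr0 => [|k nk]; last by rewrite !mxE eq_sym (negbTE nk) mul0r.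
  by rewrite (inj_eq enum_val_inj) eq_sym.
have NE : N D *m E = S^T *m S *m N D.
  have -> : S^T *m S = \matrix_(i, j) ((i == j) && (i \in D))%:R.
    apply/matrixP => i j; rewrite !mxE; case: (boolP (i \in D)) => iD.
      rewrite (bigD1 (enum_rank_in iD i)) //= !mxE enum_rankK_in // eqxx mul1r.
      rewrite big1 ?addr0 ?andbT // => k; rewrite !mxE => nk.
      rewrite [_ == i](_ : _ = false) ?mul0r //; apply/negbTE; apply: contra nk => /eqP e.
      by apply/eqP/enum_val_inj; rewrite enum_rankK_in.
    rewrite andbF big1 // => k _; rewrite !mxE [_ == i](_ : _ = false) ?mul0r //.
    by apply/negbTE; apply: contra iD => /eqP <-; apply: enum_valP.
  apply/row_matrixP => i; rewrite !row_mul.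
  have -> : row i (N D) = if i \in D then row i E else row i (1%:M - E).
    by apply/rowP => j; rewrite !mxE; case: ifP => _; rewrite !mxE.
  have -> : row i (\matrix_(i, j) ((i == j) && (i \in D))%:R : 'M[A]_n) =
      if i \in D then delta_mx 0 i else 0.
    apply/rowP => j; rewrite !mxE; case: ifP => _; rewrite !mxE ?andbF // andbT eqxx /=.
    by rewrite eq_sym.
  case: ifP => iD; rewrite -row_mul ?mul0mx.
    by rewrite idE -rowE; apply/rowP => j; rewrite !mxE iD.
  by rewrite mulmxBl mul1mx idE subrr row0.
have cD : #|D| = r.
  pose f := @FracField.tofrac A.
  have nd : \det (N D) != 0.
    by apply/eqP => d0; apply: nQD; rewrite d0; case: Qp => -[].
  have uN : map_mx f (N D) \in unitmx.
    by rewrite unitmxE det_map_mx unitfE /f tofrac_eq0.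
  have SSf : map_mx f S *m map_mx f S^T = 1%:M by rewrite -map_mxM SS map_mx1.
  have : \rank (map_mx f (N D) *m map_mx f E) = #|D|.
    rewrite -map_mxM NE map_mxM mxrankMfree ?row_free_unit //.
    apply/eqP; rewrite eqn_leq; apply/andP; split.
      by rewrite map_mxM (leq_trans (mxrankM_maxl _ _)) // rank_leq_col.
    rewrite -{1}(mxrank1 (FracField.type A : fieldType) #|D|).
    have <- : map_mx f S *m map_mx f (S^T *m S) *m map_mx f S^T = 1%:M.
      by rewrite map_mxM !mulmxA SSf mul1mx SSf.
    by rewrite (leq_trans (mxrankM_maxl _ _)) // mxrankM_maxr.
  rewrite eqmxMfull ?rkE // -?row_full_unit.
  by rewrite row_full_unit.
move: S SS NE; rewrite cD => S SS NE.
exists (\det (N D)), (\adj (N D) *m S^T), (S *m N D); split=> //; split.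
- by rewrite -mulmxA (mulmxA S^T) -NE mulmxA mul_adj_mx mul_scalar_mx.
- by rewrite -mulmxA (mulmxA (N D)) mul_mx_adj mul_scalar_mx -scalemxAr SS scalemx1.
Qed.

(** Strata are treated as in [stable_range], with coordinates from [local_factor] over a prime [J].
    The vector is first corrected on [V(c)], by induction, then by [c *: (x *m H)], which changes
    nothing there. Passing to coordinates through [G] brings a second factor [c], whence
    [c * c * b]. *)
Lemma stable_range_proj e (J0 : A -> Prop) : noetherian A -> is_ideal J0 ->
  dim_over J0 e -> (e < r)%N ->
  forall b (u : 'rV[A]_n), exists w : 'rV[A]_n, w *m E = w /\
  forall Q, is_prime_ideal Q -> (forall y, J0 y -> Q y) ->
    (forall j, Q ((u + b *: w) 0 j)) -> Q b.
Proof.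
move=> noeA J0i dimJ0 er.
suff: forall J, is_ideal J -> (forall x, J0 x -> J x) ->
  forall b (u : 'rV[A]_n), exists w : 'rV[A]_n, w *m E = w /\
  forall Q, is_prime_ideal Q -> (forall y, J y -> Q y) ->
    (forall j, Q ((u + b *: w) 0 j)) -> Q b by apply.
apply: (noeth_ind noeA) => J Ji IH J0J b u.
have sub a : ~ J a -> forall b (u : 'rV[A]_n), exists w : 'rV[A]_n, w *m E = w /\
  forall Q, is_prime_ideal Q -> (forall y, J y -> Q y) -> Q a ->
    (forall j, Q ((u + b *: w) 0 j)) -> Q b.
  move=> nJa b' u'.
  have [||||w [wE Hw]] := IH (addI J a) _ _ _ _ b' u'.
  - exact: addI_ideal.
  - exact: addI_sub.
  - by exists a; split=> //; apply: addI_gen.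
  - by move=> x /J0J; apply: addI_sub.
  exists w; split=> // Q Qp JQ Qa; apply: (Hw Q) => //.
  by apply: addI_min => //; case: Qp.
case: (classic (is_prime_ideal J)) => [Jp|/(not_prime_split Ji)[J1|]].
- have [c [G [H [nJc [GH HG]]]]] := local_factor Jp.
  have [w1 [w1E H1]] := sub c nJc b u.
  have [||x Hx] := stable_range_row (X := fun=> True) noeA _ Ji _ er (c * c * b) ((u + b *: w1) *m G).
  + by [].
  + move=> m P Pch _ JP; apply: (dimJ0 m P Pch) => y /J0J; exact: JP.
  exists (w1 + c *: (x *m H)); split.
    rewrite mulmxDl w1E -scalemxAl -mulmxA; congr (_ + _ *: (_ *m _)).
    have nc : c != 0 by apply/eqP => c0; apply: nJc; rewrite c0; case: Ji.
    have : c *: (H *m E) = c *: H by rewrite scalemxAr -GH mulmxA HG mul_scalar_mx.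
    exact: scalemx_inj.
  move=> Q Qp JQ HQ; have Qi : is_ideal Q by case: Qp.
  case: (classic (Q c)) => Qc.
    apply: (H1 Q) => // j.
    have Q2 : Q (b * (x *m H) 0 j * c) by case: Qi => _ _; apply.
    apply: (ideal_addKl Qi Q2); have := HQ j; congr (Q _); rewrite !mxE; ring.
  have : Q (c * c * b).
    apply: (Hx Q) => // j.
    have -> : (u + b *: w1) *m G + c * c * b *: x = (u + b *: (w1 + c *: (x *m H))) *m G.
      rewrite scalerDr addrA [RHS]mulmxDl; congr (_ + _).
      rewrite -!scalemxAl -mulmxA HG mul_mx_scalar !scalerA; congr (_ *: _); ring.
    by rewrite mxE; apply: ideal_sum => // k _; apply: ideal_mulr.
  by case: Qp => _ _ QM /QM[/QM[]|].
- by exists 0; rewrite mul0mx; split=> // Q [_ Q1 _] JQ _; case: Q1; apply: JQ.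
case=> a [c [Jac nJa nJc]].
have [w1 [w1E H1]] := sub a nJa b u.
have [w2 [w2E H2]] := sub c nJc (a * b) (u + b *: w1).
exists (w1 + a *: w2); split; first by rewrite mulmxDl -scalemxAl w1E w2E.
move=> Q Qp JQ HQ; case: (Qp) => Qi Q1 QM.
have Ha : Q a -> Q b.
  move=> Qa; apply: (H1 Q) => // j.
  have Q2 : Q (b * w2 0 j * a) by case: Qi => _ _; apply.
  apply: (ideal_addKl Qi Q2); have := HQ j; congr (Q _); rewrite !mxE; ring.
case: (QM a c (JQ _ Jac)) => // Qc.
have : Q (a * b).
  apply: (H2 Q) => // j.
  by have := HQ j; congr (Q _); rewrite !mxE; ring.
by case/QM.
Qed.

End Idempotent.

(** * Clearing denominators *)

Lemma frac_denom (R : idomainType) (x : {fraction R}) :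
  exists a b : R, b != 0 /\ FracField.tofrac b * x = FracField.tofrac a.
Proof.
elim/quotW: x => x; exists \n_x, \d_x; split; first exact: denom_ratioP.
rewrite !piE; apply/eqmodP; rewrite /= /FracField.equivf /= /FracField.mulf.
by rewrite !numden_Ratio ?oner_neq0 ?mul1r ?denom_ratioP //= mulr1 mulrC.
Qed.

Lemma common_multiple (R : comNzRingType) (Den : R -> Prop) (I : finType) (P : I -> R -> Prop) :
  Den 1 -> (forall c d, Den c -> Den d -> Den (c * d)) ->
  (forall i, exists c, Den c /\ P i c) -> (forall i c d, Den d -> P i c -> P i (d * c)) ->
  exists c, Den c /\ forall i, P i c.
Proof.
move=> D1 DM exP PM; pose c i := sval (constructive_indefinite_description _ (exP i)).
have cP i : Den (c i) /\ P i (c i) by rewrite /c; case: constructive_indefinite_description.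
exists (\prod_i c i); split; first by apply: big_ind => // i _; case: (cP i).
move=> i; rewrite (bigD1 i) //= mulrC; apply: PM; last by case: (cP i).
by apply: big_ind => // k _; case: (cP k).
Qed.

Section ClearDenominators.
Variable R : idomainType.
Local Notation toK := (@FracField.tofrac R).
Local Notation toKX := (map_poly toK).

Lemma clear_poly (f : {poly {fraction R}}) :
  exists c : R, c != 0 /\ exists g : {poly R}, (toK c) *: f = toKX g.
Proof.
have [||||c [nc Hc]] := @common_multiple R (fun c => c != 0) 'I_(size f)
    (fun i c => exists a, toK c * f`_i = toK a).
- exact: oner_neq0.
- by move=> c d; apply: mulf_neq0.
- by move=> i; have [a [b [nb E]]] := frac_denom f`_i; exists b; split=> //; exists a.
- by move=> i c d _ [a E]; exists (d * a); rewrite !tofracM -mulrA E.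
exists c; split=> //.
pose a (i : nat) : R := if insub i is Some k then sval (constructive_indefinite_description _ (Hc k)) else 0.
exists (\poly_(i < size f) a i); apply/polyP => i; rewrite coefZ coef_map coef_poly.
case: ltnP => [ilt|ige]; last by rewrite nth_default // mulr0 raddf0.
by rewrite /a insubT; case: constructive_indefinite_description.
Qed.

Lemma clear_mx m n (M : 'M[{poly {fraction R}}]_(m, n)) :
  exists c : R, c != 0 /\ exists N : 'M[{poly R}]_(m, n), map_mx toKX N = (toK c)%:P *: M.
Proof.
have [||||c [nc Hc]] := @common_multiple R (fun c => c != 0) ('I_m * 'I_n)%type
    (fun ij c => exists g : {poly R}, (toK c) *: M ij.1 ij.2 = toKX g).
- exact: oner_neq0.
- by move=> c d; apply: mulf_neq0.
- by move=> ij; apply: clear_poly.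
- move=> ij c d _ [g E]; exists (d%:P * g).
  by rewrite (rmorphM toKX) /= map_polyC /= tofracM -scalerA E mul_polyC.
exists c; split=> //.
exists (\matrix_(i, j) sval (constructive_indefinite_description _ (Hc (i, j)))).
apply/matrixP => i j; rewrite !mxE; case: constructive_indefinite_description => g /= <-.
by rewrite mul_polyC.
Qed.

End ClearDenominators.

(** * Reduction of matrices over K[X] *)

Section Hermite.
Variable K : fieldType.

(** A nonzero entry of least size among all the columns [U *m v], with [U] invertible, divides the
    other entries of its column, since a nonzero remainder would be smaller. *)
Lemma col_reduce m (v : 'cV[{poly K}]_m.+1) : exists U : 'M[{poly K}]_m.+1,
  U \in unitmx /\ forall i, i != 0 -> (U *m v) i 0 = 0.
Proof.
have [->|nv] := eqVneq v 0.
  by exists 1%:M; split=> [|i _]; rewrite ?unitmx1 // mulmx0 mxE.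
have [k0 nk0] : exists i, v i 0 != 0.
  apply: NNPP => no; case/eqP: nv; apply/matrixP => i j; rewrite ord1 mxE.
  by apply/eqP/negP => /negP nz; apply: no; exists i.
pose S (x : 'M[{poly K}]_m.+1 * 'I_m.+1) := x.1 \in unitmx /\ (x.1 *m v) x.2 0 != 0.
have [[U k] [[/= uU nUk] Umin]] : exists x, S x /\
    forall y, S y -> (size ((x.1 *m v) x.2 0)%R <= size ((y.1 *m v) y.2 0)%R)%N.
  have : S (1%:M, k0) by rewrite /S /= unitmx1 mul1mx.
  move: (1%:M, k0) => x; have [n] := ubnP (size ((x.1 *m v) x.2 0)%R).
  elim: n x => // n IH x; rewrite ltnS => sx Sx.
  case: (classic (exists y, S y /\ (size ((y.1 *m v) y.2 0)%R < size ((x.1 *m v) x.2 0)%R)%N)).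
    by move=> [y [Sy sy]]; apply: (IH y) => //; apply: leq_trans sy sx.
  move=> no; exists x; split=> // y Sy; rewrite leqNgt; apply/negP => sy.
  by apply: no; exists y.
set w := U *m v in nUk Umin.
have elim_unit (c : 'cV[{poly K}]_m.+1) : c k 0 = 0 -> 1%:M - c *m delta_mx 0 k \in unitmx.
  move=> ck; have [] // := @mulmx1_unit _ _ (1%:M - c *m delta_mx 0 k) (1%:M + c *m delta_mx 0 k).
  rewrite mulmxDr mulmx1 mulmxBl mul1mx mulmxA -(mulmxA c) -rowE.
  have -> : row k c = 0 by apply/matrixP => i j; rewrite ord1 (ord1 j) !mxE ck.
  by rewrite mulmx0 mul0mx subr0 subrK.
have elimE (c : 'cV[{poly K}]_m.+1) i : ((1%:M - c *m delta_mx 0 k) *m w) i 0 = w i 0 - c i 0 * w k 0.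
  by rewrite mulmxBl mul1mx -mulmxA -rowE !mxE big_ord1 !mxE.
pose c : 'cV[{poly K}]_m.+1 := \col_i (if i == k then 0 else w i 0 %/ w k 0).
have ck : c k 0 = 0 by rewrite mxE eqxx.
have cw i : i != k -> w i 0 - c i 0 * w k 0 = 0.
  move=> ik; apply: NNPP => /eqP nz; have := Umin ((1%:M - c *m delta_mx 0 k) *m U, i).
  rewrite /S /= -mulmxA elimE unitmx_mul uU elim_unit // nz => /(_ (conj isT isT)).
  rewrite leqNgt => /negP; apply.
  have -> : c i 0 = w i 0 %/ w k 0 by rewrite mxE (negbTE ik).
  by rewrite {1}(divp_eq (w i 0) (w k 0)) addrC addKr ltn_modp.
exists (tperm_mx 0 k *m ((1%:M - c *m delta_mx 0 k) *m U)); split.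
  by rewrite !unitmx_mul uU elim_unit // unitmx_perm.
move=> i ni; rewrite -mulmxA -xrowE mxE -mulmxA elimE.
case: tpermP => [i0|ik|_ ik]; first by rewrite i0 eqxx in ni.
  by apply: cw; rewrite -ik eq_sym.
by apply: cw; apply/eqP.
Qed.

(** The row space of [M] is free: the rows of [F *m M] are a basis and [G] expresses the rows of [M]
    in it. Once the first column is reduced to a single entry, that entry is either zero, and the
    column drops out, or it contributes one basis row. *)
Lemma row_space_free n m (M : 'M[{poly K}]_(m, n)) :
  exists k (F : 'M[{poly K}]_(k, m)) (G : 'M[{poly K}]_(m, k)),
  [/\ F *m G = 1%:M, G *m F *m M = M & forall x : 'rV_k, x *m (F *m M) = 0 -> x = 0].
Proof.
elim: n m M => [|n IH] m M.
  exists 0%N, 0, 0; split; [ by rewrite [LHS]flatmx0 [RHS]flatmx0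
    | by rewrite [RHS]thinmx0 [LHS]thinmx0
    | by move=> x _; apply: thinmx0 ].
case: m M => [|m] M.
  exists 0%N, 0, 0; split; [ by rewrite [LHS]flatmx0 [RHS]flatmx0
    | by rewrite [RHS]flatmx0 [LHS]flatmx0
    | by move=> x _; apply: thinmx0 ].
have [U [uU Uv]] := col_reduce (@lsubmx _ m.+1 1 n M).
have [T defT] : exists T : 'M_(1 + m, 1 + n), T = U *m M by exists (U *m M).
have Tdl : dlsubmx T = 0.
  apply/matrixP => i j; rewrite defT !mxE ord1.
  apply: etrans (Uv (rshift 1 i) isT); rewrite mxE.
  by apply: eq_bigr => l _; rewrite mxE; congr (_ * M _ _); apply: val_inj.
have ET : T = block_mx (ulsubmx T) (ursubmx T) 0 (drsubmx T) by rewrite -Tdl submxK.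
have EM : M = invmx U *m T by rewrite defT mulKmx.
have [g0|ng] := eqVneq (ulsubmx T 0 0) 0.
  have [k [F [G [FG GFN inj]]]] := IH _ (rsubmx T).
  have ET' : T = row_mx 0 (rsubmx T).
    have Er : rsubmx T = col_mx (ursubmx T) (drsubmx T) by rewrite {1}ET block_mxEh row_mxKr.
    have ul0 : ulsubmx T = 0 by rewrite [LHS]mx11_scalar g0 raddf0.
    by rewrite Er {1}ET ul0 block_mxEh col_mx0.
  exists k, (F *m U), (invmx U *m G); split.
  - by rewrite mulmxA -(mulmxA F) mulmxV // mulmx1.
  - transitivity (invmx U *m (G *m F *m T)); first by rewrite {1}EM !mulmxA mulmxK.
    by rewrite {1}ET' mul_mx_row mulmx0 GFN -ET' -EM.
  - move=> x; rewrite -(mulmxA F) -defT => E0.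
    have {E0} : x *m (F *m T) = 0 := E0.
    rewrite ET' mul_mx_row mulmx0 mul_mx_row mulmx0 => E0.
    by apply: inj; have := congr1 rsubmx E0; rewrite row_mxKr linear0.
have [k [F [G [FG GFN inj]]]] := IH _ (drsubmx T).
pose F1 : 'M_(1 + k, 1 + m) := block_mx 1%:M 0 0 F.
pose G1 : 'M_(1 + m, 1 + k) := block_mx 1%:M 0 0 G.
have FG1 : F1 *m G1 = 1%:M.
  by rewrite mulmx_block !mulmx0 !mul0mx !addr0 !add0r mulmx1 FG -scalar_mx_block.
have F1T : F1 *m T = block_mx (ulsubmx T) (ursubmx T) 0 (F *m drsubmx T).
  by rewrite {1}ET mulmx_block !mulmx0 !mul0mx !addr0 !add0r !mul1mx.
have GFT : G1 *m F1 *m T = T.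
  by rewrite -mulmxA F1T mulmx_block !mulmx0 !mul0mx !addr0 !add0r !mul1mx mulmxA GFN -ET.
exists (1 + k)%N, (F1 *m U), (invmx U *m G1); split.
- by rewrite mulmxA -(mulmxA F1) mulmxV // mulmx1.
- transitivity (invmx U *m (G1 *m F1 *m T)); first by rewrite {1}EM !mulmxA mulmxK.
  by rewrite GFT -EM.
- move=> x; rewrite -(mulmxA F1) -defT => E0.
  have {E0} : x *m (F1 *m T) = 0 := E0.
  rewrite F1T.
  rewrite -[x](@hsubmxK _ 1 1 k) mul_row_block mulmx0 addr0 => E0.
  have x0 : lsubmx x = 0.
    have := congr1 lsubmx E0; rewrite row_mxKl linear0 => /matrixP/(_ 0 0).
    rewrite !mxE big_ord1 => /eqP; rewrite mulf_eq0 (negbTE ng) orbF => /eqP H.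
    by apply/matrixP => i j; rewrite !ord1 [RHS]mxE.
  rewrite x0 in E0 *; have := congr1 rsubmx E0; rewrite row_mxKr linear0 mul0mx add0r.
  by move/inj => ->; rewrite row_mx0.
Qed.

End Hermite.

Lemma inj_map_mx (R S : Type) (f : R -> S) m n : injective f -> injective (@map_mx R S f m n).
Proof.
move=> f_inj M N /matrixP eMN; apply/matrixP => i j.
by have := eMN i j; rewrite !mxE => /f_inj.
Qed.

Lemma tofrac_inj (R : idomainType) : injective (@FracField.tofrac R).
Proof. by move=> x y /eqP; rewrite tofrac_eq => /eqP. Qed.

(** * Generic freeness of the projective module *)

Section GenericFactorization.
Variables (R A : idomainType) (ev : {rmorphism {poly R} -> A}) (Den : {poly R} -> Prop).
Local Notation toK := (@FracField.tofrac R).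
Hypothesis ev_inj : injective ev.
Hypothesis Den1 : Den 1.
Hypothesis DenM : forall f g, Den f -> Den g -> Den (f * g).
Hypothesis Den_neq0 : forall f, Den f -> f != 0.
Hypothesis ev_den : forall a, exists f g, Den f /\ ev f * a = ev g.

Lemma ev_eq0 f : (ev f == 0) = (f == 0).
Proof. by rewrite -(inj_eq ev_inj) rmorph0. Qed.

Lemma den_mx m n (M : 'M[A]_(m, n)) :
  exists f N, Den f /\ ev f *: M = map_mx ev N.
Proof.
have [||f [Df Hf]] := @common_multiple {poly R} Den ('I_m * 'I_n)%type
    (fun ij f => exists g, ev f * M ij.1 ij.2 = ev g) Den1 DenM.
- by move=> ij; have [f [g [Df E]]] := ev_den (M ij.1 ij.2); exists f; split=> //; exists g.
- by move=> ij f d _ [g E]; exists (d * g); rewrite !rmorphM -mulrA E.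
exists f, (\matrix_(i, j) sval (constructive_indefinite_description _ (Hf (i, j)))).
split=> //; apply/matrixP => i j; rewrite !mxE.
by case: constructive_indefinite_description.
Qed.

(** A basis of the row space of the numerator of [E] is found over [K[X]], where denominators are
    constants; this is why [c] lies in [R]. The equation [G *m H = c *: E] expresses that the basis
    generates, and [H *m G = c] follows from its independence. *)
Lemma generic_factor n r (E : 'M[A]_n) : E *m E = E ->
  \rank (map_mx (@FracField.tofrac A) E) = r ->
  exists c G H, c != 0 /\ @factors_through A n r E (ev c%:P) G H.
Proof.
move=> idE rkE; have [d [Eh [Dd defE]]] := den_mx E.
have inj_toKX : injective (map_poly toK).
  by apply: map_inj_poly; [exact: tofrac_inj | exact: rmorph0].
have [k [F [G [FG GFE inj]]]] := row_space_free (map_mx (map_poly toK) Eh).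
have [c1 [nc1 [F1 defF]]] := clear_mx F.
have [c2 [nc2 [G1 defG]]] := clear_mx G.
pose c := c1 * c2; have nc : c != 0 by apply: mulf_neq0.
have ntoK x : x != 0 -> (toK x)%:P != 0 by rewrite polyC_eq0 tofrac_eq0.
have toKc : (toK c1)%:P * (toK c2)%:P = map_poly toK c%:P.
  by rewrite map_polyC /= -polyCM -tofracM.
have FG1 : F1 *m G1 = c%:P%:M.
  apply: (inj_map_mx inj_toKX); rewrite map_mxM map_scalar_mx.
  rewrite [map_mx _ F1]defF [map_mx _ G1]defG -scalemxAl -scalemxAr FG.
  by rewrite scalerA toKc scalemx1.
have GFE1 : G1 *m F1 *m Eh = c%:P *: Eh.
  apply: (inj_map_mx inj_toKX); rewrite !map_mxM map_mxZ.
  rewrite [map_mx _ F1]defF [map_mx _ G1]defG -scalemxAl -scalemxAr -!scalemxAl GFE.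
  by rewrite scalerA mulrC toKc.
have inj1 (x : 'rV_k) : x *m (F1 *m Eh) = 0 -> x = 0.
  move=> /(congr1 (map_mx (map_poly toK))); rewrite !map_mxM [map_mx _ F1]defF.
  rewrite -scalemxAl -scalemxAr map_mx0 => E0.
  apply: (inj_map_mx inj_toKX); rewrite map_mx0; apply: inj.
  by apply: (scalemx_inj (ntoK _ nc1)); rewrite E0 scaler0.
pose Fa := map_mx ev F1; pose Ga := map_mx ev G1.
have ned : ev d != 0 by rewrite ev_eq0 Den_neq0.
have FGa : Fa *m Ga = (ev c%:P)%:M by rewrite -map_mxM FG1 map_scalar_mx.
have GFEa : Ga *m Fa *m E = ev c%:P *: E.
  apply: (scalemx_inj ned); rewrite scalemxAr defE -!map_mxM GFE1 map_mxZ -defE.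
  by rewrite !scalerA mulrC.
have inja (x : 'rV_k) : x *m (Fa *m E) = 0 -> x = 0.
  have [f [y [Df defx]]] := den_mx x => xFE.
  have nef : ev f != 0 by rewrite ev_eq0 Den_neq0.
  suff y0 : y = 0 by apply: (scalemx_inj nef); rewrite defx y0 map_mx0 scaler0.
  apply: inj1; apply: (inj_map_mx ev_inj); rewrite map_mx0 !map_mxM -defx -defE.
  by rewrite -scalemxAr -scalemxAl -scalemxAr -/Fa xFE !scaler0.
have nca : ev c%:P != 0 by rewrite ev_eq0 polyC_eq0.
pose H := Fa *m E.
have GH : Ga *m H = ev c%:P *: E by rewrite mulmxA.
have HG : H *m Ga = (ev c%:P)%:M.
  apply/row_matrixP => i; apply/eqP; rewrite -subr_eq0 -linearB; apply/eqP; apply: inja.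
  rewrite -row_mul mulmxBl -mulmxA (mulmxA Ga) GFEa -scalemxAr -mulmxA idE.
  by rewrite mul_scalar_mx subrr linear0.
have ek : k = r.
  pose f := @FracField.tofrac A.
  have nf : f (ev c%:P) != 0 by rewrite /f tofrac_eq0.
  apply/eqP; rewrite eqn_leq -rkE; apply/andP; split.
    have {1}<- : \rank ((f (ev c%:P))%:M : 'M_k) = k.
      by rewrite -scalemx1 mxrank_scale_nz ?mxrank1.
    rewrite -map_scalar_mx -HG.
    have -> : H *m Ga = Fa *m E *m Ga by [].
    by rewrite !map_mxM (leq_trans (mxrankM_maxl _ _)) // mxrankM_maxr.
  rewrite -(mxrank_scale_nz _ nf) -map_mxZ -GH map_mxM.
  by rewrite (leq_trans (mxrankM_maxr _ _)) // rank_leq_row.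
by exists c; move: {inja FGa GFEa} Ga H GH HG; rewrite ek => Ga H GH HG; exists Ga, H.
Qed.

End GenericFactorization.

(** * Automorphisms of A + P as matrices *)

Section Equivalence.
Variables (A : comNzRingType) (n : nat) (E : 'M[A]_n).
Hypothesis idE : E *m E = E.

Definition projAP : 'M[A]_(1 + n) := block_mx 1%:M 0 0 E.

(* Pairs (b, u) with u = u E are the elements of A + P, where P = A^n E. *)
Definition equivalent (v v' : 'rV[A]_(1 + n)) :=
  exists S S' : 'M[A]_(1 + n),
  [/\ projAP *m S = S, S *m projAP = S, projAP *m S' = S', S' *m projAP = S' &
   [/\ S *m S' = projAP, S' *m S = projAP & v *m S = v']].

Lemma equivalent_trans v1 v2 v3 : equivalent v1 v2 -> equivalent v2 v3 -> equivalent v1 v3.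
Proof.
move=> [S [S' [eS Se eS' Se' [SS S'S vS]]]] [T [T' [eT Te eT' Te' [TT T'T vT]]]].
exists (S *m T), (T' *m S'); split.
- by rewrite mulmxA eS.
- by rewrite -mulmxA Te.
- by rewrite mulmxA eT'.
- by rewrite -mulmxA Se'.
- split.
  + by rewrite mulmxA -(mulmxA S) TT Se SS.
  + by rewrite mulmxA -(mulmxA T') S'S Te' T'T.
  + by rewrite mulmxA vS vT.
Qed.

Lemma equivalent_addr b u w : u *m E = u -> w *m E = w ->
  equivalent (row_mx b%:M u) (row_mx b%:M (u + b *: w)).
Proof.
move=> uE wE; exists (block_mx 1%:M w 0 E), (block_mx 1%:M (- w) 0 E).
have wE' : (- w) *m E = - w by rewrite mulNmx wE.
split; rewrite /projAP.
1,2,3,4: by rewrite mulmx_block ?(mulmx0, mul0mx, addr0, add0r, mul1mx, mulmx1) ?idE ?wE ?wE'.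
split.
- by rewrite mulmx_block ?(mulmx0, mul0mx, addr0, add0r, mul1mx, mulmx1) wE idE addNr.
- by rewrite mulmx_block ?(mulmx0, mul0mx, addr0, add0r, mul1mx, mulmx1) wE' idE subrr.
- by rewrite mul_row_block mulmx1 mulmx0 addr0 uE mul_scalar_mx addrC.
Qed.

Lemma equivalent_addl b u (x : 'cV[A]_n) : u *m E = u ->
  equivalent (row_mx b%:M u) (row_mx (b%:M + u *m x) u).
Proof.
move=> uE; exists (block_mx 1%:M 0 (E *m x) E), (block_mx 1%:M 0 (- (E *m x)) E).
split; rewrite /projAP.
1,2,3,4: by rewrite mulmx_block ?(mulmx0, mul0mx, addr0, add0r, mul1mx, mulmx1) ?mulmxN ?mulNmx ?mulmxA ?idE // -mulmxA.
split.
- by rewrite mulmx_block ?(mulmx0, mul0mx, addr0, add0r, mul1mx, mulmx1) mulmxN mulmxA idE subrr.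
- by rewrite mulmx_block ?(mulmx0, mul0mx, addr0, add0r, mul1mx, mulmx1) mulmxA idE addNr.
- by rewrite mul_row_block mulmx1 mulmx0 add0r mulmxA uE.
Qed.

Lemma equivalent_unimodular b u (x : 'cV[A]_n) : u *m E = u -> u *m x = 1%:M ->
  equivalent (row_mx b%:M u) (row_mx 1%:M 0).
Proof.
move=> uE ux; apply: equivalent_trans (equivalent_addl b ((1 - b) *: x) uE) _.
rewrite -scalemxAr ux scalemx1 -raddfD /= addrC subrK.
have := @equivalent_addr 1 u (- u) uE; rewrite scale1r subrr; apply.
by rewrite mulNmx uE.
Qed.

End Equivalence.

(** * Matrices defined over a localization *)

Section Denominators.
Variables (B B' : comNzRingType) (phi : {rmorphism B -> B'}).

(** A matrix over [B[1/c]] is encoded by its image in [B'], which in the applications is a field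
    containing [B = A], or the polynomial ring over it when [B] is [A[lambda]]. *)
Definition locmx (c : B) m n (M : 'M[B']_(m, n)) :=
  exists k (N : 'M[B]_(m, n)), phi (c ^+ k) *: M = map_mx phi N.

Lemma locmx_map c m n (N : 'M[B]_(m, n)) : locmx c (map_mx phi N).
Proof. by exists 0%N, N; rewrite expr0 rmorph1 scale1r. Qed.

Lemma locmxM c m n p (M : 'M_(m, n)) (N : 'M_(n, p)) :
  locmx c M -> locmx c N -> locmx c (M *m N).
Proof.
move=> [k [M' EM]] [l [N' EN]]; exists (k + l)%N, (M' *m N').
by rewrite map_mxM -EM -EN exprD rmorphM -scalemxAr -scalemxAl scalerA mulrC.
Qed.

Lemma locmx_block c m1 m2 n1 n2 (M1 : 'M_(m1, n1)) (M2 : 'M_(m1, n2)) (M3 : 'M_(m2, n1))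
  (M4 : 'M_(m2, n2)) : locmx c M1 -> locmx c M2 -> locmx c M3 -> locmx c M4 ->
  locmx c (block_mx M1 M2 M3 M4).
Proof.
move=> [k1 [N1 E1]] [k2 [N2 E2]] [k3 [N3 E3]] [k4 [N4 E4]].
exists (k1 + k2 + k3 + k4)%N, (block_mx (c ^+ (k2 + k3 + k4) *: N1)
  (c ^+ (k1 + k3 + k4) *: N2) (c ^+ (k1 + k2 + k4) *: N3) (c ^+ (k1 + k2 + k3) *: N4)).
rewrite map_block_mx !map_mxZ -E1 -E2 -E3 -E4 scale_block_mx !scalerA -!rmorphM -!exprD.
by congr block_mx; congr (phi (_ ^+ _) *: _); ring.
Qed.

Lemma locmxD c m n (M N : 'M_(m, n)) : locmx c M -> locmx c N -> locmx c (M + N).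
Proof.
move=> [k [M' EM]] [l [N' EN]]; exists (k + l)%N, (c ^+ l *: M' + c ^+ k *: N').
by rewrite map_mxD !map_mxZ -EM -EN scalerDr !scalerA -!rmorphM -!exprD addnC.
Qed.

Lemma locmxMr c d m n (M : 'M_(m, n)) : locmx c M -> locmx (c * d) M.
Proof.
move=> [k [M' EM]]; exists k, (d ^+ k *: M').
by rewrite map_mxZ -EM exprMn mulrC rmorphM scalerA.
Qed.

Definition comaximal (x y : B) := exists a b, a * x + b * y = 1.

Lemma comaximal_mul x y z : comaximal x z -> comaximal y z -> comaximal (x * y) z.
Proof.
move=> [a [b E1]] [c [d E2]]; exists (a * c), (a * x * d + b).
by rewrite -[RHS]E1 -[in RHS](mulr1 (a * x)) -E2; ring.
Qed.

Lemma comaximal_sym x y : comaximal x y -> comaximal y x.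
Proof. by move=> [a [b E]]; exists b, a; rewrite addrC. Qed.

Lemma comaximal_exp x y k : comaximal x y -> comaximal (x ^+ k) y.
Proof.
move=> xy; elim: k => [|k IH]; first by exists 1, 0; rewrite mulr1 mul0r addr0.
by rewrite exprS; apply: comaximal_mul.
Qed.

Lemma comaximal_expp x y k l : comaximal x y -> comaximal (x ^+ k) (y ^+ l).
Proof. by move=> xy; apply/comaximal_exp/comaximal_sym/comaximal_exp/comaximal_sym. Qed.

(** A relation between powers of [c] and [d] recombines the two numerators. This is the step by
    which [glue] descends to [A]. *)
Lemma locmx_comaximal c d m n (M : 'M_(m, n)) : comaximal c d ->
  locmx c M -> locmx d M -> exists N, M = map_mx phi N.
Proof.
move=> cd [k [N1 E1]] [l [N2 E2]]; have [a [b E]] := comaximal_expp k l cd.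
exists (a *: N1 + b *: N2).
rewrite map_mxD !map_mxZ -E1 -E2 !scalerA -!rmorphM -scalerDl -rmorphD E.
by rewrite rmorph1 scale1r.
Qed.

End Denominators.

(** * Families in one variable and Quillen's patching *)

Lemma horner_sub (B : comNzRingType) (p : {poly B}) x y :
  exists c, p.[x] - p.[y] = (x - y) * c.
Proof.
have : root (p - p.[y]%:P) y by rewrite /root !hornerE subrr.
case/factor_theorem => q E; exists q.[x].
by have := congr1 (horner^~ x) E; rewrite !hornerE mulrC.
Qed.

Lemma rmorph_eq0_inj (A B : nzRingType) (phi : {rmorphism A -> B}) x :
  injective phi -> (phi x == 0) = (x == 0).
Proof. by move=> phi_inj; rewrite -(inj_eq phi_inj) rmorph0. Qed.

Section Evaluation.
Variables (A : idomainType) (L : fieldType) (toL : {rmorphism A -> L}).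
Hypothesis toL_inj : injective toL.
Local Notation toLX := (map_poly toL).

Definition evmx (y : A) m n (M : 'M[{poly L}]_(m, n)) : 'M[L]_(m, n) :=
  map_mx (horner_eval (toL y)) M.

Lemma evmxM y m n p (M : 'M_(m, n)) (N : 'M_(n, p)) : evmx y (M *m N) = evmx y M *m evmx y N.
Proof. exact: map_mxM. Qed.

Lemma evmxC y m n (M : 'M[L]_(m, n)) : evmx y (map_mx polyC M) = M.
Proof. by apply/matrixP => i j; rewrite !mxE /horner_eval hornerC. Qed.

Lemma evmx1 y n : evmx y (1%:M : 'M_n) = 1%:M.
Proof. exact: map_mx1. Qed.

Lemma evmx_toLX y m n (N : 'M[{poly A}]_(m, n)) :
  evmx y (map_mx toLX N) = map_mx toL (map_mx (horner_eval y) N).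
Proof. by apply/matrixP => i j; rewrite !mxE /horner_eval horner_map. Qed.

Lemma evmxZ y c m n (M : 'M[{poly L}]_(m, n)) : evmx y (c *: M) = c.[toL y] *: evmx y M.
Proof. by apply/matrixP => i j; rewrite !mxE /horner_eval hornerM. Qed.

Lemma evmx_loc c y m n (M : 'M[{poly L}]_(m, n)) :
  locmx toLX c%:P M -> locmx toL c (evmx y M).
Proof.
move=> [k [N E]]; exists k, (map_mx (horner_eval y) N).
by rewrite -evmx_toLX -E evmxZ -polyC_exp /= map_polyC hornerC.
Qed.

Lemma locmx_polyC c m n (M : 'M[L]_(m, n)) :
  locmx toL c M -> locmx toLX c%:P (map_mx polyC M).
Proof.
move=> [k [N E]]; exists k, (map_mx polyC N).
apply/matrixP => i j; have /matrixP/(_ i j) := E; rewrite !mxE -polyC_exp /= !map_polyC /=.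
by rewrite -polyCM => ->.
Qed.

(** The difference [y - y0] divides every [N(y) - N(y0)]. A high power of [c] in it therefore
    removes the part [c] of the denominator [c * d] and leaves a factor [c ^+ l] to spare. *)
Lemma evmx_near c d l m n (M : 'M[{poly L}]_(m, n)) :
  c != 0 -> locmx toLX (c * d)%:P M -> exists k0, forall k y y0 e, (k0 <= k)%N ->
    y = y0 + c ^+ k * e -> exists N,
    toL (d ^+ k) *: (evmx y M - evmx y0 M) = toL (c ^+ l) *: map_mx toL N.
Proof.
move=> nc [k0 [N E]]; exists (k0 + l)%N => k y y0 e kk Ey.
pose a i j := sval (constructive_indefinite_description _ (horner_sub (N i j) y y0)).
have aE i j : (N i j).[y] - (N i j).[y0] = (y - y0) * a i j.
  by rewrite /a; case: constructive_indefinite_description.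
have ED : toL ((c * d) ^+ k0) *: (evmx y M - evmx y0 M) =
    map_mx toL (\matrix_(i, j) (c ^+ k * (e * a i j))).
  rewrite scalerBr.
  have EM z : toL ((c * d) ^+ k0) *: evmx z M = map_mx toL (map_mx (horner_eval z) N).
    by rewrite -evmx_toLX -E evmxZ -polyC_exp /= map_polyC hornerC.
  rewrite !EM -map_mxB; congr map_mx; apply/matrixP => i j; rewrite !mxE /horner_eval aE.
  by rewrite Ey addrAC subrr add0r mulrA.
exists (\matrix_(i, j) (d ^+ (k - k0) * c ^+ (k - (k0 + l)) * (e * a i j))).
have nck : toL (c ^+ k0) != 0 by rewrite rmorph_eq0_inj // expf_neq0.
apply: (scalemx_inj nck); rewrite !scalerA.
have k0k : (k0 <= k)%N := leq_trans (leq_addr _ _) kk.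
have -> : toL (c ^+ k0) * toL (d ^+ k) = toL (d ^+ (k - k0)) * toL ((c * d) ^+ k0).
  by rewrite -!rmorphM -[in LHS](subnK k0k) exprD exprMn; congr (toL _); ring.
rewrite -[LHS]scalerA ED -rmorphM -!map_mxZ; congr map_mx; apply/matrixP => i j; rewrite !mxE.
have -> : c ^+ k = c ^+ (k - (k0 + l)) * (c ^+ k0 * c ^+ l) by rewrite -!exprD subnK.
by ring.
Qed.

End Evaluation.

Section Glue.
Variables (A : idomainType) (L : fieldType) (toL : {rmorphism A -> L}).
Variables (n r : nat) (E : 'M[A]_n).
Local Notation toLX := (map_poly toL).
Local Notation evmx := (evmx toL).
Hypothesis toL_inj : injective toL.

Definition basis1 m : 'rV[L]_(1 + m) := row_mx 1%:M 0.
Definition basis1X m : 'rV[{poly L}]_(1 + m) := row_mx 1%:M 0.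

Lemma evmx_basis1X y m : evmx y (basis1X m) = basis1 m.
Proof. by rewrite /evmx map_row_mx map_mx1 map_mx0. Qed.

(* sigma := sigma2(1) theta(y)^-1 with theta = sigma1^-1 sigma2 is defined over
   the localization at u2 when y is divisible by a high power of s u1, and over
   the localization at s u1 when y = 1 modulo a high power of u2. *)
Theorem glue (s u1 u2 rho : A) (D1 : 'M[L]_(1 + n, 1 + r)) (D2 : 'M[L]_(1 + r, 1 + n))
    (S1 T1 S2 T2 : 'M[{poly L}]_(1 + r)) (V : 'rV[{poly L}]_(1 + r)) (v : 'rV[A]_(1 + n)) :
  s != 0 -> u1 != 0 -> u2 != 0 -> u2 = 1 + s * u1 * rho ->
  D2 *m D1 = 1%:M -> D1 *m D2 = map_mx toL (projAP E) ->
  (exists N, toL s *: D1 = map_mx toL N) -> (exists N, D2 = map_mx toL N) ->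
  S1 *m T1 = 1%:M -> S2 *m T2 = 1%:M ->
  locmx toLX (s * u1)%:P S1 -> locmx toLX (s * u1)%:P T1 ->
  locmx toLX (s * u2)%:P S2 -> locmx toLX (s * u2)%:P T2 ->
  V *m S1 = basis1X r -> V *m S2 = basis1X r ->
  evmx 0 S1 = evmx 0 S2 ->
  locmx toL u2 (D1 *m evmx 1 S2 *m D2) -> locmx toL u2 (D1 *m evmx 1 T2 *m D2) ->
  evmx 1 V *m D2 = map_mx toL v -> basis1 r *m D2 = basis1 n ->
  equivalent E v (row_mx 1%:M 0).
Proof.
move=> ns nu1 nu2 defu2 D21 D12 [D1' defD1] [D2' defD2] ST1 ST2 lS1 lT1 lS2 lT2 VS1 VS2.
move=> S0 lS2D lT2D Vv b1.
have TS1 := mulmx1C ST1; have TS2 := mulmx1C ST2.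
pose Th := T1 *m S2; pose Th' := T2 *m S1.
(* [C M] is the constant family equal to [M] at 1, so [Ps] is the identity at 1 and sigma2(1)
   theta(y)^-1 is also sigma1(1) [Ps](y): one expression is studied near 0, the other near 1. *)
pose C M := map_mx polyC (evmx 1 M) : 'M[{poly L}]_(1 + r).
pose Ps := C Th *m Th'; pose Ps' := Th *m C Th'.
have nsu : s * u1 != 0 by apply: mulf_neq0.
have lC c M : locmx toLX c%:P M -> locmx toLX c%:P (C M).
  by move=> lM; apply/locmx_polyC/evmx_loc.
have l3 c M : locmx toLX (s * c)%:P M -> forall d, locmx toLX (s * c * d)%:P M.
  by move=> lM d; rewrite polyCM; apply: locmxMr.
have l3' M : locmx toLX (s * u2)%:P M -> locmx toLX (s * u1 * u2)%:P M.
  by move=> /l3 /(_ u1); rewrite mulrAC.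
have lTh : locmx toLX (s * u1 * u2)%:P Th by apply: locmxM; [apply: l3 | apply: l3'].
have lTh' : locmx toLX (s * u1 * u2)%:P Th' by apply: locmxM; [apply: l3' | apply: l3].
have lPs : locmx toLX (u2 * (s * u1))%:P Ps by rewrite mulrC; apply: locmxM => //; apply: lC.
have lPs' : locmx toLX (u2 * (s * u1))%:P Ps' by rewrite mulrC; apply: locmxM => //; apply: lC.
(* Near 0 the spare factor [(s * u1) ^+ 1] absorbs the denominator [s] of [D1]. Near 1 that
   denominator is allowed, [s * u1] being inverted. *)
have [k1 H1] := evmx_near toL_inj 1 nsu lTh; have [k2 H2] := evmx_near toL_inj 1 nsu lTh'.
have [k3 H3] := evmx_near toL_inj 0 nu2 lPs; have [k4 H4] := evmx_near toL_inj 0 nu2 lPs'.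
pose K := (k1 + k2 + k3 + k4)%N.
have cop : comaximal (s * u1) u2.
  by exists (- rho), 1; rewrite defu2; ring.
have [a [b Eab]] := comaximal_expp K K cop.
pose y := a * (s * u1) ^+ K.
have Ey0 : y = 0 + (s * u1) ^+ K * a by rewrite add0r mulrC.
have Ey1 : y = 1 + u2 ^+ K * (- b) by rewrite -Eab /y; ring.
have ThTh' : Th *m Th' = 1%:M by rewrite mulmxA -(mulmxA T1) ST2 mulmx1 TS1.
have Th'Th : Th' *m Th = 1%:M by rewrite mulmxA -(mulmxA T2) ST1 mulmx1 TS2.
have eTh z : evmx z Th *m evmx z Th' = 1%:M by rewrite -evmxM ThTh' evmx1.
have eTh' z : evmx z Th' *m evmx z Th = 1%:M by rewrite -evmxM Th'Th evmx1.
have Th0 : evmx 0 Th = 1%:M by rewrite evmxM -S0 -evmxM TS1 evmx1.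
have Th0' : evmx 0 Th' = 1%:M by rewrite evmxM S0 -evmxM TS2 evmx1.
have Ps1 : evmx 1 Ps = 1%:M by rewrite evmxM evmxC eTh.
have Ps1' : evmx 1 Ps' = 1%:M by rewrite evmxM evmxC eTh.
have lD1 : locmx toL s D1 by exists 1%N, D1'; rewrite expr1.
have lD2 c : locmx toL c D2 by rewrite defD2; apply: locmx_map.
have near0 M : evmx 0 M = 1%:M -> (exists N, toL (u2 ^+ K) *: (evmx y M - evmx 0 M) =
    toL ((s * u1) ^+ 1) *: map_mx toL N) -> locmx toL u2 (D1 *m evmx y M *m D2).
  move=> M0 [N EN]; rewrite -(subrK (evmx 0 M) (evmx y M)) M0 mulmxDr mulmxDl mulmx1 D12.
  apply: locmxD; last exact: locmx_map.
  exists K, (u1 *: (D1' *m N *m D2')).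
  rewrite M0 in EN.
  transitivity (D1 *m (toL (u2 ^+ K) *: (evmx y M - 1%:M)) *m D2).
    by rewrite -scalemxAr -scalemxAl.
  rewrite EN expr1.
  by rewrite map_mxZ !map_mxM -defD1 -defD2 -!scalemxAr -!scalemxAl scalerA -rmorphM mulrC.
have near1 M : evmx 1 M = 1%:M -> (exists N, toL ((s * u1) ^+ K) *: (evmx y M - evmx 1 M) =
    toL (u2 ^+ 0) *: map_mx toL N) -> locmx toL (s * u1) (evmx y M).
  move=> M1 [N EN]; rewrite -(subrK (evmx 1 M) (evmx y M)); apply: locmxD.
    by exists K, N; rewrite EN expr0 rmorph1 scale1r.
  by rewrite M1 -(map_mx1 toL); apply: locmx_map.
have [kK1 kK2 kK3 kK4] : [/\ k1 <= K, k2 <= K, k3 <= K & k4 <= K]%N.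
  by split; rewrite /K; lia.
pose sg := evmx 1 S2 *m evmx y Th'; pose tg := evmx y Th *m evmx 1 T2.
have Esg : sg = evmx 1 S1 *m evmx y Ps.
  rewrite evmxM evmxC mulmxA -evmxM /Th mulmxA ST1 mul1mx; done.
have Etg : tg = evmx y Ps' *m evmx 1 T1.
  rewrite evmxM evmxC -mulmxA -evmxM /Th' -mulmxA ST1 mulmx1; congr (_ *m _).
have DD (M N : 'M[L]_(1 + r)) : (D1 *m M *m D2) *m (D1 *m N *m D2) = D1 *m (M *m N) *m D2.
  by rewrite !mulmxA -(mulmxA _ D2) D21 mulmx1.
have [Sa ESa] : exists N, D1 *m sg *m D2 = map_mx toL N.
  apply: (locmx_comaximal (comaximal_sym cop)).
    by rewrite -DD; apply: locmxM => //; apply: near0 => //; apply: H2 Ey0.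
  rewrite Esg; apply: locmxM => //; apply: locmxM; first exact: locmxMr.
  apply: locmxM; first exact: evmx_loc.
  by apply: near1 => //; apply: H3 Ey1.
have [Ta ETa] : exists N, D1 *m tg *m D2 = map_mx toL N.
  apply: (locmx_comaximal (comaximal_sym cop)).
    by rewrite -DD; apply: locmxM => //; apply: near0 => //; apply: H1 Ey0.
  rewrite Etg; apply: locmxM => //; apply: locmxM; first exact: locmxMr.
  apply: locmxM; last exact: evmx_loc.
  by apply: near1 => //; apply: H4 Ey1.
have inj := inj_map_mx toL_inj.
have sgtg : sg *m tg = 1%:M.
  by rewrite mulmxA -(mulmxA (evmx 1 S2)) eTh' mulmx1 -evmxM ST2 evmx1.
have tgsg := mulmx1C sgtg.
have pD1 : map_mx toL (projAP E) *m D1 = D1 by rewrite -D12 -mulmxA D21 mulmx1.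
have D2p : D2 *m map_mx toL (projAP E) = D2 by rewrite -D12 mulmxA D21 mul1mx.
exists Sa, Ta; split; [| | | |split]; apply: inj; rewrite !map_mxM -?ESa -?ETa ?DD.
- by rewrite !mulmxA pD1.
- by rewrite -!mulmxA D2p.
- by rewrite !mulmxA pD1.
- by rewrite -!mulmxA D2p.
- by rewrite sgtg mulmx1 D12.
- by rewrite tgsg mulmx1 D12.
rewrite -Vv !mulmxA -(mulmxA _ D2) D21 mulmx1 -evmxM VS2 evmx_basis1X.
have -> : basis1 r = evmx y (basis1X r) by rewrite evmx_basis1X.
rewrite -evmxM -VS2 -mulmxA /Th' (mulmxA S2) ST2 mul1mx VS1 evmx_basis1X b1.
by rewrite map_row_mx map_mx1 map_mx0.
Qed.

End Glue.

(** * Transvections with controlled denominators, and their patching *)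

Section LocalScalars.
Variables (B B' : comNzRingType) (phi : {rmorphism B -> B'}).

Definition loc (c : B) (x : B') := exists k a, phi (c ^+ k) * x = phi a.

Lemma loc_map c a : loc c (phi a).
Proof. by exists 0%N, a; rewrite expr0 rmorph1 mul1r. Qed.

Lemma loc1 c : loc c 1.
Proof. by rewrite -(rmorph1 phi); apply: loc_map. Qed.

Lemma locM c x y : loc c x -> loc c y -> loc c (x * y).
Proof.
move=> [k [a Ea]] [l [b Eb]]; exists (k + l)%N, (a * b).
by rewrite rmorphM -Ea -Eb exprD rmorphM mulrACA.
Qed.

Lemma locD c x y : loc c x -> loc c y -> loc c (x + y).
Proof.
move=> [k [a Ea]] [l [b Eb]]; exists (k + l)%N, (c ^+ l * a + c ^+ k * b).
by rewrite rmorphD !rmorphM -Ea -Eb exprD rmorphM; ring.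
Qed.

Lemma locN c x : loc c x -> loc c (- x).
Proof. by move=> [k [a Ea]]; exists k, (- a); rewrite rmorphN -Ea mulrN. Qed.

Lemma locmx_scale c x m n (M : 'M_(m, n)) : loc c x -> locmx phi c M -> locmx phi c (x *: M).
Proof.
move=> [k [a Ea]] [l [N EN]]; exists (k + l)%N, (a *: N).
by rewrite map_mxZ -Ea -EN exprD rmorphM !scalerA; congr (_ *: _); ring.
Qed.

Lemma loc_entry c (M : 'M_1) : locmx phi c M -> loc c (M 0 0).
Proof.
by move=> [k [N /matrixP/(_ 0 0) E]]; exists k, (N 0 0); move: E; rewrite !mxE.
Qed.

Lemma locmx1 c n : locmx phi c (1%:M : 'M_n).
Proof. by rewrite -(map_mx1 phi); apply: locmx_map. Qed.

Lemma locmx0 c m n : locmx phi c (0 : 'M_(m, n)).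
Proof. by rewrite -(map_mx0 phi); apply: locmx_map. Qed.

Lemma locmxN c m n (M : 'M_(m, n)) : locmx phi c M -> locmx phi c (- M).
Proof. by rewrite -scaleN1r; apply: locmx_scale; apply/locN/loc1. Qed.

End LocalScalars.

Section Transvections.
Variables (B : comNzRingType) (r : nat).
Implicit Types (b : B) (p q : 'rV[B]_r) (z : 'cV[B]_r).

Definition upper q : 'M[B]_(1 + r) := block_mx 1%:M q 0 1%:M.
Definition lower z : 'M[B]_(1 + r) := block_mx 1%:M 0 z 1%:M.
(** When [h = p + b *: q] satisfies [h *m z = 1], the three factors carry [(b, p)] successively to
    [(b, h)], [(1, h)] and [(1, 0)]. *)
Definition trans_mx b p q z :=
  upper q *m lower ((1 - b) *: z) *m upper (- (p + b *: q)).
Definition trans_inv b p q z :=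
  upper (p + b *: q) *m lower (- ((1 - b) *: z)) *m upper (- q).

Lemma upperN q : upper q *m upper (- q) = 1%:M.
Proof.
rewrite mulmx_block ?(mulmx0, mul0mx, addr0, add0r, mul1mx, mulmx1) addNr.
by rewrite -scalar_mx_block.
Qed.

Lemma lowerN z : lower z *m lower (- z) = 1%:M.
Proof.
rewrite mulmx_block ?(mulmx0, mul0mx, addr0, add0r, mul1mx, mulmx1) subrr.
by rewrite -scalar_mx_block.
Qed.

Lemma trans_mxK b p q z : trans_mx b p q z *m trans_inv b p q z = 1%:M.
Proof.
rewrite /trans_mx /trans_inv !mulmxA -(mulmxA _ (upper (- _))).
by rewrite (mulmx1C (upperN _)) mulmx1 -(mulmxA (upper q)) lowerN mulmx1 upperN.
Qed.

Lemma trans_mx_row b p q z : (p + b *: q) *m z = 1%:M ->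
  row_mx b%:M p *m trans_mx b p q z = row_mx 1%:M 0.
Proof.
move=> Hz; rewrite !mulmxA !mul_row_block !mulmx1 !mulmx0 !addr0 mul_scalar_mx (addrC _ p).
by rewrite -scalemxAr Hz scalemx1 -raddfD [b + _]addrC subrK mulmxN mul1mx add0r addNr.
Qed.

End Transvections.

Section TransvectionsLoc.
Variables (B B' : comNzRingType) (phi : {rmorphism B -> B'}) (c : B) (r : nat).

Lemma trans_loc b (p q : 'rV_r) z : loc phi c b -> locmx phi c p -> locmx phi c q ->
  locmx phi c z -> locmx phi c (trans_mx b p q z) /\ locmx phi c (trans_inv b p q z).
Proof.
move=> lb lp lq lz.
have lz' : locmx phi c ((1 - b) *: z).
  by apply: locmx_scale => //; apply: locD; [apply: loc1 | apply: locN].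
have lh : locmx phi c (p + b *: q) by apply: locmxD => //; apply: locmx_scale.
have lU (x : 'rV_r) : locmx phi c x -> locmx phi c (upper x).
  by move=> lx; apply: locmx_block; try exact: locmx1; try exact: locmx0.
have lL (x : 'cV_r) : locmx phi c x -> locmx phi c (lower x).
  by move=> lx; apply: locmx_block; try exact: locmx1; try exact: locmx0.
split; apply: locmxM; rewrite -/(upper _) -/(lower _).
- by apply: locmxM; [apply: lU | apply: lL].
- by apply: lU; apply: locmxN.
- by apply: locmxM; [apply: lU | apply: lL; apply: locmxN].
- by apply: lU; apply: locmxN.
Qed.

End TransvectionsLoc.

Lemma map_trans_mx (B B' : comNzRingType) (phi : {rmorphism B -> B'}) r b (p q : 'rV_r) z :
  map_mx phi (trans_mx b p q z) = trans_mx (phi b) (map_mx phi p) (map_mx phi q) (map_mx phi z).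
Proof.
rewrite /trans_mx !map_mxM !map_block_mx !map_mx1 !map_mx0 map_mxN map_mxD !map_mxZ.
by rewrite rmorphB (rmorph1 phi).
Qed.

Lemma map_trans_inv (B B' : comNzRingType) (phi : {rmorphism B -> B'}) r b (p q : 'rV_r) z :
  map_mx phi (trans_inv b p q z) = trans_inv (phi b) (map_mx phi p) (map_mx phi q) (map_mx phi z).
Proof.
rewrite /trans_inv !map_mxM !map_block_mx !map_mx1 !map_mx0 !map_mxN map_mxD !map_mxZ.
by rewrite rmorphB (rmorph1 phi).
Qed.

Lemma factors_through_id (A : idomainType) n r (E : 'M[A]_n) c G (H : 'M[A]_(r, n)) :
  c != 0 -> factors_through E c G H -> H *m E = H /\ E *m G = G.
Proof.
move=> nc [GH HG]; split; apply: (scalemx_inj nc).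
  by rewrite scalemxAr -GH mulmxA HG mul_scalar_mx.
by rewrite scalemxAl -GH -mulmxA HG mul_mx_scalar.
Qed.

Section EvaluationTransvections.
Variables (A : idomainType) (L : fieldType) (toL : {rmorphism A -> L}) (y : A) (r : nat).
Local Notation evmx := (evmx toL).

Lemma evmxD m n (M N : 'M[{poly L}]_(m, n)) : evmx y (M + N) = evmx y M + evmx y N.
Proof. exact: map_mxD. Qed.

Lemma evmx_trans_mx b (p q : 'rV_r) z : evmx y (trans_mx b p q z) =
  trans_mx b.[toL y] (evmx y p) (evmx y q) (evmx y z).
Proof. exact: map_trans_mx. Qed.

Lemma evmx_trans_inv b (p q : 'rV_r) z : evmx y (trans_inv b p q z) =
  trans_inv b.[toL y] (evmx y p) (evmx y q) (evmx y z).
Proof. exact: map_trans_inv. Qed.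

End EvaluationTransvections.

Section GlueTransvections.
Variables (A : idomainType) (L : fieldType) (toL : {rmorphism A -> L}).
Variables (n r : nat) (E : 'M[A]_n).
Local Notation toLX := (map_poly toL).
Local Notation evmx := (evmx toL).
Hypothesis toL_inj : injective toL.
Variables (s : A) (G : 'M[A]_(n, r)) (H : 'M[A]_(r, n)).
Hypothesis ns : s != 0.
Hypothesis EGH : factors_through E s G H.

Let HE : H *m E = H := (factors_through_id ns EGH).1.
Let ntoL x : x != 0 -> toL x != 0. Proof. by rewrite rmorph_eq0_inj. Qed.

(** Coordinates of [A + P] on a free module of rank [1 + r] and, with [D2], back; only [D1] has a
    denominator. *)
Definition D1 : 'M[L]_(1 + n, 1 + r) := block_mx 1%:M 0 0 ((toL s)^-1 *: map_mx toL G).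
Definition D2 : 'M[L]_(1 + r, 1 + n) := block_mx 1%:M 0 0 (map_mx toL H).

Lemma D21 : D2 *m D1 = 1%:M.
Proof.
rewrite mulmx_block ?(mulmx0, mul0mx, addr0, add0r, mul1mx) -scalemxAr -map_mxM.
rewrite (proj2 EGH) map_scalar_mx scale_scalar_mx mulVf ?ntoL //.
by rewrite -scalar_mx_block.
Qed.

Lemma D12 : D1 *m D2 = map_mx toL (projAP E).
Proof.
rewrite mulmx_block ?(mulmx0, mul0mx, addr0, add0r, mul1mx) -scalemxAl -map_mxM.
rewrite (proj1 EGH) map_mxZ scalerA mulVf ?ntoL // scale1r.
by rewrite map_block_mx map_mx1 !map_mx0.
Qed.

Lemma D1_upper_D2 q : D1 *m upper q *m D2 =
  block_mx 1%:M (q *m map_mx toL H) 0 (map_mx toL E).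
Proof.
have := D12; rewrite /projAP map_block_mx map_mx1 !map_mx0.
rewrite !mulmx_block ?(mulmx0, mul0mx, addr0, add0r, mul1mx, mulmx1).
by move=> /eq_block_mx[_ _ _ ->].
Qed.

Lemma D1_lower_D2 z : D1 *m lower z *m D2 =
  block_mx 1%:M 0 ((toL s)^-1 *: map_mx toL G *m z) (map_mx toL E).
Proof.
have := D12; rewrite /projAP map_block_mx map_mx1 !map_mx0.
rewrite !mulmx_block ?(mulmx0, mul0mx, addr0, add0r, mul1mx, mulmx1).
by move=> /eq_block_mx[_ _ _ ->].
Qed.

(** The columns [f1], [f2] are right inverses of the corrected rows for every value of the variable,
    but uncontrolled. The columns [z1], [z2] have the wanted values at 0, where the families must
    agree, and [z2] also at 1, where the denominator [s] must disappear; they are right inverses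
    only at these points. *)
Theorem glue_transvections (u1 u2 rho b0 : A) (u : 'rV[A]_n) (Q : 'rV[A]_r) (x : 'cV[A]_n)
    (b : {poly L}) (p q1 q2 : 'rV[{poly L}]_r) (f1 f2 z1 z2 : 'cV[{poly L}]_r) :
  u *m E = u ->
  u1 != 0 -> u2 != 0 -> u2 = 1 + s * u1 * rho ->
  (p + b *: q1) *m f1 = 1%:M -> (p + b *: q2) *m f2 = 1%:M ->
  loc toLX s%:P b -> locmx toLX s%:P p ->
  locmx toLX s%:P q1 -> locmx toLX s%:P q2 ->
  locmx toLX (s * u1)%:P f1 -> locmx toLX (s * u2)%:P f2 ->
  locmx toLX (s * u1)%:P z1 -> locmx toLX (s * u2)%:P z2 ->
  evmx 0 q1 = evmx 0 q2 -> evmx 0 z1 = evmx 0 z2 ->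
  evmx 0 ((p + b *: q1) *m z1) = 1%:M ->
  b.[1] = toL b0 -> evmx 1 p = (toL s)^-1 *: map_mx toL (u *m G) ->
  evmx 1 q2 = map_mx toL Q -> evmx 1 z2 = (toL u2)^-1 *: map_mx toL (H *m x) ->
  (u + b0 *: (Q *m H)) *m x = u2%:M ->
  equivalent E (row_mx b0%:M u) (row_mx 1%:M 0).
Proof.
move=> uE nu1 nu2 defu2 hf1 hf2 lb lp lq1 lq2 lf1 lf2 lz1 lz2 q0 z0 hz0 b1 p1 q21 z21 hx.
(* Given a right inverse [f] of [h], this is another one, equal to [z] wherever [z] already is
   one. *)
pose zz h (z f : 'cV[{poly L}]_r) := z + (1 - ((h : 'rV[{poly L}]_r) *m z) 0 0) *: f.
have hzz h z f : h *m f = 1%:M -> h *m zz h z f = 1%:M.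
  move=> hf; rewrite mulmxDr -scalemxAr hf scalemx1 [h *m z]mx11_scalar -raddfD /=.
  by rewrite !mxE eqxx mulr1n addrC subrK.
have zzE y h z f : evmx y (h *m z) = 1%:M -> evmx y (zz h z f) = evmx y z.
  move=> hz; rewrite /evmx map_mxD map_mxZ rmorphB rmorph1 /=.
  have -> : horner_eval (toL y) ((h *m z) 0 0) = 1.
    by have /matrixP/(_ 0 0) := hz; rewrite !mxE eqxx.
  by rewrite subrr scale0r addr0.
pose h1 := p + b *: q1; pose h2 := p + b *: q2.
pose w1 := zz h1 z1 f1; pose w2 := zz h2 z2 f2.
have lzz c q z f : locmx toLX (s * c)%:P z -> locmx toLX (s * c)%:P f ->
    locmx toLX s%:P q -> locmx toLX (s * c)%:P (zz (p + b *: q) z f).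
  move=> lz lf lq; rewrite polyCM in lz lf *.
  apply: locmxD => //; apply: locmx_scale => //.
  apply: locD; first exact: loc1.
  apply/locN/loc_entry/locmxM => //; apply: locmxMr.
  by apply: locmxD => //; apply: locmx_scale.
have lb' c : loc toLX (s * c)%:P b.
  by have [k [a Ea]] := lb; exists k, (c%:P ^+ k * a);
     rewrite polyCM exprMn !rmorphM -Ea; ring.
have lMr c m l (M : 'M_(m, l)) : locmx toLX s%:P M -> locmx toLX (s * c)%:P M.
  by move=> lM; rewrite polyCM; apply: locmxMr.
have [lS1 lT1] := trans_loc (lb' u1) (lMr u1 _ _ _ lp) (lMr u1 _ _ _ lq1) (lzz _ _ _ _ lz1 lf1 lq1).
have [lS2 lT2] := trans_loc (lb' u2) (lMr u2 _ _ _ lp) (lMr u2 _ _ _ lq2) (lzz _ _ _ _ lz2 lf2 lq2).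
have h2x : evmx 1 h2 = (toL s)^-1 *: map_mx toL ((u + b0 *: (Q *m H)) *m G).
  rewrite /h2 evmxD evmxZ p1 q21 rmorph1 b1.
  rewrite mulmxDl map_mxD scalerDr; congr (_ + _).
  rewrite -scalemxAl -mulmxA (proj2 EGH) mul_mx_scalar !map_mxZ !scalerA.
  by rewrite mulrCA mulVf ?ntoL // mulr1.
have GHE (M : 'rV[A]_n) : M *m E = M -> (M *m G) *m H = s *: M.
  by move=> ME; rewrite -mulmxA (proj1 EGH) -scalemxAr ME.
have hE : (u + b0 *: (Q *m H)) *m E = u + b0 *: (Q *m H).
  by rewrite mulmxDl uE -scalemxAl -mulmxA HE.
have h2z2 : evmx 1 (h2 *m z2) = 1%:M.
  rewrite evmxM h2x z21 -scalemxAl -scalemxAr -map_mxM mulmxA GHE // -scalemxAl hx.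
  rewrite map_mxZ map_scalar_mx !scalerA scale_scalar_mx; congr (_%:M).
  transitivity ((toL s)^-1 * toL s * ((toL u2)^-1 * toL u2)); first by ring.
  by rewrite !mulVf ?ntoL // mulr1.
have w21 : evmx 1 w2 = (toL u2)^-1 *: map_mx toL (H *m x) by rewrite zzE.
have h2H : evmx 1 h2 *m map_mx toL H = map_mx toL (u + b0 *: (Q *m H)).
  rewrite h2x -scalemxAl -map_mxM GHE // map_mxZ scalerA mulVf ?ntoL //.
  by rewrite scale1r.
(* The relation [G *m H = s *: E] cancels the [1/s] of [D1], so that only [u2] remains in the
   denominator. *)
have lowD : (toL s)^-1 *: map_mx toL G *m ((1 - toL b0) *: ((toL u2)^-1 *: map_mx toL (H *m x))) =
    (1 - toL b0) *: ((toL u2)^-1 *: map_mx toL (E *m x)).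
  rewrite -!scalemxAr -scalemxAl -map_mxM mulmxA (proj1 EGH) -scalemxAl map_mxZ.
  by rewrite (scalerA (toL s)^-1) mulVf ?ntoL // scale1r.
have llow : locmx toL u2 ((1 - toL b0) *: ((toL u2)^-1 *: map_mx toL (E *m x))).
  apply: locmx_scale; first by apply: locD; [apply: loc1 | apply/locN/loc_map].
  by exists 1%N, (E *m x); rewrite expr1 scalerA mulfV ?ntoL // scale1r.
have lUD q N : q *m map_mx toL H = map_mx toL N -> locmx toL u2 (D1 *m upper q *m D2).
  move=> qN; rewrite D1_upper_D2 qN; apply: locmx_block; try exact: locmx1; try exact: locmx0.
    exact: locmx_map.
  exact: locmx_map.
have lLD z : locmx toL u2 ((toL s)^-1 *: map_mx toL G *m z) -> locmx toL u2 (D1 *m lower z *m D2).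
  move=> lz; rewrite D1_lower_D2; apply: locmx_block; try exact: locmx1; try exact: locmx0.
    by [].
  exact: locmx_map.
have DD (M N : 'M[L]_(1 + r)) : D1 *m (M *m N) *m D2 = (D1 *m M *m D2) *m (D1 *m N *m D2).
  by rewrite !mulmxA -(mulmxA _ D2) D21 mulmx1.
have h21 : evmx 1 p + b.[1] *: evmx 1 q2 = evmx 1 h2.
  by rewrite /h2 evmxD evmxZ rmorph1.
have qH : evmx 1 q2 *m map_mx toL H = map_mx toL (Q *m H) by rewrite q21 map_mxM.
have hz0' : evmx 0 (h2 *m z2) = 1%:M.
  by rewrite -hz0 !evmxM z0 /h2 !evmxD !evmxZ q0.
have w10 : evmx 0 w1 = evmx 0 z1 by rewrite zzE.
have w20 : evmx 0 w2 = evmx 0 z2 by rewrite zzE.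
have VS1 : row_mx b%:M p *m trans_mx b p q1 w1 = basis1X L r.
  by apply: trans_mx_row; apply: hzz.
have VS2 : row_mx b%:M p *m trans_mx b p q2 w2 = basis1X L r.
  by apply: trans_mx_row; apply: hzz.
have S0 : evmx 0 (trans_mx b p q1 w1) = evmx 0 (trans_mx b p q2 w2).
  by rewrite evmx_trans_mx evmx_trans_mx w10 w20 q0 z0.
have D1int : exists N, toL s *: D1 = map_mx toL N.
  exists (block_mx s%:M 0 0 G); rewrite scale_block_mx map_block_mx map_scalar_mx !map_mx0.
  by rewrite !scaler0 scalemx1 scalerA mulfV ?ntoL // scale1r.
have D2int : exists N, D2 = map_mx toL N.
  by exists (block_mx 1%:M 0 0 H); rewrite map_block_mx map_mx1 !map_mx0.
apply: (glue toL_inj ns nu1 nu2 defu2 D21 D12 D1int D2int (trans_mxK _ _ _ _) (trans_mxK _ _ _ _)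
  lS1 lT1 lS2 lT2 VS1 VS2 S0).
- rewrite evmx_trans_mx rmorph1.
  rewrite /trans_mx !DD; apply: locmxM; first apply: locmxM.
  + exact: lUD qH.
  + by apply: lLD; rewrite b1 w21 lowD.
  + by apply: (lUD _ (- (u + b0 *: (Q *m H)))); rewrite h21 mulNmx h2H map_mxN.
- rewrite evmx_trans_inv rmorph1.
  rewrite /trans_inv !DD; apply: locmxM; first apply: locmxM.
  + by apply: (lUD _ (u + b0 *: (Q *m H))); rewrite h21 h2H.
  + by apply: lLD; rewrite b1 w21 mulmxN lowD; apply: locmxN.
  + by apply: (lUD _ (- (Q *m H))); rewrite mulNmx qH map_mxN.
- rewrite /evmx map_row_mx map_scalar_mx /= -/(evmx 1 p) p1 /horner_eval rmorph1 b1.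
  rewrite mul_row_block !mulmx0 addr0 add0r mulmx1 -scalemxAl -map_mxM GHE //.
  by rewrite map_mxZ scalerA mulVf ?ntoL // scale1r map_row_mx map_scalar_mx.
- by rewrite mul_row_block !mulmx0 mul0mx addr0 mulmx1 add0r.
Qed.

End GlueTransvections.

(** * Corrections over R[X] and assembly of the two families *)

Lemma row_meets (C : comNzRingType) (S : C -> Prop) r (h : 'rV[C]_r) :
  noetherian C -> S 1 -> (forall x y, S x -> S y -> S (x * y)) ->
  (forall Q, is_prime_ideal Q -> (forall x, S x -> ~ Q x) -> ~ forall j, Q (h 0 j)) ->
  exists x (f : 'cV[C]_r), S x /\ h *m f = x%:M.
Proof.
move=> noeC S1 SM Hh; apply: NNPP => no.
pose J x := exists f : 'cV[C]_r, h *m f = x%:M.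
have Ji : is_ideal J.
  split; first by exists 0; rewrite mulmx0 raddf0.
  - by move=> x y [f Ef] [g Eg]; exists (f + g); rewrite mulmxDr Ef Eg raddfD.
  - by move=> c x [f Ef]; exists (c *: f); rewrite -scalemxAr Ef scale_scalar_mx.
have [x Sx [f Ef]|Q [Qp JQ SQ]] := prime_disjoint noeC S1 SM Ji.
  by apply: no; exists x, f.
apply: (Hh Q Qp SQ) => j; apply: JQ; exists (delta_mx j 0).
by rewrite -colE [LHS]mx11_scalar mxE.
Qed.

Section Core.
Variables (R A : idomainType) (ev : {rmorphism {poly R} -> A}) (e r : nat).
Hypothesis ev_inj : injective ev.
Hypothesis noeR : noetherian R.
Hypothesis dimR : dim_over (fun x : R => x = 0) e.
Hypothesis er : (e < r)%N.

Definition at0 m n (M : 'M[{poly R}]_(m, n)) : 'M[R]_(m, n) := map_mx (horner_eval 0) M.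

Lemma prime_X_at0 (Q : {poly R} -> Prop) f : is_prime_ideal Q -> Q 'X -> Q f -> Q f.[0]%:P.
Proof.
move=> [Qi _ _] QX Qf.
have /factor_theorem [q Eq] : root (f - f.[0]%:P) 0 by rewrite /root !hornerE subrr.
have -> : f.[0]%:P = f - q * 'X by rewrite -[in q * 'X](subr0 'X) -polyC0 -Eq; ring.
by apply: ideal_sub => //; case: Qi => _ _; apply.
Qed.

(** The correction is fixed to [q0] at [X = 0] because the stable range is applied to a multiple of
    ['X]. A prime that contains the corrected row and avoids the allowed elements contains [B] or
    ['X]: the first contradicts the relation on [(B, g)], the second, after evaluation at 0, the
    relation at 0. As [q0] does not depend on [t], corrections for different [t] agree at 0. *)
Lemma unimodular_correction (s t : R) (B : {poly R}) (g : 'rV[{poly R}]_r) (q0 : 'rV[R]_r)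
    (a : {poly R}) (f : 'cV[{poly R}]_r) (f0 : 'cV[R]_r) k k0 :
  s * t != 0 ->
  (a * B)%:M + g *m f = (s ^+ k)%:P%:M ->
  (at0 g + (s ^+ 2 * B.[0]) *: q0) *m f0 = (s ^+ k0)%:M ->
  exists (q : 'rV[{poly R}]_r) (f : 'cV[{poly R}]_r) k c,
    (g + ((s ^+ 2)%:P * B) *: (map_mx polyC q0 + 'X *: q)) *m f =
    (s ^+ k * (1 + s * t * c))%:P%:M.
Proof.
move=> nst Hf Hf0.
pose g0 := g + ((s ^+ 2)%:P * B) *: map_mx polyC q0.
have [q Hq] := stable_range_poly noeR dimR nst er ((s ^+ 2)%:P * B * 'X) g0.
have Eq : g + ((s ^+ 2)%:P * B) *: (map_mx polyC q0 + 'X *: q) =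
    g0 + ((s ^+ 2)%:P * B * 'X) *: q by rewrite scalerDr scalerA addrA.
pose S x := exists k c, x = (s ^+ k * (1 + s * t * c))%:P.
have [|||x [f1 [[k1 [c1 ->]] E1]]] := @row_meets _ S _ (g0 + ((s ^+ 2)%:P * B * 'X) *: q)
   (noetherian_poly noeR).
- by exists 0%N, 0; rewrite mulr0 addr0 mulr1.
- move=> _ _ [k1 [c1 ->]] [k2 [c2 ->]]; exists (k1 + k2)%N, (c1 + c2 + s * t * c1 * c2).
  by rewrite -polyCM exprD; congr (_%:P); ring.
- move=> Q Qp QS HQ; case: (Qp) => Qi Q1 QM.
  have nQs : ~ Q s%:P by apply: QS; exists 1%N, 0; rewrite mulr0 addr0 mulr1.
  have nQsk l : ~ Q (s ^+ l)%:P by rewrite polyC_exp => /(prime_exp Qp).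
  have Qb : Q ((s ^+ 2)%:P * B * 'X).
    apply: (Hq Q Qp) => // c; apply: QS; exists 0%N, c; by rewrite expr0 mul1r.
  have Qg0 j : Q (g0 0 j).
    have Qbq : Q ((s ^+ 2)%:P * B * 'X * q 0 j) by apply: ideal_mulr.
    by apply: (ideal_addKl Qi Qbq); rewrite addrC; have := HQ j; rewrite mxE [in X in _ + X]mxE.
  have [QB|QX] : Q B \/ Q 'X.
    by case: (QM _ _ Qb) => [/QM[/nQsk|]|]; [|left|right].
  + apply: (nQsk k).
    have /matrixP/(_ 0 0) := Hf; rewrite !mxE eqxx !mulr1n => <-.
    case: (Qi) => _ QD QZ; apply: (QD); first exact: QZ.
    apply: ideal_sum => // j _; apply: ideal_mulr => //.
    have Qbq : Q ((s ^+ 2)%:P * B * (q0 0 j)%:P) by apply: ideal_mulr => //; apply: QZ.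
    by apply: (ideal_addKl Qi Qbq); have := Qg0 j; rewrite !mxE addrC.
  + apply: (nQsk k0).
    have /matrixP/(_ 0 0) := Hf0; rewrite !mxE eqxx mulr1n => <-.
    rewrite rmorph_sum; apply: ideal_sum => // j _.
    rewrite rmorphM; apply: ideal_mulr => //=.
    have := prime_X_at0 Qp QX (Qg0 j); congr (Q _%:P).
    by rewrite !mxE /horner_eval !hornerE /=; ring.
by exists q, f1, k1, c1; rewrite Eq.
Qed.

(* f(X) is sent to f(lambda x), where x = ev X and lambda is the variable of {poly A}. *)
Definition scale_var : {poly R} -> {poly A} :=
  comp_poly (ev 'X *: 'X) \o map_poly (ev \o polyC).

HB.instance Definition _ := GRing.RMorphism.on scale_var.

Lemma scale_varC c : scale_var c%:P = (ev c%:P)%:P.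
Proof. by rewrite /scale_var /= map_polyC comp_polyC. Qed.

Lemma ev_horner f : (map_poly (ev \o polyC) f).[ev 'X] = ev f.
Proof.
rewrite -[in RHS](coefK f) poly_def rmorph_sum horner_coef size_map_inj_poly.
- by apply: eq_bigr => i _; rewrite coef_map -mul_polyC rmorphM rmorphXn.
- by move=> x y /ev_inj /polyC_inj.
- by rewrite rmorph0.
Qed.

Lemma scale_var1 f : (scale_var f).[1] = ev f.
Proof. by rewrite /scale_var /= horner_comp hornerZ hornerX mulr1 ev_horner. Qed.

Lemma scale_var0 f : (scale_var f).[0] = ev f.[0]%:P.
Proof.
rewrite /scale_var /= horner_comp hornerZ hornerX mulr0.
by rewrite -[0 in LHS](rmorph0 (ev \o polyC)) horner_map.
Qed.

Variables (L : fieldType) (toL : {rmorphism A -> L}).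
Hypothesis toL_inj : injective toL.
Local Notation toLX := (map_poly toL).
Local Notation evmx := (evmx toL).

Let kX m n (M : 'M[{poly R}]_(m, n)) : 'M[{poly L}]_(m, n) := map_mx toLX (map_mx scale_var M).

Lemma evmx1_kX m n (M : 'M[{poly R}]_(m, n)) : evmx 1 (kX M) = map_mx toL (map_mx ev M).
Proof.
rewrite /kX evmx_toLX; congr map_mx; apply/matrixP => i j.
by rewrite !mxE /horner_eval scale_var1.
Qed.

Lemma evmx0_kX m n (M : 'M[{poly R}]_(m, n)) :
  evmx 0 (kX M) = map_mx toL (map_mx (ev \o polyC) (at0 M)).
Proof.
rewrite /kX evmx_toLX; congr map_mx; apply/matrixP => i j.
by rewrite !mxE /horner_eval scale_var0.
Qed.

Lemma loc_invC (c a w : A) k : a != 0 -> a * w = c ^+ k -> loc toLX c%:P ((toL a)^-1)%:P.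
Proof.
move=> na aw; exists k, w%:P.
rewrite -polyC_exp /= !map_polyC /= -polyCM; congr (_%:P).
by rewrite -aw rmorphM mulrC mulrA mulVf ?rmorph_eq0_inj // mul1r.
Qed.

Lemma kXM m n p (M : 'M_(m, n)) (N : 'M_(n, p)) : kX (M *m N) = kX M *m kX N.
Proof. by rewrite /kX !map_mxM. Qed.

Lemma kXD m n (M N : 'M_(m, n)) : kX (M + N) = kX M + kX N.
Proof. by rewrite /kX !map_mxD. Qed.

Lemma kXZ m n c (M : 'M_(m, n)) : kX (c *: M) = toLX (scale_var c) *: kX M.
Proof. by rewrite /kX !map_mxZ. Qed.

Lemma kX_scalar m c : kX (c%:P%:M : 'M_m) = (toL (ev c%:P))%:P%:M.
Proof. by rewrite /kX !map_scalar_mx /= scale_varC map_polyC. Qed.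

(** At 0 both families are built from [q0] and [f0], hence agree. At 1, the column [x0], that is
    unimodularity modulo [s], turns the element [s ^+ k2 * u2] of the ideal of the corrected
    coordinates into the element [u2] of the ideal of the corrected vector [h']. *)
Theorem core n (E : 'M[A]_n) (s : R) (G : 'M[A]_(n, r)) (H : 'M[A]_(r, n))
    (u : 'rV[A]_n) (b w a0 : A) (x0 : 'cV[A]_n) (d B a : {poly R}) (g : 'rV[{poly R}]_r)
    (f : 'cV[{poly R}]_r) (q0 : 'rV[R]_r) (f0 : 'cV[R]_r) k k0 kd :
  E *m E = E -> s != 0 -> (forall c, 1 + s * c != 0) ->
  factors_through E (ev s%:P) G H -> u *m E = u ->
  u *m x0 = (1 - ev s%:P * a0)%:M ->
  ev d * w = ev (s ^+ kd)%:P ->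
  ev d * b = ev B -> ev d *: (u *m G) = map_mx ev g ->
  (a * B)%:M + g *m f = (s ^+ k)%:P%:M ->
  (at0 g + (s ^+ 2 * B.[0]) *: q0) *m f0 = (s ^+ k0)%:M ->
  equivalent E (row_mx b%:M u) (row_mx 1%:M 0).
Proof.
move=> idE ns nunit EGH uE ux0 dw Eb Eg Hf Hf0.
pose i c := ev c%:P.
have iM c c' : i (c * c') = i c * i c' by rewrite /i polyCM rmorphM.
have iX c l : i (c ^+ l) = i c ^+ l by rewrite /i polyC_exp rmorphXn.
have ni c : c != 0 -> i c != 0 by rewrite /i -(rmorph0 ev) (inj_eq ev_inj) polyC_eq0.
have ntoL x : x != 0 -> toL x != 0 by rewrite rmorph_eq0_inj.
have nsA := ni s ns.
have ndA : ev d != 0.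
  by apply/eqP => d0; have := ni _ (expf_neq0 kd ns); rewrite /i -dw d0 mul0r eqxx.
have ns1 : s * 1 != 0 by rewrite mulr1.
have [q1 [f1 [k1 [c1 E1]]]] := unimodular_correction ns1 Hf Hf0.
pose u1 := 1 + s * 1 * c1; have nu1 : u1 != 0 by rewrite /u1 mulr1.
have [q2 [f2 [k2 [c2 E2]]]] := unimodular_correction (mulf_neq0 ns nu1) Hf Hf0.
pose u2 := 1 + s * u1 * c2; have nu2 : u2 != 0 by rewrite /u2 -mulrA.
(* One factor of [s ^+ 2] is put in [Q q], so that [u] changes only by multiples of [s]; the other
   arises from [H *m G = s]. *)
pose Q q : 'rV[{poly R}]_r := s%:P *: (map_mx polyC q0 + 'X *: q).
pose h q := g + (s%:P * B) *: Q q.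
have hE q : g + ((s ^+ 2)%:P * B) *: (map_mx polyC q0 + 'X *: q) = h q.
  by rewrite /h /Q scalerA; congr (_ + _ *: _); rewrite expr2 polyCM; ring.
rewrite hE -/u1 in E1; rewrite hE -/u2 in E2.
pose sL := toL (i s); pose dL := toL (ev d).
have nsL : sL != 0 by apply: ntoL.
have ndL : dL != 0 by apply: ntoL.
have nsd : sL * dL != 0 by apply: mulf_neq0.
(* At 1, [bL] and [pL] become [b] and the coordinates [u *m G / s] of the module element. *)
pose bL := (dL^-1)%:P * toLX (scale_var B).
pose pL := ((sL * dL)^-1)%:P *: kX g.
have hL q : pL + bL *: kX (Q q) = ((sL * dL)^-1)%:P *: kX (h q).
  rewrite /h kXD kXZ scalerDr; congr (_ + _); rewrite scalerA rmorphM /= scale_varC.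
  rewrite rmorphM /= map_polyC /= mulrA -polyCM /bL -/sL; congr (_%:P * _ *: _).
  by rewrite invfM mulrAC mulVf // mul1r.
pose fL l v (f : 'cV_r) := (sL * dL / toL (i (s ^+ l * v)))%:P *: kX f.
have hfL q l v (f' : 'cV_r) : v != 0 -> h q *m f' = (s ^+ l * v)%:P%:M ->
    (pL + bL *: kX (Q q)) *m fL l v f' = 1%:M.
  move=> nv Ehf; rewrite hL -scalemxAl -scalemxAr -kXM Ehf kX_scalar -/(i _).
  rewrite scalerA scale_scalar_mx -!polyCM mulrA mulVf // mul1r mulVf //.
  by apply/ntoL/ni/mulf_neq0 => //; apply: expf_neq0.
pose z0 := map_mx polyC ((sL * dL / toL (i (s ^+ k0))) *: map_mx toL (map_mx (ev \o polyC) f0)).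
have h0 q : evmx 0 ((pL + bL *: kX (Q q)) *m z0) = 1%:M.
  rewrite hL evmxM evmxZ evmxC evmx0_kX hornerC -scalemxAl -scalemxAr -!map_mxM.
  have -> : at0 (h q) = at0 g + (s ^+ 2 * B.[0]) *: q0.
    apply/matrixP => j1 j2; rewrite !mxE /horner_eval !(hornerD, hornerM, hornerC, hornerX); ring.
  rewrite Hf0 !map_scalar_mx /= -/(i _) scalerA scale_scalar_mx mulrA mulVf // mul1r.
  by rewrite mulVf //; apply/ntoL/ni/expf_neq0.
pose Q2 := map_mx ev (Q q2).
pose h' := u + b *: (Q2 *m H).
have h'G : ev d *: (h' *m G) = map_mx ev (h q2).
  rewrite /h' mulmxDl scalerDr Eg -scalemxAl -mulmxA (proj2 EGH) mul_mx_scalar !scalerA.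
  by rewrite Eb /h map_mxD map_mxZ rmorphM mulrC.
pose a' := a0 - b * (map_mx ev (map_mx polyC q0 + 'X *: q2) *m H *m x0) 0 0.
have h'x : h' *m x0 = (1 - i s * a')%:M.
  rewrite /h' mulmxDl ux0 [X in _ + X]mx11_scalar -raddfD /=; congr (_%:M).
  rewrite /Q2 /Q map_mxZ -!scalemxAl scalerA mxE /a' -/(i s); ring.
have [c Ec] : exists c, 1 - (i s * a') ^+ k2 = (1 - i s * a') * c.
  exists (\sum_(l < k2) (i s * a') ^+ l).
  by rewrite -opprB subrX1 -mulNr opprB.
(* [h'] sends the first term to [u2 * (1 - (s * a') ^+ k2)] and the second to
   [(s * a') ^+ k2 * u2]. *)
pose x2 := (i u2 * c) *: x0 + (a' ^+ k2 * ev d) *: (G *m map_mx ev f2).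
have h'x2 : h' *m x2 = (i u2)%:M.
  rewrite mulmxDr -!scalemxAr h'x scale_scalar_mx -scalerA mulmxA scalemxAl h'G -map_mxM E2.
  rewrite map_scalar_mx scale_scalar_mx -raddfD /= -/(i _) iM iX; congr (_%:M).
  rewrite -mulrA (mulrC c) -Ec exprMn; ring.
(* Linear interpolation between the common value at 0 and the value at 1 required by
   [glue_transvections]. *)
pose z2 := (1 - 'X) *: z0 + 'X *: map_mx polyC ((toL (i u2))^-1 *: map_mx toL (H *m x2)).
have locT (c' x : A) : loc toLX c'%:P (toL x)%:P.
  by have := @loc_map _ _ toLX c'%:P x%:P; rewrite /= map_polyC.
have lsV c' : loc toLX (i s * c')%:P ((toL (i s))^-1)%:P.
  by apply: (loc_invC (w := c') (k := 1)).
have loc_s c' (x : {poly L}) : loc toLX (i s)%:P x -> loc toLX (i s * c')%:P x.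
  move=> [l [p Ep]]; exists l, (c'%:P ^+ l * p).
  by rewrite polyCM exprMn !rmorphM -Ep; ring.
have lsV1 : loc toLX (i s)%:P ((sL)^-1)%:P by apply: (loc_invC (w := 1) (k := 1)); rewrite ?mulr1.
have ldV : loc toLX (i s)%:P ((dL)^-1)%:P by apply: (loc_invC (w := w) (k := kd)); rewrite -?iX.
have lsdV : loc toLX (i s)%:P ((sL * dL)^-1)%:P by rewrite invfM polyCM; apply: locM.
have lkX c' m l (M : 'M_(m, l)) : locmx toLX c' (kX M) by apply: locmx_map.
have luV l v : v != 0 -> loc toLX (i s * i v)%:P ((toL (i (s ^+ l * v)))^-1)%:P.
  move=> nv; apply: (loc_invC (w := i v ^+ l * i s) (k := l.+1)).
    by apply/ni/mulf_neq0 => //; apply: expf_neq0.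
  by rewrite iM iX exprMn !exprS; ring.
have lz0 c' : locmx toLX (i s * c')%:P z0.
  apply: locmx_polyC; apply: locmx_scale; last exact: locmx_map.
  exists k0, (c' ^+ k0 * (i s * ev d)).
  rewrite exprMn iX !rmorphM -/sL -/dL.
  have nk0 : toL (i s ^+ k0) != 0 by apply/ntoL/expf_neq0.
  by field.
have lz2 : locmx toLX (i s * i u2)%:P z2.
  apply: locmxD; apply: locmx_scale.
  - apply: locD; first exact: loc1.
    by apply: locN; exists 0%N, 'X; rewrite expr0 rmorph1 mul1r /= map_polyX.
  - exact: lz0.
  - by exists 0%N, 'X; rewrite expr0 rmorph1 mul1r /= map_polyX.
  - apply: locmx_polyC; apply: locmx_scale; last exact: locmx_map.
    exists 1%N, (i s); rewrite expr1 rmorphM mulfK //; exact/ntoL/ni.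
have lfL l v f' : v != 0 -> locmx toLX (i s * i v)%:P (fL l v f').
  move=> nv; apply: locmx_scale; last exact: lkX.
  by rewrite [(_ / _)%:P]polyCM; apply: locM; [rewrite /sL /dL -rmorphM; apply: locT | apply: luV].
have z00 : evmx 0 z0 = evmx 0 z2.
  rewrite /z2 evmxD !evmxZ !hornerE rmorph0 subr0 scale1r scale0r addr0.
  by [].
have eu2 : i u2 = 1 + i s * i u1 * i c2 by rewrite /u2 -!iM /i polyCD rmorphD rmorph1.
have hbp : (toL (i s))^-1 *: map_mx toL (u *m G) = evmx 1 pL.
  rewrite /pL evmxZ evmx1_kX hornerC -Eg map_mxZ scalerA invfM -mulrA mulVf // mulr1.
  by [].
have hb1 : bL.[1] = toL b.
  rewrite /bL hornerM hornerC -[1 in LHS](rmorph1 toL) horner_map /= scale_var1 -Eb.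
  by rewrite rmorphM mulrA mulVf // mul1r.
apply: (@glue_transvections A L toL n r E toL_inj (i s) G H nsA EGH (i u1) (i u2) (i c2) b u Q2 x2
   bL pL (kX (Q q1)) (kX (Q q2)) (fL k1 u1 f1) (fL k2 u2 f2) z0 z2) => [|||||||||||||||||||||].
- exact: uE.
- exact: ni.
- exact: ni.
- exact: eu2.
- exact: hfL.
- exact: hfL.
- by apply: locM => //; apply: loc_map.
- by apply: locmx_scale => //; apply: lkX.
- exact: lkX.
- exact: lkX.
- exact: lfL.
- exact: lfL.
- exact: lz0.
- exact: lz2.
- rewrite !evmx0_kX; congr map_mx; congr map_mx; apply/matrixP => j1 j2.
  by rewrite !mxE /horner_eval !hornerE.
- exact: z00.
- exact: h0.
- exact: hb1.
- by rewrite hbp.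
- by rewrite evmx1_kX.
- rewrite /z2 evmxD !evmxZ !evmxC !hornerE rmorph1 subrr scale0r scale1r add0r.
  by [].
- exact: h'x2.
Qed.

End Core.

(** * From the module to polynomial coordinates *)

Definition row_ideal (C : comNzRingType) r (h : 'rV[C]_r) (x : C) : Prop :=
  exists f : 'cV[C]_r, h *m f = x%:M.

Lemma row_ideal_is_ideal (C : comNzRingType) r (h : 'rV[C]_r) : is_ideal (row_ideal h).
Proof.
split; first by exists 0; rewrite mulmx0 raddf0.
- by move=> x y [f Ef] [g Eg]; exists (f + g); rewrite mulmxDr Ef Eg raddfD.
- by move=> c x [f Ef]; exists (c *: f); rewrite -scalemxAr Ef scale_scalar_mx.
Qed.

Lemma row_ideal_cat (C : comNzRingType) r b (u : 'rV[C]_r) x :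
  row_ideal (row_mx b%:M u) x <-> exists a f, (a * b)%:M + u *m f = x%:M.
Proof.
split=> [[f]|[a [f E]]].
  rewrite -[f]vsubmxK mul_row_col => E; exists (usubmx f 0 0), (dsubmx f).
  by rewrite -E [usubmx f in RHS]mx11_scalar mul_scalar_mx scale_scalar_mx mulrC.
exists (col_mx a%:M f); rewrite mul_row_col mul_scalar_mx scale_scalar_mx -E.
by rewrite mulrC.
Qed.

Lemma equivalent_row_ideal (A : comNzRingType) n (E : 'M[A]_n) v v' :
  v *m projAP E = v -> equivalent E v v' -> row_ideal v 1 -> row_ideal v' 1.
Proof.
move=> vE [S [S' [_ _ _ _ [SS _ vS]]]] [f vf]; exists (S' *m f).
by rewrite -vS mulmxA -(mulmxA v) SS vE.
Qed.

Lemma row_projAP (A : comNzRingType) n (E : 'M[A]_n) b (u : 'rV_n) : u *m E = u ->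
  row_mx b%:M u *m projAP E = row_mx b%:M u.
Proof. by move=> uE; rewrite mul_row_block !mulmx0 addr0 add0r mulmx1 uE. Qed.

(** Modulo the ideal, [a] is an inverse of [x], so the factor [x ^+ k] can be removed. *)
Lemma row_ideal_saturate (C : comNzRingType) r (h : 'rV[C]_r) x a k v :
  row_ideal h (1 - x * a) -> row_ideal h (x ^+ k * v) -> row_ideal h v.
Proof.
have [J0 JD JM] := row_ideal_is_ideal h => h1 hk.
have -> : v = (\sum_(l < k) (x * a) ^+ l) * v * (1 - x * a) + a ^+ k * (x ^+ k * v).
  have E : 1 - (x * a) ^+ k = (1 - x * a) * \sum_(l < k) (x * a) ^+ l.
    by rewrite -opprB subrX1 -mulNr opprB.
  rewrite mulrAC (mulrC _ (1 - _)) -E exprMn; ring.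
by apply: (JD); apply: (JM).
Qed.

Section Reduction.
Variables (R A : idomainType) (ev : {rmorphism {poly R} -> A}) (e r n : nat).
Hypothesis ev_inj : injective ev.
Hypothesis noeA : noetherian A.
Hypothesis er : (e < r)%N.
Variables (E : 'M[A]_n) (s : R) (G : 'M[A]_(n, r)) (H : 'M[A]_(r, n)).
Hypothesis idE : E *m E = E.
Hypothesis rkE : \rank (map_mx (@FracField.tofrac A) E) = r.
Hypothesis EGH : factors_through E (ev s%:P) G H.
Hypothesis dim_s : dim_over (principal (ev s%:P)) e.

(** A prime containing [s] and [u + b *: w] contains [b] by the stable range, which the
    unimodularity of the row excludes. Appending the column [s] to the row turns unimodularity
    modulo [s] into unimodularity. *)
Lemma unimodular_mod b (u : 'rV[A]_n) : u *m E = u -> row_ideal (row_mx b%:M u) 1 ->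
  exists w a, w *m E = w /\ row_ideal (u + b *: w) (1 - ev s%:P * a).
Proof.
move=> uE /row_ideal_cat [c [f Ef]].
have [w [wE Hw]] := stable_range_proj idE rkE noeA (principal_ideal _) dim_s er b u.
have [||Q Qp QS HQ|x [g [-> Eg]]] := @row_meets A (fun x => x = 1) _
    (row_mx (u + b *: w) (ev s%:P)%:M : 'rV_(n + 1)) noeA.
- by [].
- by move=> x y -> ->; rewrite mulr1.
- have [Qi _ _] := Qp; have [_ QD QM] := Qi.
  have Qs : Q (ev s%:P) by have := HQ (rshift n 0); rewrite row_mxEr mxE eqxx.
  have Qu j : Q ((u + b *: w) 0 j) by have := HQ (lshift 1 j); rewrite row_mxEl.
  have Qb : Q b by apply: (Hw Q) => // y [d ->]; apply: (QM).
  apply: (QS 1) => //.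
  have /matrixP/(_ 0 0) := Ef; rewrite !mxE eqxx !mulr1n => <-.
  apply: (QD); first exact: (QM).
  apply: ideal_sum => // j _; apply: ideal_mulr => //.
  have Qbw : Q (b * w 0 j) by apply: ideal_mulr.
  by apply: (ideal_addKl Qi Qbw); have := Qu j; rewrite !mxE addrC.
exists w, (dsubmx g 0 0); split=> //; exists (usubmx g); rewrite raddfB.
move: Eg; rewrite -{1}[g]vsubmxK mul_row_col {1}[dsubmx g]mx11_scalar mul_scalar_mx.
by rewrite scale_scalar_mx => /(canRL (addrK _)).
Qed.

Variable Den : {poly R} -> Prop.
Hypothesis Den1 : Den 1.
Hypothesis DenM : forall f g, Den f -> Den g -> Den (f * g).
Hypothesis ev_den : forall a, exists f g, Den f /\ ev f * a = ev g.

Lemma row_den b (u : 'rV[A]_n) : exists d B g,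
  [/\ Den d, ev d * b = ev B & ev d *: (u *m G) = map_mx ev g].
Proof.
have [d [N [Dd EN]]] := den_mx Den1 DenM ev_den (row_mx b%:M (u *m G)).
exists d, (N 0 (lshift r 0)), (rsubmx N); split=> //.
  by have /matrixP/(_ 0 (lshift r 0)) := EN; rewrite !mxE (unsplitK (inl _)) mxE eqxx.
by rewrite map_rsubmx -EN scale_row_mx row_mxKr.
Qed.

(** The factors come from the denominator [d] of the row, the denominator [d'] of the coefficients,
    and the [s] of [G *m H = s *: E] when [f] is replaced by [H *m f]. *)
Lemma poly_relation b (u : 'rV[A]_n) d B g : u *m E = u -> row_ideal (row_mx b%:M u) 1 ->
  ev d * b = ev B -> ev d *: (u *m G) = map_mx ev g ->
  exists d', Den d' /\ row_ideal (row_mx B%:M g) (d * d' * s%:P).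
Proof.
move=> uE /row_ideal_cat [c [f Ef]] EB Eg.
have [d' [N [Dd' EN]]] := den_mx Den1 DenM ev_den (col_mx (c * ev s%:P)%:M (H *m f)).
exists d'; split=> //; apply/row_ideal_cat; exists (N (lshift r 0) 0), (dsubmx N).
have Ea : ev (N (lshift r 0) 0) = ev d' * (c * ev s%:P).
  by have /matrixP/(_ (lshift r 0) 0) := EN; rewrite !mxE (unsplitK (inl _)) mxE eqxx => <-.
have Ef' : map_mx ev (dsubmx N) = ev d' *: (H *m f).
  by rewrite map_dsubmx -EN scale_col_mx col_mxKd.
apply: (inj_map_mx ev_inj); rewrite map_mxD map_mxM !map_scalar_mx -Eg Ef' !(rmorphM ev) Ea -EB.
rewrite -scalemxAl -scalemxAr mulmxA -(mulmxA u) (proj1 EGH) -scalemxAr uE -scalemxAl.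
have -> : (ev d' * (c * ev s%:P) * (ev d * b))%:M = (ev d * ev d' * ev s%:P) *: (c * b)%:M :> 'M_1.
  by rewrite scale_scalar_mx; congr (_%:M); ring.
by rewrite !scalerA mulrA -scalerDr Ef scalemx1.
Qed.

End Reduction.

(** * The polynomial and the Laurent cases *)

Section Cases.
Variables (R A : idomainType) (ev : {rmorphism {poly R} -> A}) (e r n : nat).
Hypothesis ev_inj : injective ev.
Hypotheses (noeR : noetherian R) (noeA : noetherian A).
Hypothesis dimR : dim_over (fun x : R => x = 0) e.
Hypothesis er : (e < r)%N.
Variables (E : 'M[A]_n) (s : R) (G : 'M[A]_(n, r)) (H : 'M[A]_(r, n)).
Hypothesis idE : E *m E = E.
Hypothesis rkE : \rank (map_mx (@FracField.tofrac A) E) = r.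
Hypothesis ns : s != 0.
Hypothesis nunit : forall c, 1 + s * c != 0.
Hypothesis EGH : factors_through E (ev s%:P) G H.
Hypothesis dim_s : dim_over (principal (ev s%:P)) e.

Let nevs : ev s%:P != 0. Proof. by rewrite (rmorph_eq0_inj _ ev_inj) polyC_eq0. Qed.
Let HE : H *m E = H := (factors_through_id nevs EGH).1.

(** When powers of [s] suffice as denominators, the relation on [(B, g)] gives a power of [s], and
    so does its value at [X = 0]. The stable range of [R] then supplies [q0]. *)
Lemma polynomial_case b (u : 'rV[A]_n) :
  (forall a, exists N f, ev (s ^+ N)%:P * a = ev f) ->
  u *m E = u -> row_ideal (row_mx b%:M u) 1 ->
  equivalent E (row_mx b%:M u) (row_mx 1%:M 0).
Proof.
move=> ev_den uE uni.
have [w [a0 [wE [x0 Hx0]]]] := unimodular_mod noeA er idE rkE dim_s uE uni.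
have eq1 := equivalent_addr idE b uE wE.
apply: (equivalent_trans eq1) => {eq1}.
have uni1 := equivalent_row_ideal (row_projAP b uE) (equivalent_addr idE b uE wE) uni.
have u1E : (u + b *: w) *m E = u + b *: w by rewrite mulmxDl uE -scalemxAl wE.
move: (u + b *: w) u1E Hx0 uni1 => u1 u1E Hx0 uni1.
pose Den f := exists N, f = (s ^+ N)%:P.
have Den1 : Den 1 by exists 0%N; rewrite expr0.
have DenM f g : Den f -> Den g -> Den (f * g).
  by move=> [N ->] [M ->]; exists (N + M)%N; rewrite exprD polyCM.
have ev_Den a : exists f g, Den f /\ ev f * a = ev g.
  by have [N [f Ef]] := ev_den a; exists (s ^+ N)%:P, f; split=> //; exists N.
have [d [B [g [Dd EB Eg]]]] := row_den G Den1 DenM ev_Den b u1.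
have [d' [Dd' rel]] := poly_relation ev_inj EGH Den1 DenM ev_Den u1E uni1 EB Eg.
have [N EN] := Dd; have [N' EN'] := Dd'.
have [k Ek] : exists k, d * d' * s%:P = (s ^+ k)%:P.
  by exists (N + N').+1; rewrite EN EN' exprSr exprD !polyCM.
rewrite Ek in rel; have /row_ideal_cat [a [f Hf]] := rel.
have [||q0 Hq0] := stable_range_row (X := fun=> True) noeR _ (zero_ideal R) _ er
    (s ^+ 2 * B.[0]) (at0 g).
- by [].
- by move=> m P Pch _ P0; apply: (dimR Pch).
have [|||x [f0 [[k0 ->] Hf0]]] := @row_meets R (fun x => exists k, x = s ^+ k) _
    (at0 g + (s ^+ 2 * B.[0]) *: q0) noeR.
- by exists 0%N.
- by move=> _ _ [k1 ->] [k2 ->]; exists (k1 + k2)%N; rewrite exprD.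
- move=> Q Qp QS HQ; have [Qi _ QM] := Qp; have [_ QD QZ] := Qi.
  have QsB : Q (s ^+ 2 * B.[0]) by apply: (Hq0 Q) => // y ->; case: Qi.
  have QB : Q B.[0] by case: (QM _ _ QsB) => // Qs; case: (QS (s ^+ 2)) => //; exists 2%N.
  have Qg j : Q (g 0 j).[0].
    have Q2 : Q (s ^+ 2 * B.[0] * q0 0 j) by apply: ideal_mulr.
    by apply: (ideal_addKl Qi Q2); have := HQ j; rewrite !mxE addrC.
  apply: (QS (s ^+ k)); first by exists k.
  have /matrixP/(_ 0 0) := Hf; rewrite !mxE eqxx !mulr1n => /(congr1 (horner^~ 0)).
  rewrite hornerD hornerM hornerC horner_sum => <-.
  apply: (QD); first exact: (QZ).
  by apply: ideal_sum => // j _; rewrite hornerM; apply: ideal_mulr.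
apply: (core ev_inj noeR dimR er (@tofrac_inj A) idE ns nunit EGH u1E Hx0 (w := 1) (kd := N) _ EB Eg Hf Hf0).
by rewrite EN mulr1.
Qed.

Variable w : A.
Hypothesis Xw : ev 'X * w = ev s%:P.

Let sA := ev s%:P.

Lemma unimodular_mod_addr (u v : 'rV[A]_n) a b : row_ideal u (1 - sA * a) ->
  exists a', row_ideal (u + b *: (sA *: v)) (1 - sA * a').
Proof.
move=> [x ux]; exists (a - b * (v *m x) 0 0), x.
rewrite mulmxDl ux [X in _ + X]mx11_scalar -raddfD; congr (_%:M).
rewrite -!scalemxAl !mxE; ring.
Qed.

Lemma fixed_addr (u : 'rV[A]_n) (q : 'rV[A]_r) b : u *m E = u ->
  (u + b *: (q *m H)) *m E = u + b *: (q *m H).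
Proof. by move=> uE; rewrite mulmxDl uE -scalemxAl -mulmxA HE. Qed.

Lemma ev_addr (u : 'rV[A]_n) b d B (g q : 'rV[{poly R}]_r) :
  ev d * b = ev B -> ev d *: (u *m G) = map_mx ev g ->
  ev d *: ((u + b *: (map_mx ev (s%:P *: q) *m H)) *m G) = map_mx ev (g + ((s ^+ 2)%:P * B) *: q).
Proof.
move=> EB Eg; rewrite mulmxDl scalerDr Eg map_mxD; congr (_ + _).
rewrite -scalemxAl -mulmxA (proj2 EGH) mul_mx_scalar !map_mxZ !scalerA EB; congr (_ *: _).
by rewrite polyC_exp (rmorphM ev) (rmorphXn ev); ring.
Qed.

(** Since [X * w = s], a power of [X] becomes a power of [s] when multiplied by a power of [w]. The
    correction being a multiple of [s], unimodularity modulo [s] persists and [row_ideal_saturate]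
    removes the power of [s]. *)
Lemma laurent_correction t b (u : 'rV[A]_n) a0 B g N M k m : s * t != 0 ->
  row_ideal u (1 - sA * a0) ->
  ev ((s ^+ N)%:P * 'X^M) * b = ev B ->
  ev ((s ^+ N)%:P * 'X^M) *: (u *m G) = map_mx ev g ->
  row_ideal (row_mx B%:M g) ((s ^+ k)%:P * 'X^m) ->
  exists q c, row_ideal (u + b *: (map_mx ev (s%:P *: q) *m H)) (ev (1 + s * t * c)%:P).
Proof.
move=> nst Hx EB Eg /row_ideal_cat [a [f Hf]].
have [q Hq] := stable_range_poly noeR dimR nst er ((s ^+ 2)%:P * B) g.
pose S x := exists k m c, x = (s ^+ k * (1 + s * t * c))%:P * 'X^m.
have [|||x [f1 [[k1 [m1 [c ->]]] E1]]] := @row_meets _ S _ (g + ((s ^+ 2)%:P * B) *: q)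
   (noetherian_poly noeR).
- by exists 0%N, 0%N, 0; rewrite mulr0 addr0 !mulr1.
- move=> _ _ [k1 [m1 [c1 ->]]] [k2 [m2 [c2 ->]]].
  exists (k1 + k2)%N, (m1 + m2)%N, (c1 + c2 + s * t * c1 * c2).
  rewrite mulrACA -polyCM -(exprD 'X); congr (_%:P * _); rewrite exprD; ring.
- move=> Q Qp QS HQ; case: (Qp) => Qi Q1 QM; case: (Qi) => _ QD QZ.
  have nQs l l' : ~ Q ((s ^+ l)%:P * 'X^l').
    by apply: QS; exists l, l', 0; rewrite mulr0 addr0 mulr1.
  have QB : Q B.
    have : Q ((s ^+ 2)%:P * B).
      apply: (Hq Q Qp) => // c; apply: QS; exists 0%N, 0%N, c.
      by rewrite expr0 mul1r mulr1.
    case/QM => // Qs; case: (nQs 2%N 0%N); by rewrite mulr1.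
  apply: (nQs k m).
  have /matrixP/(_ 0 0) := Hf; rewrite !mxE eqxx !mulr1n => <-.
  apply: (QD); first exact: (QZ).
  apply: ideal_sum => // j _; apply: ideal_mulr => //.
  have Qbq : Q ((s ^+ 2)%:P * B * q 0 j) by apply: ideal_mulr => //; apply: (QZ).
  by apply: (ideal_addKl Qi Qbq); have := HQ j; rewrite !mxE addrC.
exists q, c; set u' := u + _.
have [a' Ha'] : exists a', row_ideal u' (1 - sA * a').
  rewrite /u' map_mxZ -scalemxAl; exact: unimodular_mod_addr Hx.
apply: (row_ideal_saturate (k := k1 + m1) Ha').
exists ((w ^+ m1 * ev ((s ^+ N)%:P * 'X^M)) *: (G *m map_mx ev f1)).
rewrite -scalemxAr -scalerA mulmxA scalemxAl (ev_addr _ EB Eg) -map_mxM E1 map_scalar_mx.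
rewrite scale_scalar_mx; congr (_%:M).
have Em : sA ^+ m1 = ev 'X ^+ m1 * w ^+ m1 by rewrite -exprMn Xw.
rewrite exprD Em !(rmorphM ev) polyCM polyC_exp !(rmorphM ev) !(rmorphXn ev) -/sA.
ring.
Qed.

(** The element [v] of the ideal of [u] is added to [b] with coefficient [w ^+ (M + j)], which over
    the denominator is the constant [s ^+ (N + (M + j)) * v]. For [j > 0] the old numerator gets a
    factor [X], so this is the whole constant term. *)
Lemma laurent_addl j v b (u : 'rV[A]_n) B N M : u *m E = u -> row_ideal u (ev v%:P) ->
  ev ((s ^+ N)%:P * 'X^M) * b = ev B ->
  exists b', equivalent E (row_mx b%:M u) (row_mx b'%:M u) /\
    ev ((s ^+ N)%:P * 'X^(M + j)) * b' = ev ('X^j * B + (s ^+ (N + (M + j)) * v)%:P).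
Proof.
move=> uE [x ux] EB; exists (b + w ^+ (M + j) * ev v%:P); split.
  have := equivalent_addl idE b (w ^+ (M + j) *: x) uE.
  by rewrite -scalemxAr ux scale_scalar_mx -raddfD.
rewrite rmorphD (rmorphM ev 'X^j) -EB mulrDr; congr (_ + _).
  by rewrite exprD !rmorphM; ring.
rewrite (exprD s) !polyCM !rmorphM mulrA; congr (_ * _).
by rewrite -mulrA !rmorphXn -exprMn Xw.
Qed.

(** A relation up to powers of [X] is empty at [X = 0], so the constant terms are prescribed
    instead. In the end, up to powers of [s], they are [u1] for the coordinate [i1] and
    [y = 1 + s * u1 * c3] for [b]; adding a multiple of [b] in a second coordinate [i2] then makes
    the row at 0 generate a power of [s]. *)
Theorem laurent_case b (u : 'rV[A]_n) :
  (forall a, exists N M f, ev ((s ^+ N)%:P * 'X^M) * a = ev f) -> (1 < r)%N ->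
  u *m E = u -> row_ideal (row_mx b%:M u) 1 ->
  equivalent E (row_mx b%:M u) (row_mx 1%:M 0).
Proof.
move=> ev_den r1 uE uni.
have [v [a0 [vE Hx0]]] := unimodular_mod noeA er idE rkE dim_s uE uni.
have eq1 := equivalent_addr idE b uE vE.
apply: (equivalent_trans eq1) => {eq1}.
have uni1 := equivalent_row_ideal (row_projAP b uE) (equivalent_addr idE b uE vE) uni.
have u1E : (u + b *: v) *m E = u + b *: v by rewrite mulmxDl uE -scalemxAl vE.
move: (u + b *: v) u1E Hx0 uni1 => {uE uni vE}u uE Hx0 uni.
pose Den f := exists N M, f = (s ^+ N)%:P * 'X^M.
have Den1 : Den 1 by exists 0%N, 0%N; rewrite expr0 mulr1.
have DenM f g : Den f -> Den g -> Den (f * g).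
  move=> [N [M ->]] [N' [M' ->]]; exists (N + N')%N, (M + M')%N.
  by rewrite !exprD polyCM mulrACA.
have ev_Den a : exists f g, Den f /\ ev f * a = ev g.
  have [N [M [f Ef]]] := ev_den a; exists ((s ^+ N)%:P * 'X^M), f.
  by split=> //; exists N, M.
have rel b' (u' : 'rV[A]_n) N M B g : u' *m E = u' -> row_ideal (row_mx b'%:M u') 1 ->
    ev ((s ^+ N)%:P * 'X^M) * b' = ev B ->
    ev ((s ^+ N)%:P * 'X^M) *: (u' *m G) = map_mx ev g ->
    exists k m, row_ideal (row_mx B%:M g) ((s ^+ k)%:P * 'X^m).
  move=> u'E uni' EB Eg.
  have [d' [[N' [M' ->]] Hd]] := poly_relation ev_inj EGH Den1 DenM ev_Den u'E uni' EB Eg.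
  exists (N + N').+1, (M + M')%N; move: Hd; congr (row_ideal _ _).
  by rewrite exprSr !exprD !polyCM; ring.
have [d [B [g [[N [M ->]] EB Eg]]]] := row_den G Den1 DenM ev_Den b u.
have [k [m Hrel]] := rel _ _ _ _ _ _ uE uni EB Eg.
have ns1 : s * 1 != 0 by rewrite mulr1.
have [q [c1 Hu1]] := laurent_correction ns1 Hx0 EB Eg Hrel.
have [a1 Hx1] : exists a', row_ideal (u + b *: (map_mx ev (s%:P *: q) *m H)) (1 - sA * a').
  by rewrite map_mxZ -scalemxAl; apply: unimodular_mod_addr Hx0.
have qE (q' : 'rV[A]_r) : q' *m H *m E = q' *m H by rewrite -mulmxA HE.
have uE1 := fixed_addr (map_mx ev (s%:P *: q)) b uE.
have eq1 := equivalent_addr idE b uE (qE (map_mx ev (s%:P *: q))).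
apply: (equivalent_trans eq1).
have {}uni := equivalent_row_ideal (row_projAP b uE) eq1 uni.
have {}Eg := ev_addr q EB Eg; move: {q eq1}(u + _) (g + _) uE1 uni Eg Hu1 Hx1.
move=> {Hx0 Hrel uE g}u g uE uni Eg; set u1 := 1 + s * 1 * c1 => Hu1 Hx0.
have nu1 : u1 != 0 by rewrite /u1 mulr1.
have [b1 [eq1 EB1]] := laurent_addl 1 uE Hu1 EB.
apply: (equivalent_trans eq1).
have {}uni := equivalent_row_ideal (row_projAP b uE) eq1 uni.
set B1 := _ + _ in EB1 => {eq1}.
have B10 : B1.[0] = s ^+ (N + (M + 1)) * u1.
  by rewrite /B1 hornerD hornerM hornerXn hornerC expr1 mul0r add0r.
clearbody B1.
pose i1 := Ordinal (ltnW r1); pose i2 := Ordinal r1.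
(* Over the denominator [X ^ (M + 2)] the old coordinates are multiplied by [X ^ 2] and vanish at 0,
   while [w] cancels the [X] in the numerator of [b1]: the constant term is that of [s ^+ 3 * B1],
   in the coordinate [i1] alone. *)
pose q2 : 'rV[A]_r := sA *: (w *: delta_mx 0 i1).
have eq2 := equivalent_addr idE b1 uE (qE q2).
apply: (equivalent_trans eq2).
have {}uni := equivalent_row_ideal (row_projAP b1 uE) eq2 uni.
have [a2 Hx2] : exists a', row_ideal (u + b1 *: (q2 *m H)) (1 - sA * a').
  by rewrite -scalemxAl; apply: unimodular_mod_addr Hx0.
have uE2 := fixed_addr q2 b1 uE.
pose g2 := 'X^2 *: g + ((s ^+ 3)%:P * B1) *: map_mx polyC (delta_mx 0 i1).
have Eg2 : ev ((s ^+ N)%:P * 'X^(M + 2)) *: ((u + b1 *: (q2 *m H)) *m G) = map_mx ev g2.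
  rewrite mulmxDl scalerDr /g2 map_mxD !map_mxZ -Eg; congr (_ + _).
    by rewrite scalerA; congr (_ *: _); rewrite exprD !rmorphM; ring.
  rewrite -scalemxAl -mulmxA (proj2 EGH) mul_mx_scalar /q2 !scalerA.
  rewrite (rmorphM ev (s ^+ 3)%:P) -EB1 -map_mx_comp map_delta_mx; congr (_ *: _).
  have -> : ev (s ^+ 3)%:P = sA ^+ 2 * (ev 'X * w).
    by rewrite Xw -exprSr polyC_exp (rmorphXn ev).
  have -> : ev ((s ^+ N)%:P * 'X^(M + 2)) = ev 'X * ev ((s ^+ N)%:P * 'X^(M + 1)).
    by rewrite addn2 addn1 exprS !(rmorphM ev); ring.
  ring.
have EB2 : ev ((s ^+ N)%:P * 'X^(M + 2)) * b1 = ev ('X * B1).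
  by rewrite (rmorphM ev 'X B1) -EB1 addn2 addn1 exprS !(rmorphM ev); ring.
have [k2 [m2 Hrel2]] := rel _ _ _ _ _ _ uE2 uni EB2 Eg2.
have [q3 [c3 Hu3]] := laurent_correction (mulf_neq0 ns nu1) Hx2 EB2 Eg2 Hrel2.
move: eq2 Hx2 uE2 uni Eg2 Hu3; move: (u + b1 *: (q2 *m H)) => u2 _ Hx2 uE2 uni Eg2.
set y := 1 + s * u1 * c3 => Hu3.
have eq3 := equivalent_addr idE b1 uE2 (qE (map_mx ev (s%:P *: q3))).
apply: (equivalent_trans eq3).
have {}uni := equivalent_row_ideal (row_projAP b1 uE2) eq3 uni.
have uE3 := fixed_addr (map_mx ev (s%:P *: q3)) b1 uE2.
have Eg3 := ev_addr q3 EB2 Eg2.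
move: eq3 uE3 uni Eg3 Hu3; move: (u2 + b1 *: _) => u3 _ uE3 uni Eg3 Hu3.
set g3 := g2 + _ in Eg3.
have [b3 [eq4 EB3]] := laurent_addl 0 uE3 Hu3 EB2.
apply: (equivalent_trans eq4).
have {}uni := equivalent_row_ideal (row_projAP b1 uE3) eq4 uni.
rewrite expr0 mul1r addn0 in EB3; set B3 := _ + _ in EB3.
have B30 : B3.[0] = s ^+ (N + (M + 2)) * y.
  by rewrite /B3 hornerD hornerM hornerX hornerC mul0r add0r.
clearbody B3.
have [k3 [m3 Hrel3]] := rel _ _ _ _ _ _ uE3 uni EB3 Eg3.
have g30 : at0 g3 = (s ^+ (N + (M + 4)) * u1) *: delta_mx 0 i1.
  apply/matrixP => l j; rewrite !mxE /horner_eval.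
  rewrite !(hornerD, hornerM, hornerX, hornerXn, hornerC) B10.
  rewrite (_ : s ^+ (N + (M + 4)) = s ^+ 3 * s ^+ (N + (M + 1))); last first.
    by rewrite -exprD; congr (_ ^+ _); lia.
  ring.
pose K := (N + (M + 4))%N.
have Euy : y - s * u1 * c3 = 1 by rewrite /y; ring.
have delta_mul (l l' : 'I_r) : (delta_mx 0 l : 'rV[R]_r) *m delta_mx l' 0 = (l == l')%:R%:M.
  rewrite mul_delta_mx_cond; case: eqP => _; last by rewrite mulr0n raddf0.
  by apply/matrixP => l1 l2; rewrite !ord1 !mxE.
have i12 : (i1 == i2) = false by [].
have Hf0 : (at0 g3 + (s ^+ 2 * B3.[0]) *: delta_mx 0 i2) *m
    (delta_mx i2 0 - (s * c3) *: delta_mx i1 0) = (s ^+ K)%:M.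
  have i21 : (i2 == i1) = false by [].
  rewrite g30 B30 mulmxBr !mulmxDl -!scalemxAr -!scalemxAl !delta_mul !eqxx i12 i21.
  apply/matrixP => l1 l2; rewrite !ord1 !mxE eqxx /K.
  rewrite (_ : s ^+ (N + (M + 4)) = s ^+ 2 * s ^+ (N + (M + 2))); last first.
    by rewrite -exprD; congr (_ ^+ _); lia.
  by rewrite !mulr1n !mulr0n -[RHS]mulr1 -[in RHS]Euy; ring.
(* [Hrel3] gives only a power of [s] times [X ^ m3]. But the ideal contains an element [p] with
   constant term [s ^+ K]; modulo [p], [s ^+ K] is a multiple of [X], and its power [m3] a multiple
   of [X ^ m3]. *)
have [a [f Hf]] : exists a f, (a * B3)%:M + g3 *m f = ((s ^+ (K * m3 + k3))%:P)%:M.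
  apply/row_ideal_cat; have [_ JD JM] := row_ideal_is_ideal (row_mx B3%:M g3).
  have JB : row_ideal (row_mx B3%:M g3) ((s ^+ 2)%:P * B3 - (s * c3)%:P * g3 0 i1).
    apply/row_ideal_cat; exists (s ^+ 2)%:P, (- (s * c3)%:P *: delta_mx i1 0).
    rewrite -scalemxAr -colE [col _ _]mx11_scalar mxE scale_scalar_mx -raddfD.
    by rewrite mulNr.
  set p := _ - _ in JB.
  have p0 : p.[0] = s ^+ K.
    have g30i : (g3 0 i1).[0] = s ^+ K * u1.
      have -> : (g3 0 i1).[0] = at0 g3 0 i1 by rewrite [RHS]mxE.
      by rewrite g30 !mxE !eqxx mulr1.
    rewrite /p !(hornerD, hornerN, hornerM, hornerC) g30i B30.
    rewrite -[RHS]mulr1 -[in RHS]Euy.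
    rewrite (_ : s ^+ K = s ^+ 2 * s ^+ (N + (M + 2))); last first.
      by rewrite -exprD; congr (_ ^+ _); rewrite /K; lia.
    ring.
  clearbody p.
  have [h Eh] : exists h, p - (s ^+ K)%:P = h * 'X.
    have /factor_theorem [h Eh] : root (p - (s ^+ K)%:P) 0.
      by rewrite /root !hornerE p0 subrr.
    by exists h; rewrite Eh polyC0 subr0.
  pose S := (s ^+ K)%:P; have ES : S = p - h * 'X by rewrite -Eh /S opprB addrC subrK.
  have [c Ec] : exists c, S ^+ m3 - (- (h * 'X)) ^+ m3 = p * c.
    by rewrite subrXX; eexists; rewrite ES opprK subrK.
  have -> : (s ^+ (K * m3 + k3))%:P = (c * (s ^+ k3)%:P) * p + (- h) ^+ m3 * ((s ^+ k3)%:P * 'X^m3).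
    rewrite exprD polyCM exprM polyC_exp -/S -[S ^+ m3](subrK ((- (h * 'X)) ^+ m3)) Ec.
    by rewrite -mulNr exprMn; ring.
  by apply: (JD); apply: (JM).
have Hx3 : exists x3 a3, u3 *m x3 = (1 - ev s%:P * a3)%:M.
  have [x3 E3] := Hu3; exists x3, (- ev (u1 * c3)%:P); rewrite E3; congr (_%:M).
  by rewrite /y !(polyCD, polyCM) !(rmorphD, rmorphM) /= rmorph1; ring.
have [x3 [a3 E3]] := Hx3.
apply: (core ev_inj noeR dimR er (@tofrac_inj A) idE ns nunit EGH uE3 E3
  (w := w ^+ (M + 2)) (kd := N + (M + 2)) _ EB3 Eg3 Hf Hf0).
rewrite (exprD s) polyCM !(rmorphM ev) -mulrA; congr (_ * _).
by rewrite (rmorphXn ev (M + 2)) -exprMn Xw polyC_exp (rmorphXn ev).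
Qed.

End Cases.

(** * Modules and idempotent matrices *)

Section FreeCoordinates.
Variables (A : idomainType) (P : lmodType A) (n : nat).
Variables (f : {linear P -> 'rV[A]_n}) (g : {linear 'rV[A]_n -> P}).
Hypothesis fgK : cancel f g.
Let E := lin1_mx (f \o g).

Lemma idem_matrix : E *m E = E.
Proof.
apply/row_matrixP => i; rewrite row_mul [row i E]rowE !mul_rV_lin1 /=.
by rewrite fgK.
Qed.

Lemma coordinates_fixed p : f p *m E = f p.
Proof. by rewrite mul_rV_lin1 /= fgK. Qed.

Lemma unimodular_row_ideal b p : unimodular (b : A^o, p) -> row_ideal (row_mx b%:M (f p)) 1.
Proof.
move=> /(_ 1) [phi phi1]; apply/row_ideal_cat.
exists (phi (1, 0)), (\col_j phi (0, g (delta_mx 0 j))).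
have pairD (x y : P) : ((0 : A^o), x + y) = ((0 : A^o), x) + (0, y).
  by congr pair; rewrite addr0.
have pairZ a (x : A^o) (y : P) : (a * x, a *: y) = a *: (x, y) by [].
have E0 : (b : A^o, p) = b *: ((1 : A^o), (0 : P)) + \sum_j f p 0 j *: ((0 : A^o), g (delta_mx 0 j)).
  have -> : \sum_j f p 0 j *: ((0 : A^o), g (delta_mx 0 j)) = (0, p).
    rewrite -[in RHS](fgK p) [in RHS](row_sum_delta (f p)) linear_sum.
    rewrite (big_morph (fun x => ((0 : A^o), x)) pairD (erefl _)).
    by apply: eq_bigr => j _; rewrite linearZ -pairZ mulr0.
  by rewrite -pairZ mulr1 scaler0; congr pair; rewrite ?addr0 ?add0r.
move: phi1; rewrite E0 linearD linearZ linear_sum /= => phi1.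
apply/matrixP => i j; rewrite !ord1 !mxE eqxx !mulr1n -[RHS]phi1; congr (_ + _).
  by rewrite mulrC.
by apply: eq_bigr => k _; rewrite linearZ !mxE.
Qed.

(** The rows [row x] are those fixed by [projAP E]; [S] and [S'] preserve them, hence act on [A + P]
    and are inverse to each other there. *)
Lemma equivalent_automorphism b p :
  equivalent E (row_mx b%:M (f p)) (row_mx 1%:M 0) ->
  exists s : {linear (A^o * P)%type -> (A^o * P)%type},
    is_automorphism s /\ s (b : A^o, p) = (1 : A^o, 0).
Proof.
move=> [S [S' [_ Se _ S'e [SS' S'S vS]]]].
pose row (x : (A^o * P)%type) : 'rV[A]_(1 + n) := row_mx (x.1)%:M (f x.2).
pose act (T : 'M[A]_(1 + n)) (x : (A^o * P)%type) : (A^o * P)%type :=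
  ((lsubmx (row x *m T)) 0 0, g (rsubmx (row x *m T))).
have rowe x : row x *m projAP E = row x by apply: row_projAP; apply: coordinates_fixed.
have row_act T x : T *m projAP E = T -> row (act T x) = row x *m T.
  move=> Te; rewrite /row /act /=.
  have Er : row x *m T = row x *m T *m projAP E by rewrite -mulmxA Te.
  have -> : f (g (rsubmx (row x *m T))) = rsubmx (row x *m T).
    rewrite [in RHS]Er -[in RHS](hsubmxK (row x *m T)) mul_row_block !mulmx0 add0r row_mxKr.
    by rewrite mul_rV_lin1.
  by rewrite -mx11_scalar hsubmxK.
have row_inj x y : row x = row y -> x = y.
  case: x y => [x p1] [y p2] /eq_row_mx [/matrixP/(_ 0 0)].
  by rewrite !mxE eqxx !mulr1n /= => -> /(can_inj fgK) /= ->.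
have act_linear T : linear (act T).
  move=> a x y; rewrite /act.
  have -> : row (a *: x + y) = a *: row x + row y.
    rewrite /row /= linearP scale_row_mx add_row_mx; congr row_mx.
    by apply/matrixP => i j; rewrite !ord1 !mxE eqxx.
  rewrite mulmxDl -scalemxAl !linearP /=; congr pair.
  by rewrite !mxE.
pose sM := GRing.isLinear.Build A (A^o * P)%type (A^o * P)%type *:%R (act S) (act_linear S).
pose s : {linear (A^o * P)%type -> (A^o * P)%type} := HB.pack (act S) sM.
exists s; split.
  exists (act S') => x; apply: row_inj; rewrite /= !row_act // -mulmxA.
    by rewrite SS' rowe.
  by rewrite S'S rowe.
rewrite /= /act [row _ *m S]vS row_mxKl row_mxKr linear0; congr pair.
by rewrite mxE.
Qed.

End FreeCoordinates.

Definition matrix_cancellation (A : idomainType) (d : nat) := forall n r (E : 'M[A]_n),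
  E *m E = E -> \rank (map_mx (@FracField.tofrac A) E) = r -> (d < r)%N ->
  forall b (u : 'rV[A]_n), u *m E = u -> row_ideal (row_mx b%:M u) 1 ->
  equivalent E (row_mx b%:M u) (row_mx 1%:M 0).

Lemma matrix_cancellation_modules (A : idomainType) d : matrix_cancellation A d ->
  forall (P : lmodType A) (r : nat), fg_projective_of_rank P r -> (d < r)%N ->
  forall (b : A) (p : P), unimodular (b : A^o, p) ->
  exists s : {linear (A^o * P)%type -> (A^o * P)%type},
    is_automorphism s /\ s (b : A^o, p) = (1 : A^o, 0).
Proof.
move=> canA P r [n [f [g [fgK rk]]]] dr b p uni.
apply: (equivalent_automorphism fgK); apply: (canA n r _ _ rk dr).
- exact: idem_matrix.
- exact: coordinates_fixed.
- exact: unimodular_row_ideal.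
Qed.

Lemma lift_morphism (B A F : nzRingType) (psi : {rmorphism A -> F}) (g : {rmorphism B -> F}) :
  injective psi -> (forall b, exists a, psi a = g b) ->
  exists h : {rmorphism B -> A}, forall b, psi (h b) = g b.
Proof.
move=> psi_inj ex.
pose h b := sval (constructive_indefinite_description _ (ex b)).
have hE b : psi (h b) = g b by rewrite /h; case: constructive_indefinite_description.
have hB : zmod_morphism h by move=> x y; apply: psi_inj; rewrite rmorphB !hE rmorphB.
have hM : monoid_morphism h.
  split; first by apply: psi_inj; rewrite hE !rmorph1.
  by move=> x y; apply: psi_inj; rewrite rmorphM !hE rmorphM.
pose mB := GRing.isZmodMorphism.Build B A h hB.
pose mM := GRing.isMonoidMorphism.Build B A h hM.
pose hh : {rmorphism B -> A} := HB.pack h mB mM.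
by exists hh.
Qed.

(** * The case where R is a field *)

Section FieldCase.
Variables (R A : idomainType) (ev : {rmorphism {poly R} -> A}) (Den : {poly R} -> Prop).
Hypothesis ev_inj : injective ev.
Hypothesis Den1 : Den 1.
Hypothesis DenM : forall f g, Den f -> Den g -> Den (f * g).
Hypothesis Den_neq0 : forall f, Den f -> f != 0.
Hypothesis ev_den : forall a, exists f g, Den f /\ ev f * a = ev g.
Hypothesis fieldR : forall c : R, c != 0 -> exists c', c * c' = 1.
Local Notation toK := (@FracField.tofrac R).
Local Notation toKX := (map_poly toK).

(** As nonzero constants are units, the column reduction over [K[X]] gives an invertible matrix over
    [A]. It brings the row to [(g, 0, ..., 0)], where [g] is a unit by unimodularity, and a diagonal
    matrix finishes. *)
Lemma unimodular_completion m (v : 'rV[A]_m.+1) : row_ideal v 1 ->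
  exists M M' : 'M[A]_m.+1, M *m M' = 1%:M /\ v *m M = delta_mx 0 0.
Proof.
move=> [x vx]; have [d [N [Dd EN]]] := den_mx Den1 DenM ev_den v.
have [U [uU HU]] := col_reduce (map_mx toKX N)^T.
have [c1 [nc1 [U1 E1]]] := clear_mx U.
have [c2 [nc2 [U2 E2]]] := clear_mx (invmx U).
have inj_toKX : injective toKX.
  by apply: map_inj_poly; [exact: tofrac_inj | exact: rmorph0].
have toKc : (toK c2)%:P * (toK c1)%:P = toKX (c2 * c1)%:P.
  by rewrite map_polyC /= -polyCM -tofracM.
have U21 : U2 *m U1 = (c2 * c1)%:P%:M.
  apply: (inj_map_mx inj_toKX); rewrite map_mxM map_scalar_mx.
  rewrite [map_mx _ U1]E1 [map_mx _ U2]E2 -scalemxAl -scalemxAr mulVmx //.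
  by rewrite scalerA toKc scalemx1.
have HU1 i : i != 0 -> (U1 *m N^T) i 0 = 0.
  move=> ni; apply: inj_toKX; rewrite rmorph0.
  have -> : toKX ((U1 *m N^T) i 0) = (map_mx toKX (U1 *m N^T)) i 0 by rewrite [RHS]mxE.
  by rewrite map_mxM E1 -map_trmx -scalemxAl mxE HU // mulr0.
have [c' cc'] := fieldR (mulf_neq0 nc2 nc1).
pose W := (map_mx ev U1)^T; pose W' := ev c'%:P *: (map_mx ev U2)^T.
have ecc' : ev c'%:P * ev (c2 * c1)%:P = 1 by rewrite -rmorphM -polyCM mulrC cc' rmorph1.
have WW' : W *m W' = 1%:M.
  rewrite -scalemxAr -trmx_mul -map_mxM U21 map_scalar_mx tr_scalar_mx scale_scalar_mx.
  by rewrite ecc'.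
pose g := (v *m W) 0 0.
have vW : v *m W = g *: delta_mx 0 0.
  apply/matrixP => i j; rewrite ord1 [RHS]mxE [delta_mx _ _ _ _]mxE eqxx /=.
  have [->|nj] := eqVneq j 0; first by rewrite mulr1.
  rewrite mulr0; have nd : ev d != 0 by rewrite (rmorph_eq0_inj _ ev_inj) Den_neq0.
  apply: (mulfI nd); rewrite mulr0.
  have -> : ev d * (v *m W) 0 j = (ev d *: v *m W) 0 j by rewrite -scalemxAl [RHS]mxE.
  rewrite EN; have -> : map_mx ev N *m W = (map_mx ev (U1 *m N^T))^T.
    by rewrite map_mxM trmx_mul map_trmx trmxK.
  by rewrite [LHS]mxE [LHS]mxE HU1 // rmorph0.
pose y := (W' *m x) 0 0.
have gy : g * y = 1.
  have := vx; rewrite -[v]mulmx1 -WW' mulmxA vW -!scalemxAl -mulmxA => /matrixP/(_ 0 0).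
  by rewrite -rowE [X in X = _ -> _]mxE [X in _ * X = _ -> _]mxE [X in _ = X -> _]mxE eqxx.
pose D z : 'M[A]_m.+1 := 1%:M + (z - 1) *: delta_mx 0 0.
have DD : D y *m D g = 1%:M.
  rewrite /D mulmxDl mul1mx mulmxDr mulmx1 -scalemxAl -scalemxAr mul_delta_mx scalerA.
  transitivity (1%:M + (g * y - 1) *: (delta_mx 0 0 : 'M[A]_m.+1)).
    by rewrite -!addrA -!scalerDl; congr (_ + _ *: _); ring.
  by rewrite gy subrr scale0r addr0.
exists (W *m D y), (D g *m W'); split.
  by rewrite mulmxA -(mulmxA W) DD mulmx1.
rewrite mulmxA vW -scalemxAl /D mulmxDr mulmx1 -scalemxAr mul_delta_mx -{1}[delta_mx _ _]scale1r.
by rewrite -scalerDl scalerA addrC subrK gy scale1r.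
Qed.

Lemma field_case d : matrix_cancellation A d.
Proof.
move=> n r E idE rkE _ b u uE uni.
have [c [G [H [nc [GH HG]]]]] := generic_factor ev_inj Den1 DenM Den_neq0 ev_den idE rkE.
have [c' cc'] := fieldR nc.
have ecc' : ev c'%:P * ev c%:P = 1 by rewrite -rmorphM -polyCM mulrC cc' rmorph1.
pose D1 : 'M[A]_(1 + n, 1 + r) := block_mx 1%:M 0 0 (ev c'%:P *: G).
pose D2 : 'M[A]_(1 + r, 1 + n) := block_mx 1%:M 0 0 H.
have D21 : D2 *m D1 = 1%:M.
  rewrite mulmx_block ?(mulmx0, mul0mx, addr0, add0r, mul1mx) -scalemxAr HG.
  by rewrite scale_scalar_mx ecc' -scalar_mx_block.
have D12 : D1 *m D2 = projAP E.
  rewrite mulmx_block ?(mulmx0, mul0mx, addr0, add0r, mul1mx) -scalemxAl GH.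
  by rewrite scalerA ecc' scale1r.
have ve := row_projAP b uE.
have [x vx] := uni.
have [|M [M' [MM' vM]]] := @unimodular_completion r (row_mx b%:M u *m D1).
  by exists (D2 *m x); rewrite mulmxA -(mulmxA _ D1) D12 ve.
have M'M := mulmx1C MM'.
have DD (X Y : 'M[A]_(1 + r)) : D1 *m X *m D2 *m (D1 *m Y *m D2) = D1 *m (X *m Y) *m D2.
  by rewrite !mulmxA -(mulmxA _ D2) D21 mulmx1.
have pD1 : projAP E *m D1 = D1 by rewrite -D12 -mulmxA D21 mulmx1.
have D2p : D2 *m projAP E = D2 by rewrite -D12 mulmxA D21 mul1mx.
exists (D1 *m M *m D2), (D1 *m M' *m D2); split.
- by rewrite !mulmxA pD1.
- by rewrite -!mulmxA D2p.
- by rewrite !mulmxA pD1.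
- by rewrite -!mulmxA D2p.
split.
- by rewrite DD MM' mulmx1 D12.
- by rewrite DD M'M mulmx1 D12.
rewrite !mulmxA vM.
have E1 : (row_mx 1%:M 0 : 'rV[A]_(1 + r)) *m D2 = row_mx 1%:M 0.
  by rewrite mul_row_block !mulmx0 mul0mx !mulmx1 addr0 add0r.
rewrite -[RHS]E1; congr (_ *m _); apply/matrixP => i j; rewrite ord1 [LHS]mxE [RHS]mxE.
have -> : (j == 0) = (nat_of_ord j == 0)%N by [].
by case: splitP => k ->; rewrite mxE // ord1.
Qed.

End FieldCase.

(** * Choice of s and cancellation for an algebra containing R[X] *)

Section MatrixCancellation.
Variables (R A : idomainType) (d : nat).
Hypotheses (noeR : noetherian R) (dimR : krull_dim R d) (noeA : noetherian A).

Lemma krull_dim_over (J : R -> Prop) : dim_over J d.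
Proof. by move: dimR => [_ dR] m P Pch _; apply: dR Pch. Qed.

(** The stable range makes [p] itself unimodular, without any patching. This serves for [I = 0],
    where the Rees algebra is [R]. *)
Lemma cancellation_small_dim : dim_over (fun x : A => x = 0) d -> matrix_cancellation A d.
Proof.
move=> dimA n r E idE rkE dr b u uE /row_ideal_cat [c [f Ef]].
have [w [wE Hw]] := stable_range_proj idE rkE noeA (zero_ideal A) dimA dr b u.
apply: (equivalent_trans (equivalent_addr idE b uE wE)).
have [||Q Qp QS HQ|x [g [-> Eg]]] := @row_meets A (fun x => x = 1) _ (u + b *: w) noeA.
- by [].
- by move=> x y -> ->; rewrite mulr1.
- have [Qi _ _] := Qp; have [_ QD QM] := Qi.
  have Qb : Q b by apply: (Hw Q) => // y ->; case: Qi.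
  apply: (QS 1) => //.
  have /matrixP/(_ 0 0) := Ef; rewrite !mxE eqxx !mulr1n => <-.
  apply: (QD); first exact: (QM).
  apply: ideal_sum => // j _; apply: ideal_mulr => //.
  have Qbw : Q (b * w 0 j) by apply: ideal_mulr.
  by apply: (ideal_addKl Qi Qbw); have := HQ j; rewrite !mxE addrC.
apply: equivalent_unimodular Eg => //.
by rewrite mulmxDl uE -scalemxAl wE.
Qed.

Variables (ev : {rmorphism {poly R} -> A}) (s0 : R).
Hypothesis ev_inj : injective ev.
Hypothesis dimA : dim_over (fun x : A => x = 0) d.+1.
Hypothesis ns0 : s0 != 0.

Lemma nonunit_or_field : (exists v : R, v != 0 /\ forall c, v * c != 1) \/
  forall c : R, c != 0 -> exists c', c * c' = 1.
Proof.
case: (classic (exists v : R, v != 0 /\ forall c, v * c != 1)) => [|no]; [by left|right].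
move=> c nc; apply: NNPP => nc'; apply: no; exists c; split=> // c'.
by apply/eqP => cc'; apply: nc'; exists c'.
Qed.

(** In [s = s0 * (c * v)], [s0] serves for the denominators of [A], [c] for the factorization of
    [E], and the nonunit [v] keeps [1 + s * x] nonzero. *)
Lemma denominator_multiple (v : R) n r (E : 'M[A]_n) (Den : {poly R} -> Prop) :
  v != 0 -> (forall c, v * c != 1) ->
  Den 1 -> (forall f g, Den f -> Den g -> Den (f * g)) -> (forall f, Den f -> f != 0) ->
  (forall a, exists f g, Den f /\ ev f * a = ev g) ->
  E *m E = E -> \rank (map_mx (@FracField.tofrac A) E) = r ->
  exists t (G : 'M[A]_(n, r)) H, [/\ s0 * t != 0, forall c, 1 + s0 * t * c != 0,
    factors_through E (ev (s0 * t)%:P) G H & dim_over (principal (ev (s0 * t)%:P)) d].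
Proof.
move=> nv vu D1 DM Dn evD idE rkE.
have [c [G [H [nc [GH HG]]]]] := generic_factor ev_inj D1 DM Dn evD idE rkE.
have ns : s0 * (c * v) != 0 by rewrite !mulf_neq0.
exists (c * v), (ev (s0 * v)%:P *: G), H; split=> //.
- move=> x; apply/eqP => E1; move: (vu (- (s0 * c * x))) => /eqP; apply.
  by rewrite -[RHS]subr0 -E1; ring.
- have Ec : ev (s0 * (c * v))%:P = ev (s0 * v)%:P * ev c%:P.
    by rewrite -rmorphM -polyCM; congr (ev _%:P); ring.
  by split; [rewrite -scalemxAl GH scalerA Ec | rewrite -scalemxAr HG scale_scalar_mx Ec].
- by apply: dim_over_nonzero => //; rewrite (rmorph_eq0_inj _ ev_inj) polyC_eq0.
Qed.

Theorem cancellation_polynomial : (forall a, exists N f, ev (s0 ^+ N)%:P * a = ev f) ->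
  matrix_cancellation A d.
Proof.
move=> evd; pose Den f := exists N, f = (s0 ^+ N)%:P.
have D1 : Den 1 by exists 0%N; rewrite expr0.
have DM f g : Den f -> Den g -> Den (f * g).
  by move=> [N ->] [M ->]; exists (N + M)%N; rewrite exprD polyCM.
have Dn f : Den f -> f != 0 by move=> [N ->]; rewrite polyC_eq0 expf_neq0.
have evD a : exists f g, Den f /\ ev f * a = ev g.
  by have [N [f Ef]] := evd a; exists (s0 ^+ N)%:P, f; split=> //; exists N.
case: nonunit_or_field => [[v [nv vu]]|fR]; last exact: field_case D1 DM Dn evD fR _.
move=> n r E idE rkE dr b u uE uni.
have [t [G [H [ns nu EGH dims]]]] := denominator_multiple nv vu D1 DM Dn evD idE rkE.
apply: (polynomial_case ev_inj noeR noeA (@krull_dim_over _) dr idE rkE ns nu EGH dims) => // a.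
have [N [f Ef]] := evd a; exists N, ((t ^+ N)%:P * f).
by rewrite rmorphM -Ef exprMn polyCM rmorphM; ring.
Qed.

Theorem cancellation_laurent (w : A) :
  (forall a, exists N M f, ev ((s0 ^+ N)%:P * 'X^M) * a = ev f) -> ev 'X * w = ev s0%:P ->
  matrix_cancellation A d.
Proof.
move=> evd Xw; pose Den f := exists N M, f = (s0 ^+ N)%:P * 'X^M.
have D1 : Den 1 by exists 0%N, 0%N; rewrite expr0 mulr1.
have DM f g : Den f -> Den g -> Den (f * g).
  move=> [N [M ->]] [N' [M' ->]]; exists (N + N')%N, (M + M')%N.
  by rewrite !exprD polyCM mulrACA.
have Dn f : Den f -> f != 0.
  move=> [N [M ->]]; rewrite mulf_neq0 ?polyC_eq0 ?expf_neq0 //.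
  by rewrite polyX_eq0.
have evD a : exists f g, Den f /\ ev f * a = ev g.
  have [N [M [f Ef]]] := evd a; exists ((s0 ^+ N)%:P * 'X^M), f; split=> //.
  by exists N, M.
case: nonunit_or_field => [[v [nv vu]]|fR]; last exact: field_case D1 DM Dn evD fR _.
move=> n r E idE rkE dr b u uE uni.
have [t [G [H [ns nu EGH dims]]]] := denominator_multiple nv vu D1 DM Dn evD idE rkE.
(* The nonzero nonunit [v] lies in a nonzero prime; so the rank exceeds 1, which [laurent_case]
   requires. *)
have d1 : (0 < d)%N.
  have [|Q [Qp vQ]] := prime_over noeR (principal_ideal v).
    by move=> [c /esym/eqP]; rewrite mulrC (negbTE (vu c)).
  case: dimR => _ /(_ 1%N (chain_cons (fun x => x = 0) (fun=> Q))); apply.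
  apply: prime_chain_cons; [exact: prime_chain_const|exact: zero_prime| |].
    by move=> x ->; case: Qp => -[].
  by exists v; split; [apply: vQ; apply: principal_gen | apply/eqP].
apply: (laurent_case ev_inj noeR noeA (@krull_dim_over _) dr idE rkE ns nu EGH dims
  (w := w * ev t%:P)) => //.
- by rewrite mulrA Xw -rmorphM -polyCM.
- move=> a; have [N [M [f Ef]]] := evd a; exists N, M, ((t ^+ N)%:P * f).
  by rewrite (rmorphM ev _ f) -Ef exprMn polyCM !rmorphM; ring.
- exact: leq_ltn_trans d1 dr.
Qed.

End MatrixCancellation.

(** * Generators and denominators of Rees algebras *)

Lemma ideal_generators (C : comNzRingType) (I : C -> Prop) : noetherian C -> is_ideal I ->
  exists xs : seq C, (forall y, y \in xs -> I y) /\
    forall J, is_ideal J -> (forall y, y \in xs -> J y) -> forall x, I x -> J x.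
Proof.
move=> noeC Ii.
pose Gen (xs : seq C) x := forall J, is_ideal J -> (forall y, y \in xs -> J y) -> J x.
have Gi xs : is_ideal (Gen xs).
  split=> [J [J0 _ _]|x y Gx Gy J Ji Jxs|r x Gx J Ji Jxs] //.
    by case: (Ji) => _ JD _; apply: JD; [apply: Gx | apply: Gy].
  by case: (Ji) => _ _ JM; apply: JM; apply: Gx.
pose Phi J := exists2 xs, (forall y, y \in xs -> I y) & forall x, J x <-> Gen xs x.
have [|J [Ji [xs Ixs JG] _ Jmax]] := @noeth_max C noeC Phi _ (Gi [::]).
  by exists [::].
exists xs; split=> // K Ki Kxs x Ix.
have Jx : J x.
  apply: (Jmax (Gen (x :: xs))) => //.
  - exists (x :: xs) => // y; rewrite inE => /orP [/eqP -> //|]; exact: Ixs.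
  - move=> z /JG Gz L Li Lxs; apply: Gz => // y yxs; apply: Lxs.
    by rewrite inE yxs orbT.
  - by move=> L _; apply; rewrite mem_head.
by move/JG: Jx; apply.
Qed.

Lemma in_rees_zero (C : comNzRingType) (I : C -> Prop) n x :
  (forall y, I y -> y = 0) -> ideal_pow I n.+1 x -> x = 0.
Proof.
move=> I0 [m [r [a [Ia ->]]]]; apply: big1 => i _.
by rewrite big_ord_recl (I0 _ (Ia _ _)) mul0r mulr0.
Qed.

Lemma ideal_pow0 (C : comNzRingType) (I : C -> Prop) x : ideal_pow I 0 x.
Proof.
exists 1%N, (fun=> x), (fun _ _ => 0); split=> [j []//|].
by rewrite big_ord1 big_ord0 mulr1.
Qed.

Lemma ideal_pow_exp (C : comNzRingType) (I : C -> Prop) s r n : I s -> ideal_pow I n (r * s ^+ n).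
Proof.
move=> Is; exists 1%N, (fun=> r), (fun _ _ => s); split=> //.
by rewrite big_ord1 prodr_const card_ord.
Qed.

Lemma in_rees_monomial (C : comNzRingType) (I : C -> Prop) c n :
  is_ideal I -> ideal_pow I n c -> in_rees I (c *: 'X^n).
Proof.
move=> [I0 _ _] Ic i; rewrite coefZ coefXn; have [->|_] := eqVneq; first by rewrite mulr1.
rewrite mulr0; have := @ideal_pow_exp C I 0 0 i I0; by rewrite mul0r.
Qed.

Lemma coef_comp_scale (C : comNzRingType) (f : {poly C}) s i :
  (f \Po (s *: 'X))`_i = f`_i * s ^+ i.
Proof.
rewrite comp_polyE coef_sum.
under eq_bigr => k _ do rewrite exprZn !coefZ coefXn.
have [lt|le] := ltnP i (size f).
  rewrite (bigD1 (Ordinal lt)) //= eqxx mulr1 big1 ?addr0 // => k nk.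
  by rewrite (_ : (i == k) = false) ?mulr0 // eq_sym; apply: negbTE.
rewrite (nth_default _ le) mul0r big1 // => k _.
by rewrite gtn_eqF ?mulr0 //; apply: leq_trans (ltn_ord k) le.
Qed.

Lemma comp_scale_eq0 (C : idomainType) (f : {poly C}) s :
  s != 0 -> f \Po (s *: 'X) = 0 -> f = 0.
Proof.
move=> ns /polyP E; apply/polyP => i; move: (E i); rewrite coef_comp_scale !coef0.
by move/eqP; rewrite mulf_eq0 (negbTE (expf_neq0 _ ns)) orbF => /eqP.
Qed.

Lemma comp_scale_denominator (C : comNzRingType) (p : {poly C}) s :
  exists N f, (s ^+ N)%:P * p = f \Po (s *: 'X).
Proof.
exists (size p), (\poly_(i < size p) (p`_i * s ^+ (size p - i))).
apply/polyP => i; rewrite coefCM coef_comp_scale coef_poly.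
have [lt|le] := ltnP i (size p); last by rewrite nth_default // mulr0 mul0r.
by rewrite -mulrA -exprD subnK; [exact: mulrC | exact: ltnW].
Qed.

(** The Rees algebra is generated by [R] and [I t]: a product of [n] elements of [I] times [t^n] is
    a product of [n] elements of [I t]. A subring is given here by the closure properties of [V]. *)
Lemma rees_subring (C : comNzRingType) (F : nzRingType) (j : {rmorphism {poly C} -> F})
    (I : C -> Prop) (V : F -> Prop) :
  (forall x y, V x -> V y -> V (x + y)) -> (forall x y, V x -> V y -> V (x * y)) ->
  (forall c, V (j c%:P)) -> (forall x, I x -> V (j (x *: 'X))) ->
  forall p, in_rees I p -> V (j p).
Proof.
move=> VD VM VC VX p Ip.
have V0 : V 0 by rewrite -(rmorph0 j) -polyC0.
have V1 : V 1 by rewrite -(rmorph1 j) -polyC1.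
rewrite -[p]coefK poly_def rmorph_sum; apply: (big_ind V) => // i _.
have [m [r [a [Ia ->]]]] := Ip i.
have -> : j ((\sum_k r k * \prod_l a k l) *: 'X^i) = \sum_k j ((r k * \prod_l a k l) *: 'X^i).
  by rewrite scaler_suml rmorph_sum.
apply: (big_ind V) => // k _.
rewrite -scalerA -mul_polyC rmorphM; apply: (VM) => //.
have -> : (\prod_l a k l) *: 'X^i = \prod_l (a k l *: 'X) :> {poly C}.
  rewrite -mul_polyC (rmorph_prod polyC) /=.
  rewrite -[in 'X^i](card_ord i) -prodr_const -big_split /=.
  by apply: eq_bigr => l _; rewrite mul_polyC.
rewrite (rmorph_prod j); apply: (big_ind V V1 VM) => l _; exact: VX.
Qed.

Section ReesAlgebras.
Variables (R : idomainType) (d : nat) (I : R -> Prop).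
Hypotheses (noeR : noetherian R) (dimR : krull_dim R d) (Ii : is_ideal I).
Variables (A : idomainType).

Lemma dim_poly_over (J : {poly R} -> Prop) : dim_over J d.+1.
Proof.
move=> m Q /(poly_chain noeR) [k [P [mk Pch _ _]]] _.
by apply: leq_trans mk _; rewrite ltnS; case: dimR => _; apply; exact: Pch.
Qed.

Lemma birational_extension (ev : {rmorphism {poly R} -> A}) (xs : seq A) :
  (forall x, x \in xs -> exists a b, ev a != 0 /\ ev a * x = ev b) ->
  (forall V : A -> Prop, (forall x y, V x -> V y -> V (x + y)) ->
     (forall x y, V x -> V y -> V (x * y)) -> (forall f, V (ev f)) ->
     (forall x, x \in xs -> V x) -> forall a, V a) ->
  noetherian A /\ dim_over (fun x : A => x = 0) d.+1.
Proof.
move=> xsden gen.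
have [C [ev' [noeC ev'ev ev'xs dimC]]] :=
  dim_adjoin_seq (noetherian_poly noeR) (@dim_poly_over _) xsden.
have surj : forall a, exists c, ev' c = a.
  apply: gen => //.
    by move=> _ _ [x <-] [y <-]; exists (x + y); rewrite rmorphD.
  by move=> _ _ [x <-] [y <-]; exists (x * y); rewrite rmorphM.
split; [exact: (@noetherian_surj _ _ _ surj noeC) | exact: (@dim_over_surj _ _ _ surj _ dimC)].
Qed.

Section Scaled.
Variables (F : idomainType) (psi : {rmorphism A -> F}) (j : {rmorphism {poly R} -> F}).
Hypotheses (psi_inj : injective psi) (j_inj : injective j).
Hypothesis rees_lift : forall p, in_rees I p -> exists a, psi a = j p.
Variable s0 : R.
Hypotheses (Is0 : I s0) (ns0 : s0 != 0).

(* Evaluation at [s0 t]: since [s0] is in [I], [R[t]] embeds in [A] this way,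
   and the two rings agree after inverting [s0]. *)
Lemma scaled_evaluation : exists ev : {rmorphism {poly R} -> A},
  injective ev /\ forall f, psi (ev f) = j (f \Po (s0 *: 'X)).
Proof.
have [|ev evE] := lift_morphism (g := j \o comp_poly (s0 *: 'X)) psi_inj.
  move=> f; apply: rees_lift => i; rewrite coef_comp_scale; exact: ideal_pow_exp.
exists ev; split=> // f g fg; apply/eqP; rewrite -subr_eq0; apply/eqP.
apply: (comp_scale_eq0 ns0); apply: j_inj.
by rewrite rmorph0 -[LHS]evE rmorphB fg subrr rmorph0.
Qed.

Lemma rees_generators : exists ys : seq A,
  (forall y, y \in ys -> exists x, psi y = j (x *: 'X)) /\
  forall V : A -> Prop, (forall x y, V x -> V y -> V (x + y)) ->
     (forall x y, V x -> V y -> V (x * y)) -> (forall c a, psi a = j c%:P -> V a) ->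
     (forall y, y \in ys -> V y) -> forall p a, in_rees I p -> psi a = j p -> V a.
Proof.
have [xs [Ixs genxs]] := ideal_generators noeR Ii.
have liftx x : I x -> exists a, psi a = j (x *: 'X).
  move=> Ix; apply: rees_lift; apply: (@in_rees_monomial R I x 1) => //.
  by rewrite -[x]mul1r -[X in _ * X]expr1; apply: ideal_pow_exp.
have [ys [ysj xsys]] : exists ys : seq A,
    (forall y, y \in ys -> exists x, psi y = j (x *: 'X)) /\
    forall x, x \in xs -> exists2 y, y \in ys & psi y = j (x *: 'X).
  elim: xs Ixs {genxs} => [|x xs IH] Ixs; first by exists [::].
  have [|ys [ysj xsys]] := IH.
    by move=> y yxs; apply: Ixs; rewrite inE yxs orbT.
  have [a Ea] := liftx x (Ixs x (mem_head _ _)).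
  exists (a :: ys); split=> y; rewrite inE => /orP [/eqP ->|yin].
  - by exists x.
  - exact: ysj.
  - by exists a => //; apply: mem_head.
  - by have [b bys Eb] := xsys y yin; exists b => //; rewrite inE bys orbT.
exists ys; split=> // V VD VM VC Vys p a Ip Ea.
pose W (z : F) := exists2 b, V b & psi b = z.
have WC c : W (j c%:P).
  have [b Eb] : exists b, psi b = j c%:P.
    apply: rees_lift; have := @in_rees_monomial R I c 0 Ii (ideal_pow0 I c).
    by rewrite expr0 alg_polyC.
  by exists b => //; apply: VC Eb.
have WD x y : W x -> W y -> W (x + y).
  by move=> [b Vb <-] [c Vc <-]; exists (b + c); [apply: VD|rewrite rmorphD].
have WM x y : W x -> W y -> W (x * y).
  by move=> [b Vb <-] [c Vc <-]; exists (b * c); [apply: VM|rewrite rmorphM].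
have [|b Vb Eb] := rees_subring WD WM WC _ Ip.
  apply: genxs => [|y /xsys [b bys Eb]]; last by exists b => //; apply: Vys.
  split.
  - by rewrite scale0r -polyC0.
  - by move=> x y Wx Wy; rewrite scalerDl rmorphD; apply: WD.
  - by move=> r x Wx; rewrite -scalerA -mul_polyC rmorphM; apply: WM.
by rewrite -(psi_inj (etrans Eb (esym Ea))).
Qed.

Lemma generator_denominator (ev : {rmorphism {poly R} -> A}) y x :
  (forall f, psi (ev f) = j (f \Po (s0 *: 'X))) -> psi y = j (x *: 'X) ->
  ev s0%:P * y = ev (x%:P * 'X).
Proof.
move=> evE Ey; apply: psi_inj; rewrite rmorphM !evE Ey -rmorphM; congr (j _).
by rewrite comp_polyM !comp_polyC comp_polyX !mul_polyC !scalerA mulrC.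
Qed.

End Scaled.

End ReesAlgebras.

(** * Cancellation over the two Rees algebras *)

Section ReesCancellation.
Variables (R : idomainType) (d : nat) (I : R -> Prop).
Hypotheses (noeR : noetherian R) (dimR : krull_dim R d) (Ii : is_ideal I).
Variable A : idomainType.

Lemma ideal_zero_or_not : (forall x, I x -> x = 0) \/ exists2 s, I s & s != 0.
Proof.
case: (classic (exists2 s, I s & s != 0)) => [|no]; [by right|left].
by move=> x Ix; apply: NNPP => nx; apply: no; exists x => //; apply/eqP.
Qed.

Section Rees.
Variable phi : {rmorphism A -> {poly R}}.
Hypothesis phi_inj : injective phi.
Hypothesis phi_img : forall f : {poly R}, in_rees I f <-> exists a, phi a = f.

Lemma rees_cancellation_nonzero s0 : I s0 -> s0 != 0 -> matrix_cancellation A d.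
Proof.
move=> Is0 ns0.
have lift p : in_rees I p -> exists a, phi a = idfun p by move/phi_img.
have [ev [ev_inj evE]] := scaled_evaluation (j := idfun) phi_inj (@inj_id _) lift Is0 ns0.
have [ys [ysj gen]] := rees_generators noeR Ii phi_inj lift.
have [|V VD VM Vev Vys a|noeA dimA] := @birational_extension R d noeR dimR A ev ys.
- move=> y /ysj [x Ex]; exists s0%:P, (x%:P * 'X).
  by rewrite (rmorph_eq0_inj _ ev_inj) polyC_eq0 ns0; split=> //;
     apply: (generator_denominator phi_inj evE Ex).
- apply: (gen V VD VM _ Vys (phi a)) => //; last by apply/phi_img; exists a.
  move=> c b Eb; rewrite (_ : b = ev c%:P) //; apply: phi_inj.
  by rewrite evE comp_polyC.
apply: (cancellation_polynomial noeR dimR noeA ev_inj dimA ns0) => a.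
have [N [f Ef]] := comp_scale_denominator (phi a) s0.
by exists N, f; apply: phi_inj; rewrite rmorphM !evE comp_polyC /= -Ef.
Qed.

Lemma rees_cancellation_zero : (forall x, I x -> x = 0) -> matrix_cancellation A d.
Proof.
move=> I0.
have [|ev evE] := lift_morphism (g := polyC) phi_inj.
  move=> c; apply/phi_img; have := @in_rees_monomial R I c 0 Ii (ideal_pow0 I c).
  by rewrite expr0 alg_polyC.
have surj a : exists c, ev c = a.
  exists (phi a)`_0; apply: phi_inj; rewrite evE; apply/polyP => -[|i]; rewrite coefC //=.
  have Ra : in_rees I (phi a) by apply/phi_img; exists a.
  exact/esym/(in_rees_zero I0 (Ra i.+1)).
have noeA : noetherian A := @noetherian_surj _ _ _ surj noeR.
apply: (cancellation_small_dim noeA).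
exact: (@dim_over_surj _ _ _ surj _ (@krull_dim_over _ _ dimR _)).
Qed.

Lemma rees_cancellation : matrix_cancellation A d.
Proof.
case: ideal_zero_or_not => [|[s Is ns]]; first exact: rees_cancellation_zero.
exact: rees_cancellation_nonzero Is ns.
Qed.

End Rees.

Section ExtendedRees.
Local Notation toF := (@FracField.tofrac {poly R}).
Variable psi : {rmorphism A -> {fraction {poly R}}}.
Hypothesis psi_inj : injective psi.
Hypothesis psi_img : forall f : {fraction {poly R}}, in_ext_rees I f <-> exists a, psi a = f.

Lemma ext_rees_lift p : in_rees I p -> exists a, psi a = toF p.
Proof.
move=> Ip; apply/psi_img; exists 0%N, p; split=> [|i]; last by rewrite subn0.
by rewrite expr0 tofrac1 divr1.
Qed.

Lemma ext_rees_inverse : exists w, psi w = (toF 'X)^-1.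
Proof.
apply/psi_img; exists 1%N, 1; split=> [|i]; first by rewrite tofrac1 div1r expr1.
rewrite coef1; case: i => [|i]; first exact: ideal_pow0.
by case: Ii => I0 _ _; have := ideal_pow_exp 0 (i.+1 - 1) I0; rewrite mul0r.
Qed.

Lemma tofracX_neq0 : toF 'X != 0.
Proof. by rewrite tofrac_eq0 polyX_eq0. Qed.

(* Splitting [p / X^k] by degree: the terms of degree at most [k] are
   polynomials in [w = 1/X], the others lie in the Rees algebra. *)
Lemma ext_rees_induction (V : A -> Prop) w : psi w = (toF 'X)^-1 ->
  (forall x y, V x -> V y -> V (x + y)) -> (forall x y, V x -> V y -> V (x * y)) ->
  V 0 -> V 1 -> V w -> (forall a c, psi a = toF c%:P -> V a) ->
  (forall p a, in_rees I p -> psi a = toF p -> V a) -> forall a, V a.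
Proof.
move=> Ew VD VM V0 V1 Vw VC VI a.
have [k [p [Ea Ip]]] : in_ext_rees I (psi a) by apply/psi_img; exists a.
pose W (z : {fraction {poly R}}) := exists2 b, V b & psi b = z.
have WD x y : W x -> W y -> W (x + y).
  by move=> [b Vb <-] [c Vc <-]; exists (b + c); [apply: VD|rewrite rmorphD].
have Vwn n : V (w ^+ n).
  by elim: n => [|n IH]; rewrite ?expr0 ?exprS //; apply: VM.
have nX n : toF 'X ^+ n != 0 by rewrite expf_neq0 ?tofracX_neq0.
suff [b Vb Eb] : W (psi a) by rewrite -(psi_inj Eb).
have -> : psi a = \sum_(i < size p) (toF (p`_i *: 'X^i) / toF 'X^k).
  by rewrite Ea -[p in LHS]coefK poly_def raddf_sum mulr_suml.
apply: (big_ind W) => //; first by exists 0 => //; rewrite rmorph0.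
move=> i _; have [lt|le] := ltnP k i.
  have Ri : in_rees I (p`_i *: 'X^(i - k)) by apply: in_rees_monomial.
  have [b Eb] := ext_rees_lift Ri; exists b; first exact: VI Eb.
  have -> : 'X^i = 'X^(i - k) * 'X^k :> {poly R} by rewrite -exprD subnK // ltnW.
  rewrite Eb -!mul_polyC !tofracM !tofracXn.
  rewrite mulrA mulfK; [reflexivity | exact: nX].
have Ri : in_rees I (p`_i)%:P.
  by have := in_rees_monomial Ii (ideal_pow0 I p`_i); rewrite expr0 alg_polyC.
have [b Eb] := ext_rees_lift Ri; exists (b * w ^+ (k - i)).
  by apply: VM => //; apply: VC Eb.
have -> : 'X^k = 'X^i * 'X^(k - i) :> {poly R} by rewrite -exprD subnKC.
rewrite rmorphM rmorphXn Eb Ew -mul_polyC !tofracM !tofracXn -mulrA; congr (_ * _).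
by rewrite invfM mulrA (mulfV (nX i)) mul1r exprVn.
Qed.

Lemma ext_rees_cancellation_nonzero s0 : I s0 -> s0 != 0 -> matrix_cancellation A d.
Proof.
move=> Is0 ns0.
have [ev [ev_inj evE]] := scaled_evaluation psi_inj (@tofrac_inj _) ext_rees_lift Is0 ns0.
have [ys [ysj gen]] := rees_generators noeR Ii psi_inj ext_rees_lift.
have [w Ew] := ext_rees_inverse.
have EX : psi (ev 'X) = toF s0%:P * toF 'X.
  by rewrite evE comp_polyX -mul_polyC rmorphM.
have Xw : ev 'X * w = ev s0%:P.
  by apply: psi_inj; rewrite rmorphM EX evE comp_polyC Ew mulfK ?tofracX_neq0.
have evC c a : psi a = toF c%:P -> a = ev c%:P.
  by move=> Ea; apply: psi_inj; rewrite evE comp_polyC.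
have [y|V VD VM Vev Vys|noeA dimA] := @birational_extension R d noeR dimR A ev (w :: ys).
- rewrite inE => /orP [/eqP ->|/ysj [x Ex]].
    by exists 'X, s0%:P; rewrite (rmorph_eq0_inj _ ev_inj) polyX_eq0.
  exists s0%:P, (x%:P * 'X).
  by rewrite (rmorph_eq0_inj _ ev_inj) polyC_eq0 ns0; split=> //;
     apply: (generator_denominator psi_inj evE Ex).
- apply: (ext_rees_induction Ew) => //.
  + by rewrite -(rmorph0 ev).
  + by rewrite -(rmorph1 ev).
  + by apply: Vys; rewrite mem_head.
  + by move=> a c /evC ->.
  apply: gen => // [c a /evC -> //|y yys]; by apply: Vys; rewrite inE yys orbT.
apply: (cancellation_laurent noeR dimR noeA ev_inj dimA ns0 _ Xw) => a.
have [k [p [Ea _]]] : in_ext_rees I (psi a) by apply/psi_img; exists a.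
have [N [f Ef]] := comp_scale_denominator p s0.
exists N, k, ((s0 ^+ k)%:P * f); apply: psi_inj.
rewrite !(rmorphM ev) !(rmorphM psi) (rmorphXn ev) (rmorphXn psi) EX !evE !comp_polyC -Ef Ea.
rewrite exprMn /= !tofracM !tofracXn !polyC_exp !tofracXn.
have nX : toF 'X ^+ k != 0 by rewrite expf_neq0 ?tofracX_neq0.
by rewrite -[RHS](mulfK nX) !mulrA; congr (_ / _); ring.
Qed.

(** Evaluation of [X] at [w = t^-1] is an isomorphism from [R[X]] onto [A], so the polynomial case
    applies with [s0 = 1]. *)
Lemma ext_rees_cancellation_zero : (forall x, I x -> x = 0) -> matrix_cancellation A d.
Proof.
move=> I0.
have [w Ew] := ext_rees_inverse.
have [|ev0 ev0E] := lift_morphism (g := toF \o polyC) psi_inj.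
  move=> c; apply: ext_rees_lift; have := in_rees_monomial Ii (ideal_pow0 I c).
  by rewrite expr0 alg_polyC.
pose ev : {rmorphism {poly R} -> A} := horner_morph (fun c => mulrC w (ev0 c)).
have evC c : ev c%:P = ev0 c by rewrite /ev /= horner_morphC.
have evX : ev 'X = w by rewrite /ev /= horner_morphX.
clearbody ev.
have nX n : toF 'X ^+ n != 0 by rewrite expf_neq0 ?tofracX_neq0.
have ev_inj : injective ev.
  move=> f g fg; apply/eqP; rewrite -subr_eq0; apply/eqP.
  have : ev (f - g) = 0 by rewrite rmorphB fg subrr.
  move: (f - g) => h h0; apply/polyP => i; rewrite coef0.
  have [lt|] := ltnP i (size h); last exact: nth_default.
  (* Multiplication by [X ^ size h] turns the polynomial [h] in [1/X] into one with the coefficients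
     of [h] in reverse order. *)
  have E0 : \sum_(i < size h) (h`_i)%:P * 'X^(size h - i) = 0.
    apply: (@tofrac_inj {poly R}); rewrite rmorph0 -[RHS](mul0r (toF 'X ^+ size h)).
    have <- : psi (ev h) = 0 by rewrite h0 rmorph0.
    have -> : psi (ev h) = \sum_(k < size h) psi (ev (h`_k *: 'X^k)).
      by rewrite -!rmorph_sum -poly_def coefK.
    rewrite rmorph_sum mulr_suml; apply: eq_bigr => k _.
    rewrite -[h`_k *: _]mul_polyC (rmorphM ev) evC (rmorphXn ev) evX /=.
    rewrite (rmorphM psi) (rmorphXn psi) ev0E Ew tofracM tofracXn /= -mulrA; congr (_ * _).
    have -> : toF 'X ^+ size h = toF 'X ^+ k * toF 'X ^+ (size h - k).
      by rewrite -exprD subnKC // ltnW.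
    by rewrite mulrA -exprMn mulVf ?tofracX_neq0 // expr1n mul1r.
  have /polyP/(_ (size h - i)%N) := E0; rewrite coef0 coef_sum (bigD1 (Ordinal lt)) //=.
  rewrite coefCM coefXn eqxx mulr1 big1 ?addr0 // => k nk.
  rewrite coefCM coefXn (_ : _ == _ = false) ?mulr0 //.
  by apply/eqP => E; case/eqP: nk; apply: val_inj => /=; have := ltn_ord k; lia.
have surj a : exists c, ev c = a.
  pose V a := exists c, ev c = a.
  apply: (ext_rees_induction (V := V) Ew).
  - by move=> _ _ [x <-] [y <-]; exists (x + y); rewrite rmorphD.
  - by move=> _ _ [x <-] [y <-]; exists (x * y); rewrite rmorphM.
  - by exists 0; rewrite rmorph0.
  - by exists 1; rewrite rmorph1.
  - by exists 'X.
  - by move=> b c Eb; exists c%:P; apply: psi_inj; rewrite evC ev0E.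
  - move=> p b Ip Eb; exists (p`_0)%:P; apply: psi_inj; rewrite evC ev0E Eb /=; congr toF.
    apply/polyP => -[|i]; rewrite coefC //=; exact/esym/(in_rees_zero I0 (Ip i.+1)).
have noeA : noetherian A := @noetherian_surj _ _ _ surj (noetherian_poly noeR).
have dimA := @dim_over_surj _ _ _ surj _ (@dim_poly_over _ _ noeR dimR _).
apply: (cancellation_polynomial noeR dimR noeA ev_inj dimA (oner_neq0 R)) => a.
by have [f <-] := surj a; exists 0%N, f; rewrite expr0 polyC1 rmorph1 mul1r.
Qed.

Lemma ext_rees_cancellation : matrix_cancellation A d.
Proof.
case: ideal_zero_or_not => [|[s Is ns]]; first exact: ext_rees_cancellation_zero.
exact: ext_rees_cancellation_nonzero Is ns.
Qed.

End ExtendedRees.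

End ReesCancellation.

Theorem theorem3p8 (R : idomainType) (d : nat) (I : R -> Prop) :
  noetherian R -> krull_dim R d -> is_ideal I ->
  (* (1) the Rees algebra A = R[It], given up to isomorphism *)
  (forall (A : idomainType) (phi : {rmorphism A -> {poly R}}),
     injective phi ->
     (forall f : {poly R}, in_rees I f <-> exists a, phi a = f) ->
     forall (P : lmodType A) (r : nat),
       fg_projective_of_rank P r -> (d < r)%N ->
       forall (b : A) (p : P), unimodular (b : A^o, p) ->
       exists s : {linear (A^o * P)%type -> (A^o * P)%type},
         is_automorphism s /\ s (b : A^o, p) = (1 : A^o, 0)) /\
  (* (2) the extended Rees algebra A = R[It, t^-1], given up to isomorphism *)
  (forall (A : idomainType) (psi : {rmorphism A -> {fraction {poly R}}}),
     injective psi ->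
     (forall f : {fraction {poly R}}, in_ext_rees I f <-> exists a, psi a = f) ->
     forall (P : lmodType A) (r : nat),
       fg_projective_of_rank P r -> (d < r)%N ->
       forall (b : A) (p : P), unimodular (b : A^o, p) ->
       exists s : {linear (A^o * P)%type -> (A^o * P)%type},
         is_automorphism s /\ s (b : A^o, p) = (1 : A^o, 0)).
Proof.
move=> noeR dimR Ii; split=> A psi psi_inj psi_img; apply: matrix_cancellation_modules.
  exact: rees_cancellation psi_img.
exact: ext_rees_cancellation psi_img.
Qed.
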